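(* Let $n\ge 1$, let $D\subseteq\mathbb{C}$ be a domain and let $\mathcal{F}$ be a family of holomorphic curves $f:D\to\mathbb{P}^n$. Let $H_1,\dots,H_{2n+1}$ be $2n+1$ hyperplanes in general position in $\mathbb{P}^n$, and assume that the first $n+1$ of them are the coordinate hyperplanes of $\mathbb{P}^n$, i.e. $H_l=\{[w_0:\cdots:w_n]\in\mathbb{P}^n : w_{l-1}=0\}$ for $l=1,\dots,n+1$. For $f\in\mathcal{F}$ and $l\in\{0,\dots,n\}$ put $$U_{f,l}:=\{z\in D : f(z)\in\{[w_0:\cdots:w_n] : w_l\neq 0\}\},$$ and, when $U_{f,l}\neq\emptyset$, let $\widetilde{f}^{\,l}=(f^l_0,\dots,f^l_n)$ be the reduced representation of $f$ on $U_{f,l}$ such that $f^l_l\equiv 1$ on $U_{f,l}$. Suppose that (a) for each pair $f,g\in\mathcal{F}$, $f^{-1}(H_k)=g^{-1}(H_k)$ for each $k\in\{1,\dots,n+1\}$; (b) for each compact set $K\subset D$ there exists a finite number $M=M(K)>0$ such that for each $f\in\mathcal{F}$ and each $l\in\{0,\dots,n\}$ for which $U_{f,l}\neq\emptyset$, the inequality $$\big|\big((\widetilde{f}^{\,l})^*H_k\big)^{(q)}(z)\big|\le M\qquad\text{for all } q\in\{1,\dots,n\}\text{ and all } z\in f^{-1}(H_k)\cap K\cap U_{f,l}$$ holds for each $k\in\{n+2,\dots,2n+1\}$. Then the family $\mathcal{F}$ is normal.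
   Context: Fix a system of homogeneous coordinates $[w_0:\cdots:w_n]$ on the complex projective space $\mathbb{P}^n$. A hyperplane is a set $H=\{[w_0:\cdots:w_n] : \sum_{l=0}^n a_lw_l=0\}$ with $(a_0,\dots,a_n)\in\mathbb{C}^{n+1}$ non-zero; for each hyperplane such a coefficient vector is fixed. Hyperplanes $H_1,\dots,H_q$ with $q\ge n+1$ are in general position if $\bigcap_{k\in R}H_k=\emptyset$ for every $R\subset\{1,\dots,q\}$ with $|R|=n+1$. A holomorphic curve of $D$ into $\mathbb{P}^n$ is a holomorphic mapping $f:D\to\mathbb{P}^n$. A reduced representation of $f$ on an open set $U\subseteq D$ is a holomorphic map $\widetilde f=(f_0,\dots,f_n):U\to\mathbb{C}^{n+1}$ whose components have no common zero in $U$ and such that $f(z)=[f_0(z):\cdots:f_n(z)]$ for all $z\in U$. For a hyperplane $H$ with coefficients $(a_0,\dots,a_n)$ put $\widetilde f^*H:=a_0f_0+\cdots+a_nf_n$, a holomorphic function on $U$. The superscript $(q)$ denotes the $q$-th derivative. A family $\mathcal{F}\subset\operatorname{Hol}(D,\mathbb{P}^n)$ is normal if it is relatively compact in $\operatorname{Hol}(D,\mathbb{P}^n)$, the space of holomorphic maps $D\to\mathbb{P}^n$ with the compact-open topology. *)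

(* Defs.v *)
From HB Require Import structures.
From mathcomp Require Import all_boot all_order all_algebra.
From mathcomp Require Import generic_quotient.
From mathcomp Require Import complex.
From mathcomp Require Import all_classical all_reals all_analysis.

Set Implicit Arguments.
Unset Strict Implicit.
Unset Printing Implicit Defensive.

Import Order.TTheory GRing.Theory Num.Theory.
Import numFieldNormedType.Exports.

Local Open Scope classical_set_scope.
Local Open Scope ring_scope.
Local Open Scope quotient_scope.

(* The topology and the normed structure of [R[i]] are inferred through its
   [numClosedFieldType] structure, so that [derivable] and [derive1n] below are
   complex differentiation. *)
Definition CC (R : realType) : numClosedFieldType := R[i].

Section ProjectiveSpace.
Context (R : realType) (n : nat).
Local Notation C := (CC R).

Definition nzvec : Type := [set w : 'rV[C]_n.+1 | w != 0].

HB.instance Definition _ := Topological.on nzvec.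

Definition scaled (v w : nzvec) : bool :=
  `[< exists2 c : C, c != 0 & set_val w = c *: set_val v >].

Lemma scaled_refl : reflexive scaled.
Proof. by move=> v; apply/asboolP; exists 1; rewrite ?oner_neq0 ?scale1r. Qed.

Lemma scaled_sym : symmetric scaled.
Proof.
suff H v w : scaled v w -> scaled w v by move=> v w; apply/idP/idP; exact: H.
move=> /asboolP[c c0 e]; apply/asboolP; exists c^-1; first by rewrite invr_eq0.
by rewrite e scalerA mulVf // scale1r.
Qed.

Lemma scaled_trans : transitive scaled.
Proof.
move=> v u w /asboolP[c c0 e] /asboolP[d d0 e']; apply/asboolP.
by exists (d * c); rewrite ?mulf_neq0 // e' e scalerA.
Qed.

Definition scaled_equiv := EquivRel _ scaled_refl scaled_sym scaled_trans.

Definition PP : Type := {eq_quot scaled_equiv}.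

HB.instance Definition _ := Topological.copy PP (quotient_topology PP).
HB.instance Definition _ := Quotient.on PP.

Definition to_PP (w : nzvec) : PP := \pi_PP w.

Lemma to_PP_eqP (v w : nzvec) :
  to_PP v = to_PP w <-> exists2 c : C, c != 0 & set_val w = c *: set_val v.
Proof. by split=> [/eqmodP/asboolP //|h]; apply/eqmodP/asboolP. Qed.

Definition pairing (a w : 'rV[C]_n.+1) : C := \sum_(l < n.+1) a ord0 l * w ord0 l.

Definition hyperplane (a : 'rV[C]_n.+1) : set PP :=
  to_PP @` [set w : nzvec | pairing a (set_val w) = 0].

Definition coord_hyperplane (l : 'I_n.+1) : set PP :=
  to_PP @` [set w : nzvec | set_val w ord0 l = 0].

Definition coord_open (l : 'I_n.+1) : set PP :=
  to_PP @` [set w : nzvec | set_val w ord0 l != 0].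

(* The affine coordinates (w_j / w_l) for j <> l; junk outside
   [coord_open l], see [chart_to_PP]. *)
Definition chart (l : 'I_n.+1) (p : PP) : 'rV[C]_n :=
  let w := set_val (repr p) in \row_j (w ord0 (lift l j) / w ord0 l).

Lemma chart_to_PP (l : 'I_n.+1) (w : nzvec) :
  chart l (to_PP w) =
  \row_j (set_val w ord0 (lift l j) / set_val w ord0 l).
Proof.
have [c c0 e] : exists2 c : C, c != 0 & set_val w = c *: set_val (repr (to_PP w)).
  by apply/to_PP_eqP; rewrite /to_PP reprK.
apply/rowP => j; rewrite !mxE e !mxE -mulf_div mulfV // mul1r //.
Qed.

Definition general_position (q : nat) (a : 'I_q -> 'rV[C]_n.+1) : Prop :=
  forall S : {set 'I_q}, #|S| = n.+1 ->
    \bigcap_(k in [set` S]) hyperplane (a k) = set0.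

End ProjectiveSpace.

Arguments coord_hyperplane {R n} l.
Arguments coord_open {R n} l.
Arguments to_PP {R n} w.

Section HolomorphicCurves.
Context (R : realType) (n : nat).
Local Notation C := (CC R).

Definition is_domain (D : set C) : Prop := [/\ D !=set0, open D & connected D].

Definition holomorphic_on (U : set C) (g : C -> C) : Prop :=
  forall z, U z -> derivable g z 1.

Variable D : set C.

Definition curve_preimage (f : D -> PP R n) (A : set (PP R n)) : set C :=
  set_val @` (f @^-1` A).

(* [valL_ 0] extends a function on D to C by 0; since D is going to be open,
   this does not affect differentiability at the points of D. *)
Definition holomorphic_curve (f : D -> PP R n) : Prop :=
  continuous f /\
  forall (l : 'I_n.+1) (j : 'I_n),
    holomorphic_on (curve_preimage f (coord_open l))
      (valL_ 0 (fun z : D => chart l (f z) ord0 j)).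

Definition Hol : Type :=
  [set f : {compact-open, D -> PP R n} | holomorphic_curve f].

HB.instance Definition _ := Topological.on Hol.

Definition curve (f : Hol) : D -> PP R n := set_val f.

Definition normal_family (F : set Hol) : Prop := precompact F.

(* That the components have no common zero is part of the typing [w : nzvec]
   in the last condition. *)
Definition reduced_rep (f : D -> PP R n) (U : set C) (ft : C -> 'rV[C]_n.+1) :
    Prop :=
  [/\ open U, U `<=` D,
      forall l, holomorphic_on U (fun z => ft z ord0 l) &
      forall z : D, U (set_val z) ->
        exists2 w : nzvec R n, set_val w = ft (set_val z) & f z = to_PP w].

Definition pullback (ft : C -> 'rV[C]_n.+1) (a : 'rV[C]_n.+1) (z : C) : C :=
  pairing a (ft z).

End HolomorphicCurves.

Arguments Hol {R} n D.

(* Main.v *)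
From HB Require Import structures.
Require Import Defs.
From mathcomp Require Import all_boot all_order all_algebra.
From mathcomp Require Import zify ring lra.
From mathcomp Require Import complex.
From mathcomp Require Import all_classical all_reals all_analysis.

Set Implicit Arguments.
Unset Strict Implicit.
Unset Printing Implicit Defensive.
Import Order.TTheory GRing.Theory Num.Theory.
Import numFieldNormedType.Exports.
Local Open Scope classical_set_scope.
Local Open Scope ring_scope.

(** Zalcman's rescaling method. Near a point [z0] some homogeneous coordinate
    of every curve of the family is free of zeros, because the curves share the
    inverse images of the coordinate hyperplanes; normalising it to 1 gives
    lifts, each of whose components is identically zero or has no zero except
    perhaps [z0]. Suppose that the spherical derivatives of these lifts are not
    bounded near [z0]. Rescaling around nearly maximal points of the spherical
    derivative ([zalcman_point]), a subsequence, or rather an ultrafilter,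
    gives a limit: a nonconstant entire curve [th] with bounded spherical
    derivative, one component of which is 1. Centring the rescaling at [z0]
    when the maximal points are close to it, at these points otherwise, each
    component of [th] is zero or free of zeros off the origin. By hypothesis
    (b), the derivatives of orders 1 to n of the pulled back equation of a
    further hyperplane are small at its zeros after rescaling, so by Hurwitz's
    theorem the entire function [\sum_i a_ki th_i] vanishes to order n+1 at
    each of its zeros off the origin.

    Such a curve is constant ([rigidity]). A bounded spherical derivative
    bounds the circle means of the logarithm of the norm by a power of the
    radius ([growth]): in the logarithmic coordinate the dbar derivative of the
    logarithmic derivative of the squared norm is the spherical derivative
    times the squared modulus, and its integral over a strip is controlled by
    Goursat's argument. So each nonzero component is a constant times
    [z^m exp(h(z))] with [h] a polynomial. A linear combination of at most n+1
    such terms whose zeros off the origin have order at least n+1 has a single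
    term ([few_terms]): first order operators annihilate the terms one by one,
    each at the cost of one order of vanishing, which leaves finitely many
    zeros; then growth and linear independence of exponentials finish. If two
    components of [th] were of different types, each of the n further
    hyperplanes would therefore contain one of two points with disjoint
    supports; general position allows at most |J| - 1 of them to pass through a
    point with support J ([card_killers]), hence at most n - 1 in all.

    So the spherical derivative is bounded near each point ([local_bound]), and
    then one homogeneous coordinate dominates the others on a disc of uniform
    size ([dominant]). The curves dominated in this way on prescribed discs
    form a compact closed set ([stars_compact]), since along an ultrafilter
    their bounded affine coordinates converge locally uniformly.

    Complex analysis is developed from real differentiability, with both
    Wirtinger derivatives ([rdiff]), because the argument uses the dbar
    derivative of functions that are not holomorphic. *)

(** * Real and imaginary parts, conjugation and modulus with real values *)

Section ComplexNumbers.
Context {R : realType}.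
Local Notation C := (CC R).
Implicit Types (z w : C) (x y : R).

Definition rc x : C := Complex x 0.
Definition mkc x y : C := Complex x y.
Definition re z : R := complex.Re z.
Definition im z : R := complex.Im z.
Definition cj z : C := conjc z.
Definition nm z : R := re `|z|.

Lemma eqC z w : re z = re w -> im z = im w -> z = w.
Proof. by case: z => a b; case: w => c d /= -> ->. Qed.

Lemma reD z w : re (z + w) = re z + re w. Proof. by case: z; case: w. Qed.
Lemma imD z w : im (z + w) = im z + im w. Proof. by case: z; case: w. Qed.
Lemma reN z : re (- z) = - re z. Proof. by case: z. Qed.
Lemma imN z : im (- z) = - im z. Proof. by case: z. Qed.
Lemma reB z w : re (z - w) = re z - re w. Proof. by rewrite reD reN. Qed.
Lemma imB z w : im (z - w) = im z - im w. Proof. by rewrite imD imN. Qed.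
Lemma reM z w : re (z * w) = re z * re w - im z * im w.
Proof. by case: z; case: w. Qed.
Lemma imM z w : im (z * w) = re z * im w + im z * re w.
Proof. by case: z; case: w. Qed.
Lemma re0 : re 0 = 0. Proof. by []. Qed.
Lemma im0 : im 0 = 0. Proof. by []. Qed.
Lemma re1 : re 1 = 1. Proof. by []. Qed.
Lemma im1 : im 1 = 0. Proof. by []. Qed.
Lemma re_rc x : re (rc x) = x. Proof. by []. Qed.
Lemma im_rc x : im (rc x) = 0. Proof. by []. Qed.
Lemma re_mk x y : re (mkc x y) = x. Proof. by []. Qed.
Lemma im_mk x y : im (mkc x y) = y. Proof. by []. Qed.
Lemma re_cj z : re (cj z) = re z. Proof. by case: z. Qed.
Lemma im_cj z : im (cj z) = - im z. Proof. by case: z. Qed.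

Definition reimE := (reD, imD, reN, imN, reM, imM, re0, im0, re1, im1, re_rc,
  im_rc, re_mk, im_mk, re_cj, im_cj).

Lemma rcD x y : rc (x + y) = rc x + rc y.
Proof. by apply: eqC; rewrite !reimE ?addr0. Qed.
Lemma rcN x : rc (- x) = - rc x.
Proof. by apply: eqC; rewrite !reimE ?oppr0. Qed.
Lemma rcB x y : rc (x - y) = rc x - rc y. Proof. by rewrite rcD rcN. Qed.
Lemma rcM x y : rc (x * y) = rc x * rc y.
Proof. by apply: eqC; rewrite !reimE ?mulr0 ?mul0r ?subr0 ?addr0. Qed.
Lemma rc0 : rc 0 = 0. Proof. by []. Qed.
Lemma rc1 : rc 1 = 1. Proof. by []. Qed.
Lemma rcI x y : rc x = rc y -> x = y. Proof. by case. Qed.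
Lemma rcX x k : rc (x ^+ k) = rc x ^+ k.
Proof. by elim: k => [|k ih]; rewrite ?expr0 // !exprS rcM ih. Qed.
Lemma rc_nat k : rc (k%:R) = k%:R.
Proof. by elim: k => [|k ih] //; rewrite -addn1 !natrD rcD ih. Qed.
Lemma rc_eq0 x : (rc x == 0) = (x == 0).
Proof. by apply/eqP/eqP => [/rcI|->]. Qed.
Lemma rcV x : rc x^-1 = (rc x)^-1.
Proof.
have [->|x0] := eqVneq x 0; first by rewrite !rc0 !invr0.
by apply: (mulfI (x := rc x)); rewrite ?rc_eq0 // -rcM !divff // rc_eq0.
Qed.
Lemma rc_sum (I : Type) (s : seq I) (P : pred I) (f : I -> R) :
  rc (\sum_(i <- s | P i) f i) = \sum_(i <- s | P i) rc (f i).
Proof. exact: (big_morph rc rcD rc0). Qed.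
Lemma cjD z w : cj (z + w) = cj z + cj w.
Proof. by apply: eqC; rewrite !reimE ?opprD. Qed.
Lemma cjN z : cj (- z) = - cj z. Proof. by apply: eqC; rewrite !reimE. Qed.
Lemma cjB z w : cj (z - w) = cj z - cj w. Proof. by rewrite cjD cjN. Qed.
Lemma cjM z w : cj (z * w) = cj z * cj w.
Proof. by apply: eqC; rewrite !reimE; ring. Qed.
Lemma cjK z : cj (cj z) = z. Proof. by apply: eqC; rewrite !reimE ?opprK. Qed.
Lemma cj_rc x : cj (rc x) = rc x. Proof. by apply: eqC; rewrite !reimE ?oppr0. Qed.
Lemma cj0 : cj 0 = 0. Proof. by rewrite -rc0 cj_rc. Qed.
Lemma cj1 : cj 1 = 1. Proof. by rewrite -rc1 cj_rc. Qed.
Lemma cj_sum (I : Type) (s : seq I) (P : pred I) (f : I -> C) :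
  cj (\sum_(i <- s | P i) f i) = \sum_(i <- s | P i) cj (f i).
Proof. exact: (big_morph cj cjD cj0). Qed.

Lemma normE z : `|z| = rc (nm z).
Proof. by case: z. Qed.
Lemma nm_def z : nm z = Num.sqrt (re z ^+ 2 + im z ^+ 2).
Proof. by case: z. Qed.
Lemma sqr_nm z : nm z ^+ 2 = re z ^+ 2 + im z ^+ 2.
Proof. by rewrite nm_def sqr_sqrtr // addr_ge0 ?sqr_ge0. Qed.
Lemma nm_ge0 z : 0 <= nm z. Proof. by rewrite nm_def sqrtr_ge0. Qed.
Lemma mulcj z : z * cj z = rc (nm z ^+ 2).
Proof. by rewrite sqr_nm; apply: eqC; rewrite !reimE; ring. Qed.
Lemma nmM z w : nm (z * w) = nm z * nm w.
Proof. by apply: rcI; rewrite rcM -!normE normrM. Qed.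
Lemma nmD z w : nm (z + w) <= nm z + nm w.
Proof.
by have := ler_normD z w; rewrite !normE -rcD -[rc _ <= _]/((_ == _) && (_ <= _)) => /andP[].
Qed.
Lemma nmN z : nm (- z) = nm z. Proof. by apply: rcI; rewrite -!normE normrN. Qed.
Lemma nmB z w : nm (z - w) <= nm z + nm w. Proof. by rewrite -(nmN w) nmD. Qed.
Lemma nmBC z w : nm (z - w) = nm (w - z). Proof. by rewrite -nmN opprB. Qed.
Lemma nm0 : nm 0 = 0. Proof. by apply: rcI; rewrite -normE normr0. Qed.
Lemma nm1 : nm 1 = 1. Proof. by apply: rcI; rewrite -normE normr1. Qed.
Lemma nm_eq0 z : (nm z == 0) = (z == 0).
Proof. by rewrite -rc_eq0 -normE normr_eq0. Qed.
Lemma nm_gt0 z : (0 < nm z) = (z != 0).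
Proof. by rewrite lt_neqAle nm_ge0 andbT eq_sym nm_eq0. Qed.
Lemma nmV z : nm z^-1 = (nm z)^-1.
Proof. by apply: rcI; rewrite rcV -!normE normfV. Qed.
Lemma nmX z k : nm (z ^+ k) = nm z ^+ k.
Proof. by elim: k => [|k ih]; rewrite ?expr0 ?nm1 // !exprS nmM ih. Qed.
Lemma nm_rc x : nm (rc x) = `|x|.
Proof. by rewrite nm_def !reimE expr0n addr0 sqrtr_sqr. Qed.
Lemma nm_cj z : nm (cj z) = nm z.
Proof. by rewrite !nm_def !reimE sqrrN. Qed.
Lemma nm_nat k : nm (k%:R : C) = k%:R.
Proof. by rewrite -rc_nat nm_rc normr_nat. Qed.
Lemma re_le_nm z : `|re z| <= nm z.
Proof. by rewrite nm_def -sqrtr_sqr ler_wsqrtr // lerDl sqr_ge0. Qed.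
Lemma im_le_nm z : `|im z| <= nm z.
Proof. by rewrite nm_def -sqrtr_sqr ler_wsqrtr // lerDr sqr_ge0. Qed.
Lemma re_le z : re z <= nm z. Proof. exact: le_trans (ler_norm _) (re_le_nm z). Qed.
Lemma nm_le_reim z : nm z <= `|re z| + `|im z|.
Proof.
rewrite -(@ger0_norm _ (_ + _)) ?addr_ge0 // -ler_sqr ?nnegrE ?nm_ge0 ?normr_ge0 //.
rewrite sqr_nm ger0_norm ?addr_ge0 // sqrrD !real_normK ?num_real //.
by rewrite -addrA addrCA lerDr mulrn_wge0 // mulr_ge0.
Qed.
Lemma nm_sum (I : Type) (s : seq I) (P : pred I) (f : I -> C) :
  nm (\sum_(i <- s | P i) f i) <= \sum_(i <- s | P i) nm (f i).
Proof.
apply: (big_ind2 (fun z x => nm z <= x)) => [|z x w y zx wy|//]; rewrite ?nm0 //.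
by apply: le_trans (nmD _ _) _; apply: lerD.
Qed.
Lemma ler_nmB z w : nm z - nm w <= nm (z - w).
Proof. by rewrite lerBlDr -{1}(subrK w z) nmD. Qed.
Lemma reimK z : z = rc (re z) + mkc 0 1 * rc (im z).
Proof. by apply: eqC; rewrite !reimE; ring. Qed.
Lemma nm_mk01 : nm (mkc 0 1) = 1.
Proof. by rewrite nm_def !reimE expr0n add0r expr1n sqrtr1. Qed.

Lemma ltC_rc x y : (rc x < rc y) = (x < y).
Proof. exact: ltcR. Qed.
Lemma leC_rc x y : (rc x <= rc y) = (x <= y).
Proof. exact: lecR. Qed.
Lemma posC (e : C) : 0 < e -> exists2 x, 0 < x & e = rc x.
Proof.
case: e => a b; rewrite -[_ < _]/((_ == _) && (_ < _)) => /andP[/eqP/= -> a0].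
by exists a.
Qed.

(** ** Continuity *)

Lemma cvgCP (T : Type) (F : set_system T) (f : T -> C) (l : C) : Filter F ->
  (forall e, 0 < e -> \forall t \near F, nm (l - f t) <= e) <-> f @ F --> l.
Proof.
move=> FF; split=> h.
  apply/cvgrPdist_le => e /posC[x x0 ->].
  by move/h: x0; apply: filterS => t; rewrite normE leC_rc.
move=> e e0; have e0' : 0 < rc e by rewrite -rc0 ltC_rc.
by move/cvgrPdist_le: h => /(_ _ e0'); apply: filterS => t; rewrite normE leC_rc.
Qed.

Lemma nbhsCP z (A : set C) :
  nbhs z A <-> exists2 d, 0 < d & forall w, nm (w - z) < d -> A w.
Proof.
split.
  move=> /nbhs_ballP[d /= /posC[x x0 ->] h]; exists x => // w wz; apply: h.
  by rewrite /ball /= normE ltC_rc nmBC.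
move=> [d d0 h]; apply/nbhs_ballP; exists (rc d); first by rewrite /= -rc0 ltC_rc.
by move=> w; rewrite /ball /= normE ltC_rc nmBC; exact: h.
Qed.

Lemma openCP (A : set C) :
  open A <-> forall z, A z -> exists2 d, 0 < d & forall w, nm (w - z) < d -> A w.
Proof.
by rewrite openE; split=> h z /h; rewrite /interior => /nbhsCP.
Qed.

Lemma ctnCP (f : C -> C) z :
  {for z, continuous f} <->
  forall e, 0 < e -> exists2 d, 0 < d & forall w, nm (w - z) < d -> nm (f w - f z) <= e.
Proof.
split.
  move=> /(@cvgCP _ _ f (f z) (nbhs_filter z)) h e /h /nbhsCP[d d0 hd].
  by exists d => // w /hd /=; rewrite nmBC.
move=> h; apply/(@cvgCP _ _ f (f z) (nbhs_filter z)) => e /h[d d0 hd].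
by apply/nbhsCP; exists d => // w /hd /=; rewrite nmBC.
Qed.

Lemma rc_continuous : continuous (rc : R -> C).
Proof.
move=> x; apply/cvgCP => e e0; near=> y; rewrite -rcB nm_rc.
by near: y; apply/cvgrPdist_le: (e) (e0); exact: cvg_id.
Unshelve. all: by end_near. Qed.

Lemma ctnCRP (f : C -> R) z :
  (forall e, 0 < e -> exists2 d, 0 < d & forall w, nm (w - z) < d -> `|f z - f w| <= e) ->
  {for z, continuous f}.
Proof.
have FF : Filter (nbhs z) := nbhs_filter z.
by move=> h; apply/cvgrPdist_le => e /h ?; apply/nbhsCP.
Qed.

Lemma re_continuous : continuous (re : C -> R).
Proof.
move=> z; apply: ctnCRP => e e0; exists e => // w.
by rewrite -reB => wz; apply: le_trans (re_le_nm _) _; rewrite nmBC ltW.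
Qed.

Lemma im_continuous : continuous (im : C -> R).
Proof.
move=> z; apply: ctnCRP => e e0; exists e => // w.
by rewrite -imB => wz; apply: le_trans (im_le_nm _) _; rewrite nmBC ltW.
Qed.

Lemma nm_continuous : continuous (nm : C -> R).
Proof.
move=> z; apply: ctnCRP => e e0; exists e => // w wz.
rewrite ler_norml; apply/andP; split; last first.
  by apply: le_trans (ler_nmB _ _) _; rewrite nmBC ltW.
by rewrite lerNl opprB; apply: le_trans (ler_nmB _ _) _; rewrite ltW.
Qed.

Lemma cj_continuous : continuous (cj : C -> C).
Proof.
by move=> z; apply/ctnCP => e e0; exists e => // w /ltW; rewrite -cjB nm_cj.
Qed.

End ComplexNumbers.

(** * Real differentiability in Wirtinger form *)

Section Wirtinger.
Context {R : realType}.
Local Notation C := (CC R).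
Implicit Types (f g : C -> C) (p a b h : C).

Definition rdiff f p a b := forall e : R, 0 < e -> exists2 d : R, 0 < d &
  forall h, nm h < d -> nm (f (p + h) - f p - a * h - b * cj h) <= e * nm h.

Lemma rdiff_lip f p a b : rdiff f p a b ->
  exists2 d : R, 0 < d & forall h, nm h < d ->
    nm (f (p + h) - f p) <= (nm a + nm b + 1) * nm h.
Proof.
move=> /(_ 1 ltr01)[d d0 H]; exists d => // h /H; rewrite mul1r => H'.
rewrite (_ : f _ - _ = (f (p + h) - f p - a * h - b * cj h) + a * h + b * cj h);
  last by ring.
apply: le_trans (nmD _ _) _; rewrite mulrDl mul1r [_ + nm h]addrC mulrDl addrA.
apply: lerD; last by rewrite nmM nm_cj.
by apply: le_trans (nmD _ _) _; rewrite nmM; exact: lerD.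
Qed.

Lemma rdiff_ctn f p a b : rdiff f p a b -> {for p, continuous f}.
Proof.
move=> /rdiff_lip[d d0 H]; apply/ctnCP => e e0.
have L0 : 0 < nm a + nm b + 1 by rewrite ltr_wpDl ?addr_ge0 ?nm_ge0.
exists (Num.min d (e / (nm a + nm b + 1))); first by rewrite lt_min d0 divr_gt0.
move=> w; rewrite lt_min => /andP[wd we].
have := H _ wd; rewrite [p + _]addrC subrK => /le_trans; apply.
by rewrite mulrC -ler_pdivlMr // ltW.
Qed.

Lemma rdiff_near f g p a b d : 0 < d -> (forall h, nm h < d -> f (p + h) = g (p + h)) ->
  rdiff f p a b -> rdiff g p a b.
Proof.
move=> d0 fg H e /H[d' d'0 {}H]; exists (Num.min d d'); first by rewrite lt_min d0.
have E : f p = g p by have := fg 0; rewrite addr0 nm0; exact.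
by move=> h; rewrite lt_min => /andP[hd hd']; rewrite -fg // -E H.
Qed.

Lemma rdiff_eq f p a b a' b' : rdiff f p a b -> a = a' -> b = b' -> rdiff f p a' b'.
Proof. by move=> + <- <-. Qed.

Lemma rdiff_cst c p : rdiff (fun=> c) p 0 0.
Proof.
by move=> e e0; exists 1 => // h _; rewrite !mul0r !subr0 subrr nm0 mulr_ge0 ?nm_ge0 ?ltW.
Qed.

Lemma rdiff_id p : rdiff id p 1 0.
Proof.
move=> e e0; exists 1 => // h _.
by rewrite /= [p + h]addrC addrK mul1r mul0r subr0 subrr nm0 mulr_ge0 ?nm_ge0 ?ltW.
Qed.

Lemma rdiffD f g p a b a' b' : rdiff f p a b -> rdiff g p a' b' ->
  rdiff (fun z => f z + g z) p (a + a') (b + b').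
Proof.
move=> F G e e0; have e2 : 0 < e / 2 by rewrite divr_gt0.
have [d d0 {}F] := F _ e2; have [d' d'0 {}G] := G _ e2.
exists (Num.min d d'); first by rewrite lt_min d0.
move=> h; rewrite lt_min => /andP[/F {}F /G {}G].
rewrite (_ : _ - _ = (f (p + h) - f p - a * h - b * cj h) +
   (g (p + h) - g p - a' * h - b' * cj h)); last by ring.
by apply: le_trans (nmD _ _) _; apply: le_trans (lerD F G) _; rewrite -mulrDl -splitr.
Qed.

Lemma rdiff_sum (I : Type) (s : seq I) (F : I -> C -> C) (A B : I -> C) p :
  (forall i, rdiff (F i) p (A i) (B i)) ->
  rdiff (fun z => \sum_(i <- s) F i z) p (\sum_(i <- s) A i) (\sum_(i <- s) B i).
Proof.
move=> H; elim: s => [|i s ih].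
  rewrite !big_nil; under eq_fun do rewrite big_nil; exact: rdiff_cst.
by rewrite !big_cons; under eq_fun do rewrite big_cons; exact: rdiffD (H i) ih.
Qed.

Lemma rdiff_cj f p a b : rdiff f p a b -> rdiff (fun z => cj (f z)) p (cj b) (cj a).
Proof.
move=> F e /F[d d0 {}F]; exists d => // h /F.
by rewrite -[X in X <= _]nm_cj !cjB !cjM !cjK -!addrA [in - (cj a * _) - _]addrC.
Qed.

Lemma rdiffM f g p a b a' b' : rdiff f p a b -> rdiff g p a' b' ->
  rdiff (fun z => f z * g z) p (a * g p + f p * a') (b * g p + f p * b').
Proof.
move=> F G e e0.
have [d1 d10 F1] := rdiff_lip F; have [d2 d20 G1] := rdiff_lip G.
set A := _ + 1 in F1; set B := _ + 1 in G1.
have A0 : 0 < A by rewrite /A ltr_wpDl ?addr_ge0 ?nm_ge0.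
have B0 : 0 < B by rewrite /B ltr_wpDl ?addr_ge0 ?nm_ge0.
pose M := 1 + nm (f p) + nm (g p).
have M0 : 0 < M by rewrite /M ltr_wpDr ?nm_ge0 // ltr_wpDr ?nm_ge0.
have e3 : 0 < e / 3 / M by rewrite !divr_gt0.
have [d3 d30 {}F] := F _ e3; have [d4 d40 {}G] := G _ e3.
pose d5 := e / 3 / (A * B).
have d50 : 0 < d5 by rewrite /d5 divr_gt0 ?mulr_gt0 // divr_gt0.
exists (Num.min d1 (Num.min d2 (Num.min d3 (Num.min d4 d5)))).
  by rewrite !lt_min d10 d20 d30 d40.
move=> h; rewrite !lt_min => /and5P[/F1 {}F1 /G1 {}G1 /F {}F /G {}G h5].
rewrite /= (_ : _ - _ = (f (p + h) - f p) * (g (p + h) - g p) +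
  (f (p + h) - f p - a * h - b * cj h) * g p +
  f p * (g (p + h) - g p - a' * h - b' * cj h)); last by ring.
have h0 := nm_ge0 h.
have T1 : nm ((f (p + h) - f p) * (g (p + h) - g p)) <= e / 3 * nm h.
  rewrite nmM; apply: le_trans (ler_pM (nm_ge0 _) (nm_ge0 _) F1 G1) _.
  rewrite [leLHS](_ : _ = nm h * (A * B) * nm h); last by ring.
  by rewrite ler_wpM2r // -ler_pdivlMr ?mulr_gt0 // ltW.
have T x (y : C) : x <= e / 3 / M * nm h -> 0 <= x -> nm y <= M -> x * nm y <= e / 3 * nm h.
  move=> hx x0 hy; apply: le_trans (ler_pM x0 (nm_ge0 _) hx hy) _.
  by rewrite mulrAC divfK ?gt_eqF.
have T2 := T _ (g p) F (nm_ge0 _); have T3 := T _ (f p) G (nm_ge0 _).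
apply: le_trans (nmD _ _) _; rewrite (_ : e * _ = e / 3 * nm h + e / 3 * nm h + e / 3 * nm h); last by field.
apply: lerD; last by rewrite nmM mulrC; apply: T3; rewrite /M; have := nm_ge0 (g p); lra.
apply: le_trans (nmD _ _) _; apply: lerD => //.
by rewrite nmM; apply: T2; rewrite /M; have := nm_ge0 (f p); lra.
Qed.

Lemma rdiff_chain f g p a b c d : rdiff f p a b -> rdiff g (f p) c d ->
  rdiff (g \o f) p (c * a + d * cj b) (c * b + d * cj a).
Proof.
move=> F G e e0.
have [d1 d10 F1] := rdiff_lip F; set A := _ + 1 in F1.
have A0 : 0 < A by rewrite /A ltr_wpDl ?addr_ge0 ?nm_ge0.
pose B := nm c + nm d + 1.
have B0 : 0 < B by rewrite /B ltr_wpDl ?addr_ge0 ?nm_ge0.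
have eA : 0 < e / 2 / A by rewrite !divr_gt0.
have ec : 0 < e / 2 / B by rewrite !divr_gt0.
have [d2 d20 {}G] := G _ eA; have [d3 d30 {}F] := F _ ec.
exists (Num.min d1 (Num.min d3 (d2 / A))); first by rewrite !lt_min d10 d30 divr_gt0.
move=> h; rewrite !lt_min => /and3P[/F1 {}F1 /F {}F]; rewrite ltr_pdivlMr // mulrC => h2.
have := G _ (le_lt_trans F1 h2); rewrite [f p + _]addrC subrK => {}G.
set u := f (p + h) - f p - a * h - b * cj h in F.
have -> : (g \o f) (p + h) - (g \o f) p - (c * a + d * cj b) * h - (c * b + d * cj a) * cj h =
    (g (f (p + h)) - g (f p) - c * (f (p + h) - f p) - d * cj (f (p + h) - f p)) +
    (c * u + d * cj u).
  by rewrite /u /= !cjB !cjM !cjK; ring.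
apply: le_trans (nmD _ _) _; rewrite [leRHS](_ : _ = e / 2 * nm h + e / 2 * nm h); last by field.
apply: lerD.
  apply: le_trans G _; apply: le_trans (ler_wpM2l (ltW eA) F1) _.
  by rewrite mulrA divfK ?gt_eqF.
apply: le_trans (nmD _ _) _; rewrite !nmM nm_cj -mulrDl.
have cd : 0 <= nm c + nm d by rewrite addr_ge0 ?nm_ge0.
apply: le_trans (ler_wpM2l cd F) _; rewrite mulrA ler_wpM2r ?nm_ge0 //.
by rewrite mulrA ler_pdivrMr // mulrC ler_wpM2l ?lerDl // ltW // divr_gt0.
Qed.

Lemma rdiff_comp f g p a b c : rdiff f p a b -> rdiff g (f p) c 0 ->
  rdiff (g \o f) p (c * a) (c * b).
Proof.
by move=> F G; have := rdiff_chain F G; rewrite !mul0r !addr0.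
Qed.

Lemma rdiff_is_derive f p a : rdiff f p a 0 <-> is_derive p 1 f a.
Proof.
split=> [F|[F <-]].
  suff H : (fun h : C => h^-1 *: (f (h *: (1 : C) + p) - f p)) @ 0^' --> a.
    by apply: DeriveDef; [apply/cvg_ex; exists a | apply/cvg_lim => //].
  apply/cvgCP => e /F[d d0 {}F]; rewrite /dnbhs /within /=; apply/nbhsCP.
  exists d => // h; rewrite subr0 => /F {}F h0.
  rewrite /GRing.scale /= mulr1 [h + p]addrC -(ler_pM2r (x := nm h)) ?nm_gt0 // -nmM.
  rewrite mulrBl mulrAC mulVf // mul1r -nmN opprB.
  by move: F; rewrite mul0r subr0.
have {}F : (fun h : C => h^-1 *: (f (h *: (1 : C) + p) - f p)) @ 0^' --> 'D_1 f p by [].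
move/cvgCP: F => F e /F; rewrite /dnbhs /within /= => /nbhsCP[d d0 {}F].
exists d => // h hd; have [->|h0] := eqVneq h 0.
  by rewrite addr0 subrr cj0 !mulr0 !subr0 nm0 mulr0.
have := F h; rewrite subr0 => /(_ hd h0).
rewrite /GRing.scale /= mulr1 [h + p]addrC -(ler_pM2r (x := nm h)) ?nm_gt0 // -nmM.
by rewrite mulrBl mulrAC mulVf // mul1r -nmN opprB mul0r subr0.
Qed.

Definition hol f p := derivable f p 1.

Lemma holP f p : hol f p <-> exists a, rdiff f p a 0.
Proof.
split=> [F|[a /rdiff_is_derive[]//]].
by exists ('D_1 f p); apply/rdiff_is_derive; apply: derivableP.
Qed.

Lemma rdiff_derive1 f p a : rdiff f p a 0 -> derive1 f p = a.
Proof. by move=> /rdiff_is_derive[_ <-]; rewrite derive1E. Qed.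

Lemma hol_rdiff f p : hol f p -> rdiff f p (derive1 f p) 0.
Proof. by move=> /holP[a F]; rewrite (rdiff_derive1 F). Qed.

Lemma rdiff_inv p : p != 0 -> rdiff (fun z => z^-1) p (- p ^- 2) 0.
Proof.
move=> p0; apply/rdiff_is_derive.
have H := @derivable_id C C p 1.
apply: DeriveDef; first exact: (@derivableV _ _ id p 1 p0 H).
rewrite (@deriveV _ _ id p 1 p0 H) derive_id /GRing.scale /=; ring.
Qed.

Lemma rdiffV f p a b : f p != 0 -> rdiff f p a b ->
  rdiff (fun z => (f z)^-1) p (- a / f p ^+ 2) (- b / f p ^+ 2).
Proof.
move=> f0 F; apply: rdiff_eq (rdiff_comp F (rdiff_inv f0)) _ _; ring.
Qed.

Lemma rdiffN f p a b : rdiff f p a b -> rdiff (fun z => - f z) p (- a) (- b).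
Proof.
move=> F; rewrite -[- a]mulN1r -[- b]mulN1r.
have := rdiffM (rdiff_cst (-1) p) F; rewrite !mul0r !add0r.
by under eq_fun do rewrite mulN1r.
Qed.

Lemma rdiffX f p a b k : rdiff f p a b ->
  rdiff (fun z => f z ^+ k) p (k%:R * f p ^+ k.-1 * a) (k%:R * f p ^+ k.-1 * b).
Proof.
move=> F; elim: k => [|k ih].
  by rewrite !mul0r; under eq_fun do rewrite expr0; exact: rdiff_cst.
under eq_fun do rewrite exprS.
apply: rdiff_eq (rdiffM F ih) _ _; rewrite /= -natr1; case: k {ih} => [|k]; rewrite ?expr0 /= ?exprS; ring.
Qed.

Lemma rdiff_line f p v a b (t : R) : rdiff f (p + rc t * v) a b ->
  is_derive t 1 (fun s : R => re (f (p + rc s * v))) (re (a * v + b * cj v)) /\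
  is_derive t 1 (fun s : R => im (f (p + rc s * v))) (im (a * v + b * cj v)).
Proof.
move=> F.
have K (T : C -> R) : (forall z w, T (z - w) = T z - T w) -> (forall z, `|T z| <= nm z) ->
    (forall x z, T (rc x * z) = x * T z) ->
    is_derive t 1 (fun s : R => T (f (p + rc s * v))) (T (a * v + b * cj v)).
  move=> TB Tn TZ.
  suff H : (fun h : R => h^-1 *: (T (f (p + rc (h *: (1 : R) + t) * v)) - T (f (p + rc t * v))))
      @ 0^' --> T (a * v + b * cj v).
    by apply: DeriveDef; [apply/cvg_ex; eexists; exact: H | apply/cvg_lim => //].
  apply/cvgrPdist_le => e e0; have ev : 0 < e / (nm v + 1) by rewrite divr_gt0 // ltr_wpDl ?nm_ge0.
  have [d d0 {}F] := F _ ev.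
  rewrite /dnbhs /within /=; apply/nbhs_ballP; exists (d / (nm v + 1)) => /=.
    by rewrite divr_gt0 // ltr_wpDl ?nm_ge0.
  move=> h; rewrite /ball /= sub0r normrN => hd h0.
  have hv : nm (rc h * v) < d.
    rewrite nmM nm_rc; have v1 : 0 < nm v + 1 by rewrite ltr_wpDl ?nm_ge0.
    move: hd; rewrite ltr_pdivlMr // => /(le_lt_trans _); apply.
    by rewrite ler_wpM2l // lerDl.
  have := F _ hv; rewrite nmM nm_rc cjM cj_rc => {}F.
  rewrite /GRing.scale /= mulr1 -(ler_pM2r (x := `|h|)) ?normr_gt0 // -normrM.
  rewrite mulrBl mulrAC mulVf // mul1r mulrC -TZ -!TB.
  apply: le_trans (Tn _) _; rewrite nmBC [h + t]addrC rcD mulrDl addrA.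
  rewrite [X in nm X <= _](_ : _ = f (p + rc t * v + rc h * v) - f (p + rc t * v) - a * (rc h * v) -
      b * (rc h * cj v)); last by ring.
  apply: le_trans F _; rewrite [leLHS](_ : _ = e * `|h| * (nm v / (nm v + 1))); last by ring.
  rewrite ler_piMr //; first by rewrite mulr_ge0 // ltW.
  by rewrite ler_pdivrMr ?mul1r ?lerDl // ltr_wpDl ?nm_ge0.
split; apply: K.
- exact: reB.
- exact: re_le_nm.
- by move=> x z; rewrite reM re_rc im_rc mul0r subr0.
- exact: imB.
- exact: im_le_nm.
- by move=> x z; rewrite imM re_rc im_rc mul0r addr0.
Qed.

End Wirtinger.

(** * Integrals of continuous complex paths *)

Section PathIntegral.
Context {R : realType}.
Local Notation C := (CC R).
Local Notation mu := (@lebesgue_measure R).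

Definition ctn_on (T : topologicalType) (f : R -> T) (a b : R) :=
  forall t, a <= t <= b -> {for t, continuous f}.

Definition rint (f : R -> R) a b : R := \int[mu]_(t in `[a, b]) f t.

Lemma ctn_on_integrable (f : R -> R) a b : ctn_on f a b ->
  mu.-integrable `[a, b] (EFin \o f).
Proof.
move=> cf; apply: continuous_compact_integrable; first exact: segment_compact.
by apply: continuous_in_subspaceT => t; rewrite inE /= in_itv /=; exact: cf.
Qed.

Let mab (a b : R) : measurable (`[a, b] : set R). Proof. exact: measurable_itv. Qed.

Lemma rintD (f g : R -> R) a b : ctn_on f a b -> ctn_on g a b ->
  rint (fun t => f t + g t) a b = rint f a b + rint g a b.
Proof.
by move=> cf cg; rewrite /rint RintegralD //; apply: ctn_on_integrable.
Qed.

Lemma rintZ (f : R -> R) k a b : ctn_on f a b ->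
  rint (fun t => k * f t) a b = k * rint f a b.
Proof. by move=> cf; rewrite /rint RintegralZl //; apply: ctn_on_integrable. Qed.

Lemma eq_rint (f g : R -> R) a b : (forall t, a <= t <= b -> f t = g t) ->
  rint f a b = rint g a b.
Proof. by move=> fg; apply: eq_Rintegral => t; rewrite inE /= in_itv /=; exact: fg. Qed.

Lemma rint_le (f g : R -> R) a b : ctn_on f a b -> ctn_on g a b ->
  (forall t, a <= t <= b -> f t <= g t) -> rint f a b <= rint g a b.
Proof.
move=> cf cg fg; apply: le_Rintegral => //; [exact: ctn_on_integrable cf|exact: ctn_on_integrable cg].
Qed.

Lemma rint_cst k a b : a <= b -> rint (fun=> k) a b = k * (b - a).
Proof.
move=> ab; rewrite /rint Rintegral_cst //.
congr (k * _); transitivity (fine (b - a)%:E) => //; congr fine.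
transitivity (if (a%:E < b%:E)%E then (b%:E - a%:E)%E else 0%E).
  exact: lebesgue_measure_itv.
rewrite lte_fin; by case: ltgtP ab => // -> _; rewrite subrr.
Qed.

Lemma rint_split (f : R -> R) a c b : a <= c <= b -> ctn_on f a b ->
  rint f a b = rint f a c + rint f c b.
Proof.
move=> /andP[ac cb] cf; have fi := ctn_on_integrable cf.
apply/eqP; rewrite addrC -subr_eq /rint; apply/eqP.
rewrite Rintegral_itvB ?bnd_simp // Rintegral_itv_obnd_cbnd //.
by apply: integrableS fi => //; apply: subset_itvr; rewrite bnd_simp.
Qed.

Lemma rint_derive (F f : R -> R) a b : a <= b -> ctn_on f a b ->
  (forall t, a <= t <= b -> is_derive t 1 F (f t)) -> rint f a b = F b - F a.
Proof.
rewrite le_eqVlt => /predU1P[-> _ _|ab cf dF].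
  by rewrite subrr /rint set_itv1 Rintegral_set1.
have cF t : a <= t <= b -> {for t, continuous F}.
  by move=> /dF[dFt _]; apply/differentiable_continuous/derivable1_diffP.
rewrite /rint /Rintegral (@continuous_FTC2 _ f F a b ab) //.
- by apply: continuous_in_subspaceT => t; rewrite inE /= in_itv /=; exact: cf.
- split.
  + move=> t; rewrite in_itv /= => /andP[ta tb].
    by have [] // := dF t; rewrite !ltW.
  + by apply: cvg_at_right_filter; apply: cF; rewrite lexx ltW.
  + by apply: cvg_at_left_filter; apply: cF; rewrite lexx ltW.
- move=> t; rewrite in_itv /= => /andP[ta tb].
  by rewrite derive1E; have [] // := dF t; rewrite !ltW.
Qed.

Lemma rint_ge0 (f : R -> R) a b : (forall t, a <= t <= b -> 0 <= f t) -> 0 <= rint f a b.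
Proof. by move=> f0; apply: Rintegral_ge0 => t; rewrite /= in_itv /=; exact: f0. Qed.

Definition pint (g : R -> C) a b : C :=
  mkc (rint (fun t => re (g t)) a b) (rint (fun t => im (g t)) a b).

Lemma ctn_on_re (g : R -> C) a b : ctn_on g a b -> ctn_on (fun t => re (g t)) a b.
Proof. by move=> cg t /cg gt; apply: (continuous_comp gt); exact: re_continuous. Qed.
Lemma ctn_on_im (g : R -> C) a b : ctn_on g a b -> ctn_on (fun t => im (g t)) a b.
Proof. by move=> cg t /cg gt; apply: (continuous_comp gt); exact: im_continuous. Qed.
Lemma ctn_on_nm (g : R -> C) a b : ctn_on g a b -> ctn_on (fun t => nm (g t)) a b.
Proof. by move=> cg t /cg gt; apply: (continuous_comp gt); exact: nm_continuous. Qed.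
Lemma ctn_on_cst (T : topologicalType) (k : T) a b : ctn_on (fun=> k) a b.
Proof. by move=> t _; exact: cvg_cst. Qed.
Lemma ctn_on_rM (f g : R -> R) a b : ctn_on f a b -> ctn_on g a b ->
  ctn_on (fun t => f t * g t) a b.
Proof. by move=> cf cg t ht; apply: continuousM; [exact: cf | exact: cg]. Qed.
Lemma ctn_onD (f g : R -> C) a b : ctn_on f a b -> ctn_on g a b ->
  ctn_on (fun t => f t + g t) a b.
Proof. by move=> cf cg t ht; apply: cvgD; [exact: cf | exact: cg]. Qed.
Lemma ctn_onN (f : R -> C) a b : ctn_on f a b -> ctn_on (fun t => - f t) a b.
Proof. by move=> cf t ht; apply: cvgN; exact: cf. Qed.
Lemma ctn_onM (f g : R -> C) a b : ctn_on f a b -> ctn_on g a b ->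
  ctn_on (fun t => f t * g t) a b.
Proof. by move=> cf cg t ht; apply: cvgM; [exact: cf | exact: cg]. Qed.
Lemma ctn_on_comp (T U : topologicalType) (f : R -> T) (g : T -> U) a b :
  ctn_on f a b -> (forall t, a <= t <= b -> {for f t, continuous g}) ->
  ctn_on (fun t => g (f t)) a b.
Proof. by move=> cf cg t ht; apply: continuous_comp; [exact: cf | exact: cg]. Qed.

Lemma eq_pint (f g : R -> C) a b : (forall t, a <= t <= b -> f t = g t) ->
  pint f a b = pint g a b.
Proof. by move=> fg; congr mkc; apply: eq_rint => t /fg ->. Qed.

Lemma pintD (f g : R -> C) a b : ctn_on f a b -> ctn_on g a b ->
  pint (fun t => f t + g t) a b = pint f a b + pint g a b.
Proof.
move=> cf cg; apply: eqC; rewrite /pint !reimE -rintD.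
- by apply: eq_rint => t _; rewrite reD.
- exact: ctn_on_re.
- exact: ctn_on_re.
- by apply: eq_rint => t _; rewrite imD.
- exact: ctn_on_im.
- exact: ctn_on_im.
Qed.

Lemma pintZ (f : R -> C) k a b : ctn_on f a b ->
  pint (fun t => k * f t) a b = k * pint f a b.
Proof.
move=> cf; have cr := ctn_on_re cf; have ci := ctn_on_im cf.
have cc (x : R) := @ctn_on_cst _ x a b.
apply: eqC; rewrite /pint !reimE.
  rewrite -mulNr -rintZ // -rintZ // -rintD; try exact: ctn_on_rM.
  by apply: eq_rint => t _; rewrite reM mulNr.
rewrite -rintZ // -rintZ // -rintD; try exact: ctn_on_rM.
by apply: eq_rint => t _; rewrite imM.
Qed.

Lemma pintN (f : R -> C) a b : ctn_on f a b ->
  pint (fun t => - f t) a b = - pint f a b.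
Proof.
by move=> cf; rewrite -mulN1r -pintZ //; apply: eq_pint => t _; rewrite mulN1r.
Qed.

Lemma pintB (f g : R -> C) a b : ctn_on f a b -> ctn_on g a b ->
  pint (fun t => f t - g t) a b = pint f a b - pint g a b.
Proof. by move=> cf cg; rewrite -(pintN cg) -(pintD cf (ctn_onN cg)). Qed.

Lemma pint_cst k a b : a <= b -> pint (fun=> k) a b = k * rc (b - a).
Proof.
by move=> ab; apply: eqC; rewrite /pint !reimE rint_cst // mulr0 ?subr0 ?add0r.
Qed.

Lemma pint_cj (f : R -> C) a b : ctn_on f a b ->
  pint (fun t => cj (f t)) a b = cj (pint f a b).
Proof.
move=> cf; apply: eqC; rewrite /pint !reimE.
  by apply: eq_rint => t _; rewrite re_cj.
rewrite -mulN1r -rintZ; last exact: ctn_on_im.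
by apply: eq_rint => t _; rewrite im_cj mulN1r.
Qed.

Lemma pint_rc (f : R -> R) a b : pint (fun t => rc (f t)) a b = rc (rint f a b).
Proof.
apply: eqC; rewrite /pint !reimE; first by apply: eq_rint => t _; rewrite re_rc.
rewrite (_ : rint _ _ _ = rint (fun=> 0) a b); last by apply: eq_rint => t _; rewrite im_rc.
by rewrite /rint /Rintegral integral0.
Qed.

Lemma pint_split (f : R -> C) a c b : a <= c <= b -> ctn_on f a b ->
  pint f a b = pint f a c + pint f c b.
Proof.
by move=> acb cf; apply: eqC; rewrite /pint !reimE (rint_split acb) //;
  [exact: ctn_on_re | exact: ctn_on_im].
Qed.

Lemma pint_nm (f : R -> C) a b : ctn_on f a b ->
  nm (pint f a b) <= rint (fun t => nm (f t)) a b.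
Proof.
(* a unimodular factor makes the integral real *)
move=> cf; set I := pint _ _ _.
have [->|I0] := eqVneq I 0; first by rewrite nm0 rint_ge0 // => t _; exact: nm_ge0.
have nI : nm I != 0 by rewrite nm_eq0.
pose u := cj I / rc (nm I).
have u1 : nm u = 1 by rewrite /u nmM nmV nm_cj nm_rc ger0_norm ?nm_ge0 // divff.
have uI : u * I = rc (nm I).
  by rewrite /u mulrAC [cj I * I]mulrC mulcj -rcV -rcM expr2 mulfK.
have -> : nm I = re (u * I) by rewrite uI re_rc.
have cu : ctn_on (fun t => u * f t) a b by exact: ctn_onM (@ctn_on_cst _ u a b) cf.
rewrite /I -(pintZ u cf) /pint re_mk.
by apply: (rint_le (ctn_on_re cu) (ctn_on_nm cf)) => t _; apply: le_trans (re_le _) _; rewrite nmM u1 mul1r.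
Qed.

Lemma pint_le (f : R -> C) a b M : a <= b -> ctn_on f a b ->
  (forall t, a <= t <= b -> nm (f t) <= M) -> nm (pint f a b) <= M * (b - a).
Proof.
move=> ab cf fM; apply: le_trans (pint_nm cf) _; rewrite -rint_cst //.
exact: rint_le (ctn_on_nm cf) (@ctn_on_cst _ M a b) fM.
Qed.

Lemma pint_derive (F f : R -> C) a b : a <= b -> ctn_on f a b ->
  (forall t, a <= t <= b -> is_derive t 1 (fun s => re (F s)) (re (f t)) /\
     is_derive t 1 (fun s => im (F s)) (im (f t))) -> pint f a b = F b - F a.
Proof.
move=> ab cf dF; apply: eqC; rewrite /pint !reimE.
  exact: rint_derive ab (ctn_on_re cf) (fun t ht => (dF t ht).1).
exact: rint_derive ab (ctn_on_im cf) (fun t ht => (dF t ht).2).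
Qed.

Lemma line_continuous (p v : C) : continuous (fun t : R => p + rc t * v).
Proof.
move=> t; apply: cvgD; first exact: cvg_cst.
by apply: cvgM; [exact: rc_continuous | exact: cvg_cst].
Qed.

Lemma pint_line (F f : C -> C) p v L : 0 <= L ->
  (forall t, 0 <= t <= L -> {for p + rc t * v, continuous f}) ->
  (forall t, 0 <= t <= L -> exists a b, rdiff F (p + rc t * v) a b /\
     f (p + rc t * v) = a * v + b * cj v) ->
  pint (fun t => f (p + rc t * v)) 0 L = F (p + rc L * v) - F p.
Proof.
move=> L0 cf dF.
have cl : ctn_on (fun t : R => p + rc t * v) 0 L.
  by move=> t _; exact: line_continuous.
have := pint_derive (F := fun s => F (p + rc s * v)) L0 (ctn_on_comp cl cf).
rewrite rc0 mul0r addr0; apply=> t /dF[a [b [Fab ->]]]; exact: rdiff_line.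
Qed.

Lemma mvi_line (F : C -> C) p v K :
  (forall t : R, 0 <= t <= 1 -> exists2 ab, rdiff F (p + rc t * v) ab.1 ab.2 &
     nm (ab.1 * v + ab.2 * cj v) <= K) ->
  nm (F (p + v) - F p) <= K.
Proof.
move=> dF; set w := F (p + v) - F p.
have [->|w0] := eqVneq w 0.
  have [|ab _ h] := dF 0; first by rewrite lexx ler01.
  by rewrite nm0; exact: le_trans (nm_ge0 _) h.
pose u := cj w / rc (nm w).
have nw : nm w != 0 by rewrite nm_eq0.
have u1 : nm u = 1 by rewrite /u nmM nmV nm_cj nm_rc ger0_norm ?nm_ge0 // divff.
have uw : u * w = rc (nm w).
  by rewrite /u mulrAC [cj w * w]mulrC mulcj -rcV -rcM expr2 mulfK.
pose G s := re (u * F (p + rc s * v)).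
have dG (t : R) : 0 <= t <= 1 -> exists2 d : R, is_derive t 1 G d & d <= K.
  move=> /dF[ab Fab h].
  have [/= H _] := rdiff_line (rdiffM (rdiff_cst u _) Fab); eexists; first exact: H.
  apply: le_trans (re_le _) _.
  rewrite [X in nm X <= _](_ : _ = u * (ab.1 * v + ab.2 * cj v)); last by ring.
  by rewrite nmM u1 mul1r.
have -> : nm w = G 1 - G 0.
  by rewrite /G rc1 rc0 mul1r mul0r addr0 -reB -mulrBr uw re_rc.
have cG (t : R) : 0 <= t <= 1 -> {for t, continuous G}.
  by move=> /dG[d [dGt _] _]; apply/differentiable_continuous/derivable1_diffP.
have [||c c01 ->] := @MVT_segment R G (derive1 G) 0 1 ler01.
- move=> x; rewrite in_itv /= => /andP[x0 x1].
  have /dG[d [dGt dd] _] : 0 <= x <= 1 by rewrite !ltW.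
  by apply: DeriveDef => //; rewrite derive1E.
- by apply: continuous_in_subspaceT => t; rewrite inE /= in_itv /=; exact: cG.
rewrite subr0 mulr1 derive1E.
by have /dG[d [_ ->]] : 0 <= c <= 1 by move: c01; rewrite in_itv.
Qed.

End PathIntegral.

(** * The Goursat inequality on rectangles *)

Section Goursat.
Context {R : realType}.
Local Notation C := (CC R).

Lemma rint_id (a b : R) : a <= b -> rint (fun t => t) a b = (b ^+ 2 - a ^+ 2) / 2.
Proof.
move=> ab; have dF (t : R) : a <= t <= b -> is_derive t 1 (2^-1 \*: (@id R ^+ 2)) t.
  move=> _; apply: is_derive_eq; rewrite /GRing.scale /= expr1 mulr1.
  by rewrite -mulr_natl; field.
rewrite (rint_derive ab _ dF); first by rewrite /GRing.scale /= mulrBl; congr (_ - _); rewrite mulrC.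
by move=> t _; exact: cvg_id.
Qed.

Lemma pint_affine (al be : C) (a b : R) : a <= b ->
  pint (fun t => al + be * rc t) a b = al * rc (b - a) + be * rc ((b ^+ 2 - a ^+ 2) / 2).
Proof.
move=> ab; have ct : ctn_on (fun t : R => rc t : C) a b.
  by move=> t _; exact: rc_continuous.
rewrite (pintD (@ctn_on_cst _ _ al a b) (ctn_onM (@ctn_on_cst _ _ be a b) ct)).
by rewrite pint_cst // (pintZ _ ct) pint_rc rint_id.
Qed.

Definition horz (g : C -> C) (y x1 x2 : R) := pint (fun t => g (mkc t y)) x1 x2.
Definition vert (g : C -> C) (x y1 y2 : R) := pint (fun t => g (mkc x t)) y1 y2.

Definition boundary (g : C -> C) (x1 x2 y1 y2 : R) : C :=
  horz g y1 x1 x2 - horz g y2 x1 x2 + mkc 0 1 * (vert g x2 y1 y2 - vert g x1 y1 y2).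

Definition in_rect (x1 x2 y1 y2 : R) (z : C) :=
  (x1 <= re z <= x2) /\ (y1 <= im z <= y2).

Lemma horz_continuous (y : R) : continuous (fun t : R => mkc t y : C).
Proof.
rewrite (_ : (fun t => _) = fun t : R => mkc 0 y + rc t * 1).
  exact: line_continuous.
by apply/funext => t; apply: eqC; rewrite !reimE; ring.
Qed.

Lemma vert_continuous (x : R) : continuous (fun t : R => mkc x t : C).
Proof.
rewrite (_ : (fun t => _) = fun t : R => rc x + rc t * mkc 0 1).
  exact: line_continuous.
by apply/funext => t; apply: eqC; rewrite !reimE; ring.
Qed.

Section Rectangle.
Variables (g : C -> C) (x1 x2 y1 y2 : R).
Hypothesis gc : forall z, in_rect x1 x2 y1 y2 z -> {for z, continuous g}.

Lemma horz_ctn y : y1 <= y <= y2 -> ctn_on (fun t => g (mkc t y)) x1 x2.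
Proof.
move=> hy t ht; apply: continuous_comp; first exact: horz_continuous.
exact: gc.
Qed.

Lemma vert_ctn x : x1 <= x <= x2 -> ctn_on (fun t => g (mkc x t)) y1 y2.
Proof.
move=> hx t ht; apply: continuous_comp; first exact: vert_continuous.
exact: gc.
Qed.

Lemma boundary_split_x m : x1 <= m <= x2 -> y1 <= y2 ->
  boundary g x1 x2 y1 y2 = boundary g x1 m y1 y2 + boundary g m x2 y1 y2.
Proof.
move=> hm y12; rewrite /boundary /horz.
rewrite (pint_split hm (horz_ctn _)) ?lexx // (pint_split hm (horz_ctn _)) ?lexx ?andbT //.
by ring.
Qed.

Lemma boundary_split_y m : x1 <= x2 -> y1 <= m <= y2 ->
  boundary g x1 x2 y1 y2 = boundary g x1 x2 y1 m + boundary g x1 x2 m y2.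
Proof.
move=> x12 hm; rewrite /boundary /vert.
rewrite (pint_split hm (vert_ctn _)) ?lexx ?andbT // (pint_split hm (vert_ctn _)) ?lexx //.
by ring.
Qed.

Lemma boundaryD (h : C -> C) : (forall z, in_rect x1 x2 y1 y2 z -> {for z, continuous h}) ->
  x1 <= x2 -> y1 <= y2 ->
  boundary (fun z => g z + h z) x1 x2 y1 y2 = boundary g x1 x2 y1 y2 + boundary h x1 x2 y1 y2.
Proof.
move=> hc x12 y12.
have hh y : y1 <= y <= y2 -> ctn_on (fun t => h (mkc t y)) x1 x2.
  by move=> hy t ht; apply: continuous_comp; [exact: horz_continuous | exact: hc].
have hv x : x1 <= x <= x2 -> ctn_on (fun t => h (mkc x t)) y1 y2.
  by move=> hx t ht; apply: continuous_comp; [exact: vert_continuous | exact: hc].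
have Y1 : y1 <= y1 <= y2 by rewrite lexx.
have Y2 : y1 <= y2 <= y2 by rewrite lexx andbT.
have X1 : x1 <= x1 <= x2 by rewrite lexx.
have X2 : x1 <= x2 <= x2 by rewrite lexx andbT.
rewrite /boundary /horz /vert (pintD (horz_ctn Y1) (hh _ Y1)) (pintD (horz_ctn Y2) (hh _ Y2)).
rewrite (pintD (vert_ctn X1) (hv _ X1)) (pintD (vert_ctn X2) (hv _ X2)).
by ring.
Qed.

Lemma boundary_le M : x1 <= x2 -> y1 <= y2 ->
  (forall z, in_rect x1 x2 y1 y2 z -> nm (g z) <= M) ->
  nm (boundary g x1 x2 y1 y2) <= 2 * M * ((x2 - x1) + (y2 - y1)).
Proof.
move=> x12 y12 gM.
have Y1 : y1 <= y1 <= y2 by rewrite lexx.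
have Y2 : y1 <= y2 <= y2 by rewrite lexx andbT.
have X1 : x1 <= x1 <= x2 by rewrite lexx.
have X2 : x1 <= x2 <= x2 by rewrite lexx andbT.
have h1 := pint_le x12 (horz_ctn Y1) (fun t ht => gM (mkc t y1) (conj ht Y1)).
have h2 := pint_le x12 (horz_ctn Y2) (fun t ht => gM (mkc t y2) (conj ht Y2)).
have v1 := pint_le y12 (vert_ctn X1) (fun t ht => gM (mkc x1 t) (conj X1 ht)).
have v2 := pint_le y12 (vert_ctn X2) (fun t ht => gM (mkc x2 t) (conj X2 ht)).
rewrite /boundary; apply: le_trans (nmD _ _) _; rewrite nmM nm_mk01 mul1r.
have hh := nmB (horz g y1 x1 x2) (horz g y2 x1 x2).
have vv := nmB (vert g x2 y1 y2) (vert g x1 y1 y2).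
apply: le_trans (lerD hh vv) _.
apply: le_trans (lerD (lerD h1 h2) (lerD v2 v1)) _.
by rewrite le_eqVlt; apply/orP; left; apply/eqP; ring.
Qed.

End Rectangle.

Lemma boundary_affine (q a b : C) x1 x2 y1 y2 : x1 <= x2 -> y1 <= y2 ->
  boundary (fun z => q + a * z + b * cj z) x1 x2 y1 y2 =
  2 * mkc 0 1 * b * rc ((x2 - x1) * (y2 - y1)).
Proof.
move=> x12 y12.
have H y : horz (fun z => q + a * z + b * cj z) y x1 x2 =
    (q + (a - b) * mkc 0 1 * rc y) * rc (x2 - x1) + (a + b) * rc ((x2 ^+ 2 - x1 ^+ 2) / 2).
  rewrite -pint_affine //; apply: eq_pint => t _.
  have -> : cj (mkc t y) = rc t - mkc 0 1 * rc y :> C by apply: eqC; rewrite !reimE; ring.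
  have -> : mkc t y = rc t + mkc 0 1 * rc y :> C by apply: eqC; rewrite !reimE; ring.
  by ring.
have V x : vert (fun z => q + a * z + b * cj z) x y1 y2 =
    (q + (a + b) * rc x) * rc (y2 - y1) + (a - b) * mkc 0 1 * rc ((y2 ^+ 2 - y1 ^+ 2) / 2).
  rewrite -pint_affine //; apply: eq_pint => t _.
  have -> : cj (mkc x t) = rc x - mkc 0 1 * rc t :> C by apply: eqC; rewrite !reimE; ring.
  have -> : mkc x t = rc x + mkc 0 1 * rc t :> C by apply: eqC; rewrite !reimE; ring.
  by ring.
rewrite /boundary !H !V.
have [rq rb ra] : [/\ q = rc (re q) + mkc 0 1 * rc (im q), b = rc (re b) + mkc 0 1 * rc (im b) &
  a = rc (re a) + mkc 0 1 * rc (im a)] by split; exact: reimK.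
have i2 : mkc 0 1 * mkc 0 1 = -1 :> C by apply: eqC; rewrite !reimE; ring.
by rewrite !rcB !rcM !rcB; ring: i2.
Qed.

End Goursat.

Section GoursatInequality.
Context {R : realType}.
Local Notation C := (CC R).

Lemma boundary_local (g : C -> C) p a b (e : R) : 0 < e -> rdiff g p a b ->
  exists2 d : R, 0 < d & forall x1 x2 y1 y2 : R, x1 <= x2 -> y1 <= y2 ->
    (x2 - x1) + (y2 - y1) < d -> in_rect x1 x2 y1 y2 p ->
    (forall z, in_rect x1 x2 y1 y2 z -> {for z, continuous g}) ->
    nm (boundary g x1 x2 y1 y2) <= 2 * nm b * ((x2 - x1) * (y2 - y1)) +
      2 * e * ((x2 - x1) + (y2 - y1)) ^+ 2.
Proof.
move=> e0 /(_ _ e0)[d d0 H]; exists d => // x1 x2 y1 y2 x12 y12 sd [px py] gc.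
pose A z := (g p - a * p - b * cj p) + a * z + b * cj z.
pose E z := g z + - A z.
have cA z : {for z, continuous A}.
  apply: rdiff_ctn (rdiffD (rdiffD (rdiff_cst _ z) (rdiffM (rdiff_cst a z) (rdiff_id z)))
    (rdiffM (rdiff_cst b z) (rdiff_cj (rdiff_id z)))).
have cE z : in_rect x1 x2 y1 y2 z -> {for z, continuous E}.
  by move=> /gc gz; exact: cvgD gz (cvgN (cA z)).
have -> : g = fun z => A z + E z by apply/funext => z; rewrite /E addrC subrK.
rewrite (boundaryD (fun z _ => cA z) cE x12 y12) {1}/A boundary_affine //.
apply: le_trans (nmD _ _) _; apply: lerD.
  rewrite !nmM nm_mk01 mulr1 nm_nat nm_rc ger0_norm //.
  by rewrite mulr_ge0 ?subr_ge0.
set s := _ + _ in sd *.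
have s0 : 0 <= s by rewrite /s addr_ge0 ?subr_ge0.
have B z : in_rect x1 x2 y1 y2 z -> nm (E z) <= e * s.
  move=> [zx zy]; have zp : nm (z - p) <= s.
    apply: le_trans (nm_le_reim _) _; rewrite reB imB /s.
    by apply: lerD; rewrite ler_norml; apply/andP; split; lra.
  have := H (z - p) (le_lt_trans zp sd); rewrite [p + _]addrC subrK => Hz.
  have -> : E z = g z - g p - a * (z - p) - b * cj (z - p).
    by rewrite /E /A cjB; ring.
  by apply: le_trans Hz _; rewrite ler_wpM2l // ltW.
apply: le_trans (boundary_le cE x12 y12 B) _; rewrite -/s.
by rewrite le_eqVlt; apply/orP; left; apply/eqP; ring.
Qed.

(** Bisection: if the boundary integral exceeded the bound, so would, in the
    same proportion, that of one of the four quarters, and so on; at the common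
    point of the nested rectangles this contradicts [boundary_local]. For
    [K = 0] this is Goursat's lemma. *)
Theorem goursat (g : C -> C) (x1 x2 y1 y2 K : R) : x1 <= x2 -> y1 <= y2 ->
  (forall z, in_rect x1 x2 y1 y2 z -> exists a b, rdiff g z a b /\ nm b <= K) ->
  nm (boundary g x1 x2 y1 y2) <= 2 * K * ((x2 - x1) * (y2 - y1)).
Proof.
move=> x12 y12 dg.
have gc z : in_rect x1 x2 y1 y2 z -> {for z, continuous g}.
  by move=> /dg[a [b [/rdiff_ctn]]].
pose w := x2 - x1; pose h := y2 - y1.
have w0 : 0 <= w by rewrite subr_ge0.
have h0 : 0 <= h by rewrite subr_ge0.
apply/ler_addgt0Pr => e e0; rewrite leNgt; apply/negP => big.
pose c := 2 * K * (w * h) + e.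
(* [q n] is the side of the [n]-th rectangle relative to the original one *)
pose q n : R := (2 ^+ n)^-1.
have q0 n : 0 < q n by rewrite invr_gt0 exprn_gt0.
have qS n : q n = q n.+1 + q n.+1 by rewrite /q exprS; field; rewrite expf_neq0 // pnatr_eq0.
pose bad n (p : R * R) := [/\ x1 <= p.1, p.1 + w * q n <= x2, y1 <= p.2, p.2 + h * q n <= y2 &
  c * q n ^+ 2 < nm (boundary g p.1 (p.1 + w * q n) p.2 (p.2 + h * q n))].
have step (np : nat * (R * R)) : exists p' : R * R, bad np.1 np.2 ->
    [/\ bad np.1.+1 p', np.2.1 <= p'.1 <= np.2.1 + w * q np.1.+1 &
      np.2.2 <= p'.2 <= np.2.2 + h * q np.1.+1].
  case: np => n [x y] /=.
  have [B|B] := pselect (bad n (x, y)); last by exists (0, 0).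
  have [/= a1 a2 a3 a4 a5] := B.
  pose wn := w * q n.+1; pose hn := h * q n.+1.
  have wn0 : 0 <= wn by rewrite mulr_ge0 // ltW.
  have hn0 : 0 <= hn by rewrite mulr_ge0 // ltW.
  have eqw : w * q n = wn + wn by rewrite qS mulrDr.
  have eqh : h * q n = hn + hn by rewrite qS mulrDr.
  suff : [\/ bad n.+1 (x, y), bad n.+1 (x + wn, y), bad n.+1 (x, y + hn) |
      bad n.+1 (x + wn, y + hn)].
    by case=> H; eexists => _; (split; first exact: H) => /=; rewrite ?lexx ?lerDl -/wn -/hn ?lerDl ?wn0 ?hn0.
  rewrite eqw in a2 a5; rewrite eqh in a4 a5.
  have gcs x' x'' y' y'' : x <= x' -> x'' <= x + (wn + wn) -> y <= y' -> y'' <= y + (hn + hn) ->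
      forall z, in_rect x' x'' y' y'' z -> {for z, continuous g}.
    by move=> ? ? ? ? z [/andP[? ?] /andP[? ?]]; apply: gc; split; apply/andP; split; lra.
  move: a5; rewrite (@boundary_split_x _ g _ _ _ _ _ (x + wn)); last first.
  - by lra.
  - by apply/andP; split; lra.
  - by apply: gcs; lra.
  rewrite (@boundary_split_y _ g _ _ _ _ _ (y + hn)); last first.
  - by apply/andP; split; lra.
  - by lra.
  - by apply: gcs; lra.
  rewrite (@boundary_split_y _ g (x + wn) _ _ _ _ (y + hn)); last first.
  - by apply/andP; split; lra.
  - by lra.
  - by apply: gcs; lra.
  have -> : x + (wn + wn) = x + wn + wn by rewrite addrA.
  have -> : y + (hn + hn) = y + hn + hn by rewrite addrA.
  have -> : c * q n ^+ 2 = 4 * (c * q n.+1 ^+ 2) by rewrite qS; ring.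
  move=> a5; apply: contrapT => nb.
  have nb4 : [/\ ~ bad n.+1 (x, y), ~ bad n.+1 (x + wn, y), ~ bad n.+1 (x, y + hn) &
    ~ bad n.+1 (x + wn, y + hn)].
    by split=> hb; apply: nb; [exact: Or41|exact: Or42|exact: Or43|exact: Or44].
  have mk x' y' : x1 <= x' -> x' + wn <= x2 -> y1 <= y' -> y' + hn <= y2 -> ~ bad n.+1 (x', y') ->
      nm (boundary g x' (x' + wn) y' (y' + hn)) <= c * q n.+1 ^+ 2.
    by move=> b1 b2 b3 b4 nbad; rewrite leNgt; apply/negP => b5; apply: nbad; split.
  move: nb4 => [/mk n1 /mk n2 /mk n3 /mk n4].
  move: a5; apply/negP; rewrite -leNgt.
  apply: le_trans (nmD _ _) _; apply: le_trans (lerD (nmD _ _) (nmD _ _)) _.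
  have lx : x1 <= x + wn by rewrite (le_trans a1) // lerDl.
  have rx : x + wn + wn <= x2 by rewrite -addrA.
  have rx' : x + wn <= x2 by rewrite (le_trans _ rx) // lerDl.
  have ly : y1 <= y + hn by rewrite (le_trans a3) // lerDl.
  have ry : y + hn + hn <= y2 by rewrite -addrA.
  have ry' : y + hn <= y2 by rewrite (le_trans _ ry) // lerDl.
  move: (n1 a1 rx' a3 ry') (n2 lx rx a3 ry') (n3 a1 rx' ly ry) (n4 lx rx ly ry).
  rewrite mulr_natl !mulrSr mulr0n add0r; move: (nm _) (nm _) (nm _) (nm _) => u1 u2 u3 u4.
  by move=> b1 b2 b3 b4; rewrite -[leRHS]addrA; apply: lerD; apply: lerD.
have [s Hs] := choice step.
pose P := fix P n := if n is m.+1 then s (m, P m) else (x1, y1).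
have badP n : bad n (P n).
  elim: n => [|n ih]; last by have [] := Hs (n, P n) ih.
  have ew : x1 + w * q 0%N = x2 by rewrite /q expr0 invr1 mulr1 /w addrC subrK.
  have eh : y1 + h * q 0%N = y2 by rewrite /q expr0 invr1 mulr1 /h addrC subrK.
  split; rewrite [P 0%N]/= ?ew ?eh; [exact: lexx..|].
  by rewrite /q expr0 invr1 expr1n mulr1.
have PS n : (P n).1 <= (P n.+1).1 <= (P n).1 + w * q n.+1 /\
    (P n).2 <= (P n.+1).2 <= (P n).2 + h * q n.+1.
  by have [] := Hs (n, P n) (badP n).
(* the corners increase and stay below the opposite corner of each rectangle *)
have lim (X : nat -> R) (W : R) : 0 <= W ->
    (forall n, X n <= X n.+1 <= X n + W * q n.+1) -> exists p, forall n, X n <= p <= X n + W * q n.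
  move=> W0 HX.
  have mono m k : X m <= X (m + k)%N.
    elim: k => [|k ih]; rewrite ?addn0 // addnS; apply: le_trans ih _.
    by have /andP[] := HX (m + k)%N.
  have up m k : X (m + k)%N + W * q (m + k)%N <= X m + W * q m.
    elim: k => [|k ih]; rewrite ?addn0 // addnS; apply: le_trans ih.
    by have /andP[_] := HX (m + k)%N; rewrite (qS (m + k)%N) mulrDr; lra.
  have ubX m n : X n <= X m + W * q m.
    have [mn|nm] := leqP m n.
      have := up m (n - m)%N; rewrite subnKC //; apply: le_trans.
      by rewrite lerDl mulr_ge0 // ltW.
    have := mono n (m - n)%N; rewrite subnKC ?(ltnW nm) // => /le_trans; apply.
    by rewrite lerDl mulr_ge0 // ltW.
  exists (sup (range X)) => n; apply/andP; split.
    by apply: ub_le_sup; [exists (X 0%N + W * q 0%N) => _ [k _ <-]; exact: ubX | exists n].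
  by apply: ge_sup; [exists (X 0%N), 0%N | move=> _ [k _ <-]; exact: ubX].
have [px hpx] := lim (fun n => (P n).1) w w0 (fun n => (PS n).1).
have [py hpy] := lim (fun n => (P n).2) h h0 (fun n => (PS n).2).
have pin n : in_rect (P n).1 ((P n).1 + w * q n) (P n).2 ((P n).2 + h * q n) (mkc px py).
  by split; rewrite ?re_mk ?im_mk.
have [a [b [dgp bK]]] : exists a b, rdiff g (mkc px py) a b /\ nm b <= K.
  apply: dg; have [b1 b2 b3 b4 _] := badP 0%N; have [] := pin 0%N.
  by rewrite re_mk im_mk => /andP[? ?] /andP[? ?]; split; rewrite ?re_mk ?im_mk; apply/andP; split; lra.
pose S := (w + h) ^+ 2 + 1.
have S0 : 0 < S by rewrite ltr_wpDl ?sqr_ge0.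
have eS : 0 < e / (2 * S) by rewrite divr_gt0 // mulr_gt0.
have [d d0 Hd] := boundary_local eS dgp.
have [n nd] : exists n : nat, (w + h) * q n < d.
  have wh1 : 0 < w + h + 1 by rewrite ltr_wpDl // (addr_ge0 w0 h0).
  have dw : 0 < d / (w + h + 1) by rewrite divr_gt0.
  have [n Hn] := ltr_add_invr dw; exists n.
  have n2 : n.+1%:R <= 2 ^+ n :> R by rewrite -natrX ler_nat ltn_expl.
  have : q n < d / (w + h + 1).
    rewrite add0r in Hn; apply: le_lt_trans Hn; rewrite lef_pV2 // posrE.
      by rewrite exprn_gt0.
    by rewrite ltr0n.
  rewrite ltr_pdivlMr // => Hq; apply: le_lt_trans Hq.
  by rewrite mulrC ler_wpM2l ?ltW // ltrDl.
have [b1 b2 b3 b4] := badP n; apply/negP; rewrite -leNgt.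
have wq : 0 <= w * q n by rewrite mulr_ge0 // ltW.
have hq : 0 <= h * q n by rewrite mulr_ge0 // ltW.
have e1 x (y : R) : x + y - x = y by rewrite addrAC subrr add0r.
have := Hd _ _ _ _ _ _ _ (pin n); rewrite !e1 !lerDl -mulrDl => /(_ wq hq nd) Hn.
apply: le_trans (Hn _) _.
  by move=> z [/andP[? ?] /andP[? ?]]; apply: gc; split; apply/andP; split; lra.
have -> : 2 * nm b * (w * q n * (h * q n)) = 2 * nm b * (w * h) * q n ^+ 2 by ring.
have -> : 2 * (e / (2 * S)) * ((w + h) * q n) ^+ 2 = e * ((w + h) ^+ 2 / S) * q n ^+ 2.
  by field; rewrite gt_eqF.
rewrite -mulrDl ler_wpM2r ?sqr_ge0 // /c; apply: lerD.
  by rewrite ler_wpM2r ?mulr_ge0 // ler_wpM2l.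
by rewrite ler_piMr ?ltW // ltr_pdivrMr // mul1r /S ltrDl.
Qed.

End GoursatInequality.

(** * The complex exponential and means over circles *)

Section Exponential.
Context {R : realType}.
Local Notation C := (CC R).

Definition cis (t : R) : C := mkc (cos t) (sin t).
Definition cexp (z : C) : C := rc (expR (re z)) * cis (im z).

Lemma nm_cis t : nm (cis t) = 1.
Proof. by rewrite nm_def !reimE cos2Dsin2 sqrtr1. Qed.

Lemma cisD s t : cis (s + t) = cis s * cis t.
Proof. by apply: eqC; rewrite !reimE ?cosD ?sinD //; ring. Qed.

Lemma nm_cexp z : nm (cexp z) = expR (re z).
Proof. by rewrite nmM nm_cis mulr1 nm_rc ger0_norm // expR_ge0. Qed.

Lemma cexp_neq0 z : cexp z != 0.
Proof. by rewrite -nm_eq0 nm_cexp expR_eq0. Qed.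

Lemma cexpD z w : cexp (z + w) = cexp z * cexp w.
Proof. by rewrite /cexp reD imD expRD cisD rcM; ring. Qed.

Lemma cexp0 : cexp 0 = 1.
Proof. by apply: eqC; rewrite !reimE expR0 ?cos0 ?sin0; ring. Qed.

Lemma cexpN z : cexp (- z) = (cexp z)^-1.
Proof.
by apply: (mulfI (cexp_neq0 z)); rewrite -cexpD subrr cexp0 divff // cexp_neq0.
Qed.

Lemma cexp_mk (s t : R) : cexp (mkc s t) = rc (expR s) * cis t.
Proof. by rewrite /cexp re_mk im_mk. Qed.

Lemma cis_2pi : cis (2 * pi) = 1.
Proof. by apply: eqC; rewrite /cis !reimE mulr_natl ?cos2pi ?sin2pi. Qed.

Lemma cis0 : cis 0 = 1.
Proof. by apply: eqC; rewrite /cis !reimE ?cos0 ?sin0. Qed.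

Lemma cis_onto (u : C) : nm u = 1 -> exists t, cis t = u.
Proof.
move=> u1'; have u1 : re u ^+ 2 + im u ^+ 2 = 1 by rewrite -sqr_nm u1' expr1n.
have ru : -1 <= re u <= 1 by rewrite -ler_norml -u1' re_le_nm.
have su : sin (acos (re u)) = `|im u|.
  by rewrite sin_acos // -u1 addrAC subrr add0r sqrtr_sqr.
have cu : cos (acos (re u)) = re u by rewrite acosK // in_itv /=.
have [i0|i0] := leP 0 (im u).
  by exists (acos (re u)); apply: eqC; rewrite /cis !reimE // su ger0_norm.
exists (- acos (re u)); apply: eqC; rewrite /cis !reimE ?cosN ?sinN //.
by rewrite su ltr0_norm // opprK.
Qed.

Lemma cexp_onto (w : C) : w != 0 -> exists z, cexp z = w.
Proof.
move=> w0; have nw : 0 < nm w by rewrite nm_gt0.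
have [|t ct] := @cis_onto (w / rc (nm w)).
  by rewrite nmM nmV nm_rc ger0_norm ?nm_ge0 // divff // nm_eq0.
exists (mkc (ln (nm w)) t); rewrite cexp_mk lnK ?posrE // ct mulrC divfK //.
by rewrite rc_eq0 nm_eq0.
Qed.

Lemma is_derive_small (f : R -> R) (d e : R) : is_derive (0 : R) 1 f d -> 0 < e ->
  exists2 del : R, 0 < del & forall h : R, `|h| < del -> `|f h - f 0 - d * h| <= e * `|h|.
Proof.
move=> [F <-] e0.
have {}F : (fun h : R => h^-1 *: (f (h *: (1 : R) + 0) - f 0)) @ 0^' --> 'D_1 f 0 by [].
move/cvgrPdist_le: F => /(_ _ e0); rewrite /dnbhs /within /= => /nbhs_ballP[del /= d0 H].
exists del => // h hd; have [->|h0] := eqVneq h 0.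
  by rewrite subrr mulr0 subr0 normr0 mulr0.
have := H h; rewrite /ball /= sub0r normrN => /(_ hd h0).
rewrite /GRing.scale /= mulr1 addr0 -(ler_pM2r (x := `|h|)) ?normr_gt0 // -normrM.
by rewrite mulrBl mulrAC mulVf // mul1r distrC.
Qed.

Lemma rdiff_cexp p : rdiff cexp p (cexp p) 0.
Proof.
suff H0 : forall e : R, 0 < e -> exists2 d : R, 0 < d & forall h : C, nm h < d ->
    nm (cexp h - 1 - h) <= e * nm h.
  move=> e e0; have np : 0 < nm (cexp p) by rewrite nm_gt0 cexp_neq0.
  have [d d0 H] := H0 _ (divr_gt0 e0 np); exists d => // h /H {}H.
  rewrite cexpD mul0r subr0.
  have -> : cexp p * cexp h - cexp p - cexp p * h = cexp p * (cexp h - 1 - h) by ring.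
  rewrite nmM; apply: le_trans (ler_wpM2l (ltW np) H) _.
  by rewrite mulrA [_ * (e / _)]mulrC divfK // gt_eqF.
move=> e e0; pose e' := Num.min (e / 8) 1.
have e'0 : 0 < e' by rewrite lt_min ltr01 andbT divr_gt0.
have e'1 : e' <= 1 by rewrite ge_min lexx orbT.
have e'8 : e' <= e / 8 by rewrite ge_min lexx.
have D1 : is_derive (0 : R) 1 expR 1 by apply: is_derive_eq; rewrite expR0.
have D2 : is_derive (0 : R) 1 cos 0 by apply: is_derive_eq; rewrite sin0 oppr0.
have D3 : is_derive (0 : R) 1 sin 1 by apply: is_derive_eq; rewrite cos0.
have [d1 d10 H1] := is_derive_small D1 e'0.
have [d2 d20 H2] := is_derive_small D2 e'0.
have [d3 d30 H3] := is_derive_small D3 e'0.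
exists (Num.min (e' / 2) (Num.min d1 (Num.min d2 d3))).
  by rewrite !lt_min d10 d20 d30 divr_gt0.
move=> h; rewrite !lt_min => /and4P[h0 h1 h2 h3].
set x := re h; set y := im h.
have xh : `|x| <= nm h := re_le_nm h.
have yh : `|y| <= nm h := im_le_nm h.
have := H1 x (le_lt_trans xh h1); rewrite expR0 mul1r => {}H1.
have := H2 y (le_lt_trans yh h2); rewrite cos0 mul0r subr0 => {}H2.
have := H3 y (le_lt_trans yh h3); rewrite sin0 mul1r subr0 => {}H3.
have nh := nm_ge0 h.
have E1 : `|expR x - 1| <= e'.
  rewrite (_ : expR x - 1 = (expR x - 1 - x) + x); last by ring.
  apply: le_trans (ler_normD _ _) _.
  have : e' * `|x| <= `|x| by rewrite ler_piMl.
  by lra.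
have E2 : `|expR x| <= 2.
  rewrite (_ : expR x = (expR x - 1) + 1); last by ring.
  by apply: le_trans (ler_normD _ _) _; rewrite normr1; lra.
have eh : e' * nm h <= e / 8 * nm h by rewrite ler_wpM2r.
have X1 : `|expR x - 1 - x| <= e / 8 * nm h.
  by apply: le_trans H1 _; apply: le_trans eh; rewrite ler_pM2l.
have Y1 : `|cos y - 1| <= e / 8 * nm h.
  by apply: le_trans H2 _; apply: le_trans eh; rewrite ler_pM2l.
have Z1 : `|sin y - y| <= e / 8 * nm h.
  by apply: le_trans H3 _; apply: le_trans eh; rewrite ler_pM2l.
apply: le_trans (nm_le_reim _) _.
rewrite /cexp /cis !reimE -/x -/y !mul0r subr0 addr0 subr0.
rewrite (_ : expR x * cos y - 1 - x = expR x * (cos y - 1) + (expR x - 1 - x)); last by ring.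
rewrite (_ : expR x * sin y - y = expR x * (sin y - y) + (expR x - 1) * y); last by ring.
have W1 : `|expR x * (cos y - 1)| <= 2 * (e / 8 * nm h) by rewrite normrM ler_pM.
have W2 : `|expR x * (sin y - y)| <= 2 * (e / 8 * nm h) by rewrite normrM ler_pM.
have W3 : `|(expR x - 1) * y| <= e / 8 * nm h.
  by rewrite normrM; apply: le_trans eh; rewrite ler_pM.
apply: le_trans (lerD (ler_normD _ _) (ler_normD _ _)) _.
by have : 0 <= e * nm h by [rewrite mulr_ge0 // ltW]; lra.
Qed.

Lemma cexp_continuous : continuous cexp.
Proof. by move=> z; apply: rdiff_ctn (rdiff_cexp z). Qed.

Lemma cis_continuous : continuous cis.
Proof.
rewrite (_ : cis = cexp \o (fun t => mkc 0 t)); last first.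
  by apply/funext => t; rewrite /= cexp_mk expR0 mul1r.
move=> t; apply: continuous_comp; first exact: vert_continuous.
exact: cexp_continuous.
Qed.

End Exponential.

Section CircleMean.
Context {R : realType}.
Local Notation C := (CC R).
Implicit Types (f g : C -> C) (c : C) (r : R).

Definition circ c r t : C := c + rc r * cis t.
Definition mean c r f : C := rc (2 * pi)^-1 * pint (fun t => f (circ c r t)) 0 (2 * pi).
Definition rmean c r (u : C -> R) : R := (2 * pi)^-1 * rint (fun t => u (circ c r t)) 0 (2 * pi).
Definition ctn_circ (T : topologicalType) c r (f : C -> T) :=
  forall z, nm (z - c) = r -> {for z, continuous f}.

Lemma pi2_gt0 : 0 < 2 * pi :> R. Proof. by rewrite mulr_gt0 // pi_gt0. Qed.
Lemma pi2_ge0 : 0 <= 2 * pi :> R. Proof. exact: ltW pi2_gt0. Qed.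

Lemma nm_circ c r t : 0 <= r -> nm (circ c r t - c) = r.
Proof. by move=> r0; rewrite /circ addrAC subrr add0r nmM nm_cis mulr1 nm_rc ger0_norm. Qed.

Lemma circ_continuous c r : continuous (circ c r).
Proof.
rewrite (_ : circ c r = (fun z => c + rc r * z) \o cis) // => t.
apply: continuous_comp; first exact: cis_continuous.
exact: rdiff_ctn (rdiffD (rdiff_cst c _) (rdiffM (rdiff_cst (rc r) _) (rdiff_id _))).
Qed.

Lemma ctn_circ_on (T : topologicalType) c r (f : C -> T) a b : 0 <= r -> ctn_circ c r f ->
  ctn_on (fun t => f (circ c r t)) a b.
Proof.
move=> r0 cf; apply: ctn_on_comp => t _; first exact: circ_continuous.
by apply: cf; rewrite nm_circ.
Qed.

Lemma eq_mean c r f g : 0 <= r -> (forall z, nm (z - c) = r -> f z = g z) ->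
  mean c r f = mean c r g.
Proof. by move=> r0 fg; congr (_ * _); apply: eq_pint => t _; apply: fg; rewrite nm_circ. Qed.

Lemma meanD c r f g : 0 <= r -> ctn_circ c r f -> ctn_circ c r g ->
  mean c r (fun z => f z + g z) = mean c r f + mean c r g.
Proof.
move=> r0 cf cg; rewrite /mean -mulrDr; congr (_ * _).
by apply: pintD; apply: ctn_circ_on.
Qed.

Lemma meanB c r f g : 0 <= r -> ctn_circ c r f -> ctn_circ c r g ->
  mean c r (fun z => f z - g z) = mean c r f - mean c r g.
Proof.
move=> r0 cf cg; rewrite /mean -mulrBr; congr (_ * _).
by apply: pintB; apply: ctn_circ_on.
Qed.

Lemma meanZ c r f k : 0 <= r -> ctn_circ c r f ->
  mean c r (fun z => k * f z) = k * mean c r f.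
Proof.
move=> r0 cf; rewrite /mean mulrCA; congr (_ * _).
by apply: pintZ; apply: ctn_circ_on.
Qed.

Lemma mean_cj c r f : 0 <= r -> ctn_circ c r f ->
  mean c r (fun z => cj (f z)) = cj (mean c r f).
Proof.
move=> r0 cf; rewrite /mean cjM cj_rc; congr (_ * _).
by apply: pint_cj; apply: ctn_circ_on.
Qed.

Lemma mean_cst c r k : mean c r (fun=> k) = k.
Proof.
by rewrite /mean pint_cst ?pi2_ge0 // subr0 mulrCA -rcM mulVf ?mulr1 // gt_eqF // pi2_gt0.
Qed.

Lemma mean_nm c r f : 0 <= r -> ctn_circ c r f ->
  nm (mean c r f) <= rmean c r (fun z => nm (f z)).
Proof.
move=> r0 cf; rewrite /mean nmM nm_rc ger0_norm ?invr_ge0 ?pi2_ge0 //.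
by rewrite ler_wpM2l ?invr_ge0 ?pi2_ge0 //; apply: pint_nm; exact: ctn_circ_on.
Qed.

Lemma mean_le c r f M : 0 <= r -> ctn_circ c r f -> (forall z, nm (z - c) = r -> nm (f z) <= M) ->
  nm (mean c r f) <= M.
Proof.
move=> r0 cf fM; rewrite /mean nmM nm_rc ger0_norm ?invr_ge0 ?pi2_ge0 //.
rewrite mulrC ler_pdivrMr ?pi2_gt0 // -[X in M * X]subr0.
apply: pint_le; rewrite ?pi2_ge0 //; first exact: ctn_circ_on.
by move=> t _; apply: fM; rewrite nm_circ.
Qed.

Lemma rmean_le c r (u v : C -> R) : 0 <= r -> ctn_circ c r u -> ctn_circ c r v ->
  (forall z, nm (z - c) = r -> u z <= v z) -> rmean c r u <= rmean c r v.
Proof.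
move=> r0 cu cv uv; rewrite ler_wpM2l ?invr_ge0 ?pi2_ge0 //.
apply: rint_le; [exact: ctn_circ_on | exact: ctn_circ_on | move=> t _].
by apply: uv; rewrite nm_circ.
Qed.

Lemma rmeanD c r (u v : C -> R) : 0 <= r -> ctn_circ c r u -> ctn_circ c r v ->
  rmean c r (fun z => u z + v z) = rmean c r u + rmean c r v.
Proof.
move=> r0 cf cg; rewrite /rmean -mulrDr; congr (_ * _).
by apply: rintD; apply: ctn_circ_on.
Qed.

Lemma rmeanZ c r (u : C -> R) k : 0 <= r -> ctn_circ c r u ->
  rmean c r (fun z => k * u z) = k * rmean c r u.
Proof.
move=> r0 cf; rewrite /rmean mulrCA; congr (_ * _).
by apply: rintZ; apply: ctn_circ_on.
Qed.

Lemma re_mean c r f : re (mean c r f) = rmean c r (fun z => re (f z)).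
Proof. by rewrite /mean /pint !reimE mul0r subr0. Qed.

(** In the coordinate [w] with [z = exp w], concentric circles become vertical
    segments; the horizontal sides of the rectangle between two of them cancel
    by periodicity. *)
Lemma periodic_strip (F : C -> C) (s1 s2 K : R) : s1 <= s2 ->
  (forall t : R, F (mkc t (2 * pi)) = F (mkc t 0)) ->
  (forall z, s1 <= re z <= s2 -> exists a b, rdiff F z a b /\ nm b <= K) ->
  nm (vert F s2 0 (2 * pi) - vert F s1 0 (2 * pi)) <= 2 * K * ((s2 - s1) * (2 * pi)).
Proof.
move=> s12 per dF.
have := @goursat R F s1 s2 0 (2 * pi) K s12 pi2_ge0 (fun z hz => dF z hz.1).
rewrite subr0 /boundary (_ : horz F (2 * pi) s1 s2 = horz F 0 s1 s2); last first.
  by apply: eq_pint => t _; rewrite per.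
by rewrite subrr add0r nmM nm_mk01 mul1r.
Qed.

Lemma mean_vert c r f : 0 < r ->
  mean c r f = rc (2 * pi)^-1 * vert (fun w => f (c + cexp w)) (ln r) 0 (2 * pi).
Proof.
move=> r0; congr (_ * _); apply: eq_pint => t _.
by rewrite cexp_mk lnK ?posrE.
Qed.

Lemma mean_annulus c r1 r2 f : 0 < r1 -> r1 <= r2 ->
  (forall z, r1 <= nm (z - c) <= r2 -> hol f z) -> mean c r1 f = mean c r2 f.
Proof.
move=> r10 r12 hf; have r20 : 0 < r2 := lt_le_trans r10 r12.
rewrite (mean_vert c f r10) (mean_vert c f r20); apply: (congr1 (fun x => _ * x)).
apply/esym/eqP; rewrite -subr_eq0 -nm_eq0 eq_le nm_ge0 andbT.
have := @periodic_strip (fun w => f (c + cexp w)) (ln r1) (ln r2) 0.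
rewrite mulr0 mul0r; apply; first by rewrite ler_ln ?posrE.
  by move=> t; rewrite !cexp_mk cis_2pi cis0.
move=> z /andP[z1 z2]; have /hf /hol_rdiff H : r1 <= nm (c + cexp z - c) <= r2.
  rewrite addrAC subrr add0r nm_cexp; apply/andP; split.
    by rewrite -(lnK r10) ler_expR.
  by rewrite -(lnK r20) ler_expR.
eexists; eexists; split.
  exact: rdiff_comp (rdiffD (rdiff_cst c z) (rdiff_cexp z)) H.
by rewrite addr0 mulr0 nm0.
Qed.

(** The mean depends continuously on the radius, by compactness of the circle. *)
Lemma mean_radius c r0 f e : 0 <= r0 -> 0 < e -> ctn_circ c r0 f ->
  exists2 d, 0 < d & forall r, `|r - r0| < d -> 0 <= r -> ctn_circ c r f ->
    nm (mean c r f - mean c r0 f) <= e.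
Proof.
move=> r00 e0 cf.
have /compact_near_coveringP H := @segment_compact R 0 (2 * pi).
have := H R (nbhs r0) (fun r t => nm (f (circ c r t) - f (circ c r0 t)) <= e) _.
case=> [t _|d /= d0 Hd].
  have ct := cf _ (nm_circ c t r00).
  have e2 : 0 < e / 2 by rewrite divr_gt0.
  have [d1 d10 H1] := (ctnCP _ _).1 ct _ e2.
  have c0 : {for t, continuous (circ c r0)} by exact: circ_continuous.
  have d1h : 0 < d1 / 2 by rewrite divr_gt0.
  have N : \forall t' \near t, nm (circ c r0 t - circ c r0 t') <= d1 / 4.
    by move/cvgCP: c0; apply; rewrite divr_gt0.
  have M : \forall r \near r0, `|r0 - r| < d1 / 2.
    by apply/nbhs_ballP; exists (d1 / 2).
  near=> t' r => /=.
  rewrite (_ : f _ - f _ = (f (circ c r t') - f (circ c r0 t)) + (f (circ c r0 t) - f (circ c r0 t'))); last by ring.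
  have A : nm (circ c r0 t' - circ c r0 t) <= d1 / 4.
    by rewrite nmBC; near: t'.
  have B : nm (circ c r t' - circ c r0 t') < d1 / 2.
    rewrite /circ (_ : _ - _ = (rc r - rc r0) * cis t'); last by ring.
    by rewrite nmM nm_cis mulr1 -rcB nm_rc distrC; near: r.
  apply: le_trans (nmD _ _) _; rewrite [e]splitr; apply: lerD.
    apply: H1; rewrite (_ : _ - _ = (circ c r t' - circ c r0 t') + (circ c r0 t' - circ c r0 t)); last by ring.
    by apply: le_lt_trans (nmD _ _) _; lra.
  by rewrite nmBC; apply: H1; apply: le_lt_trans A _; lra.
exists d => // r rd r0' cr; have := Hd r; rewrite /ball /= distrC => /(_ rd) K.
have cb : ctn_on (fun t => f (circ c r t)) 0 (2 * pi) by exact: ctn_circ_on.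
have c0 : ctn_on (fun t => f (circ c r0 t)) 0 (2 * pi) by exact: ctn_circ_on.
rewrite /mean -mulrBr -(pintB cb c0) nmM nm_rc ger0_norm ?invr_ge0 ?pi2_ge0 //.
rewrite mulrC ler_pdivrMr ?pi2_gt0 // -[X in e * X]subr0.
by apply: (pint_le pi2_ge0 (ctn_onD cb (ctn_onN c0))) => t ht; apply: K; rewrite /= in_itv.
Unshelve. all: by end_near. Qed.

End CircleMean.

(** * Cauchy's formula and its consequences *)

Section Cauchy.
Context {R : realType}.
Local Notation C := (CC R).
Implicit Types (f g phi : C -> C) (c z : C) (r rho : R).

Definition hol_ball c rho f := forall z, nm (z - c) < rho -> hol f z.

Lemma hol_ctn f z : hol f z -> {for z, continuous f}.
Proof. by move=> /holP[a /rdiff_ctn]. Qed.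

Lemma hol_near f g z d : 0 < d -> (forall h, nm h < d -> f (z + h) = g (z + h)) ->
  hol f z -> hol g z.
Proof. by move=> d0 fg /holP[a F]; apply/holP; exists a; exact: rdiff_near fg F. Qed.

Lemma ctn_circ_cst c r (k : C) : ctn_circ c r (fun=> k).
Proof. by move=> z _; exact: rdiff_ctn (rdiff_cst k z). Qed.
Lemma ctn_circB c r f g : ctn_circ c r f -> ctn_circ c r g -> ctn_circ c r (fun z => f z - g z).
Proof. by move=> cf cg z zr; exact: cvgB (cf z zr) (cg z zr). Qed.
Lemma ctn_circM c r f g : ctn_circ c r f -> ctn_circ c r g -> ctn_circ c r (fun z => f z * g z).
Proof. by move=> cf cg z zr; exact: cvgM (cf z zr) (cg z zr). Qed.

Lemma nm_small x : (forall e : R, 0 < e -> nm (x : C) <= e) -> x = 0.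
Proof.
move=> H; apply/eqP; rewrite -nm_eq0 eq_le nm_ge0 andbT.
by apply/ler_addgt0Pr => e e0; rewrite add0r; exact: H.
Qed.

(** The mean value property, where one circle may carry exceptional points at
    which the function is only continuous. *)
Lemma mean_value f c rho R0 r : 0 < r < R0 ->
  (forall z, nm (z - c) < R0 -> {for z, continuous f}) ->
  (forall z, nm (z - c) < R0 -> z != c -> nm (z - c) != rho -> hol f z) ->
  mean c r f = f c.
Proof.
move=> /andP[r0 rR] cf hf.
have cc s : s < R0 -> ctn_circ c s f by move=> sR z zs; apply: cf; rewrite zs.
have A s : 0 < s < R0 -> (rho <= 0) || (s < rho) -> mean c s f = f c.
  move=> /andP[s0 sR] hs; apply/eqP; rewrite -subr_eq0; apply/eqP/nm_small => e e0.
  have cR : nm (c - c) < R0 by rewrite subrr nm0 (lt_trans s0).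
  have [d d0 Hd] := (ctnCP _ _).1 (cf c cR) _ e0.
  pose s1 := Num.min s (d / 2).
  have s10 : 0 < s1 by rewrite lt_min s0 divr_gt0.
  have s1s : s1 <= s by rewrite ge_min lexx.
  have s1d : s1 < d by rewrite gt_min; apply/orP; right; lra.
  rewrite -(@mean_annulus R c s1 s f s10 s1s).
    rewrite -[X in _ - X](mean_cst c s1 (f c)).
    have c1 := cc _ (le_lt_trans s1s sR); have c2 := @ctn_circ_cst c s1 (f c).
    rewrite -(meanB (ltW s10) c1 c2).
    by apply: (mean_le (ltW s10) (ctn_circB c1 c2)) => z zs; apply: Hd; rewrite zs.
  move=> z /andP[z1 z2]; apply: hf.
  - exact: le_lt_trans sR.
  - by rewrite -subr_eq0 -nm_eq0 gt_eqF // (lt_le_trans s10).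
  - apply/eqP => zr; move: hs; rewrite -zr leNgt (lt_le_trans s10) //=.
    by rewrite ltNge z2.
have B s : 0 < s < R0 -> s <= rho -> mean c s f = f c.
  move=> /andP[s0 sR]; rewrite le_eqVlt => /predU1P[es|sr]; last first.
    by apply: A; rewrite ?s0 ?sr ?orbT.
  apply/eqP; rewrite -subr_eq0; apply/eqP/nm_small => e e0.
  have [d d0 Hd] := mean_radius (ltW s0) e0 (cc _ sR).
  pose s' := Num.max (s / 2) (s - d / 2).
  have s's : s' < s by rewrite gt_max; apply/andP; split; lra.
  have s'0 : 0 < s' by rewrite lt_max; apply/orP; left; lra.
  rewrite -(A s'); first last.
  - by rewrite -es s's orbT.
  - by rewrite s'0 (lt_trans s's).
  rewrite nmBC; apply: Hd; rewrite ?ltW //; last by apply: cc; exact: lt_trans sR.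
  rewrite ltr0_norm ?subr_lt0 // opprB ltrBlDr -ltrBlDl lt_max.
  by apply/orP; right; lra.
have [rr|rr] := leP r rho; first by apply: B; rewrite ?r0.
have [r00|r00] := leP rho 0; first by apply: A; rewrite ?r0 ?r00.
rewrite -(B rho) ?lexx ?r00 ?(lt_trans rr) //.
apply/eqP; rewrite -subr_eq0; apply/eqP/nm_small => e e0.
have [d d0 Hd] := mean_radius (ltW r00) e0 (cc _ (lt_trans rr rR)).
pose s := Num.min r (rho + d / 2).
have rs : rho < s by rewrite lt_min rr ltrDl divr_gt0.
have sr : s <= r by rewrite ge_min lexx.
rewrite -(@mean_annulus R c s r f) //; last 2 first.
- exact: lt_trans rs.
- move=> z /andP[z1 z2]; apply: hf.
  + exact: le_lt_trans rR.
  + by rewrite -subr_eq0 -nm_eq0 gt_eqF // (lt_le_trans _ z1) // (lt_trans r00).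
  + by rewrite gt_eqF // (lt_le_trans rs).
apply: Hd; last by apply: cc; exact: le_lt_trans rR.
- by rewrite gtr0_norm ?subr_gt0 // ltrBlDr gt_min; apply/orP; right; lra.
- by rewrite ltW // (lt_trans r00).
Qed.

Lemma mean_hol f c R0 r : 0 < r < R0 -> hol_ball c R0 f -> mean c r f = f c.
Proof.
move=> rR hf; apply: (@mean_value f c 0 R0 r rR) => z zR; first by apply: hol_ctn; exact: hf.
by move=> _ _; exact: hf.
Qed.

Lemma rdiff_quot f z w : w != z -> hol f w -> hol (fun x => (f x - f z) / (x - z)) w.
Proof.
move=> wz /holP[a F]; apply/holP.
have N := rdiffD F (rdiff_cst (- f z) w).
have D := rdiffD (rdiff_id w) (rdiff_cst (- z) w).
have wz0 : id w + - z != 0 by rewrite subr_eq0.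
have V := @rdiffV _ (fun x => x - z) w _ _ wz0 D.
by eexists; apply: rdiff_eq (rdiffM N V) _ _; [reflexivity | ring].
Qed.

(** The value at [z] makes the quotient continuous there, so that the mean value
    property, which tolerates such a point, applies to it. *)
Definition divq z f : C -> C := fun x => if x == z then derive1 f z else (f x - f z) / (x - z).

Lemma divqE z f x : f x = f z + (x - z) * divq z f x.
Proof.
rewrite /divq; have [->|xz] := eqVneq x z; first by rewrite subrr mul0r addr0.
by rewrite mulrC divfK ?subr_eq0 // addrC subrK.
Qed.

Lemma divq_hol z f w : w != z -> hol f w -> hol (divq z f) w.
Proof.
move=> wz hf; have d0 : 0 < nm (w - z) by rewrite nm_gt0 subr_eq0.
apply: (hol_near d0 _ (rdiff_quot wz hf)) => h hd.
rewrite /divq ifN //; apply/negP => /eqP e.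
by move: hd; rewrite -e opprD addrA subrr add0r nmN ltxx.
Qed.

Lemma divq_ctn z f : hol f z -> {for z, continuous (divq z f)}.
Proof.
move=> /hol_rdiff F; apply/ctnCP => e e0; have [d d0 H] := F _ e0; exists d => // w wd.
rewrite /divq eqxx; have [_|wz] := eqVneq w z; first by rewrite subrr nm0 ltW.
have := H _ wd; rewrite [z + _]addrC subrK mul0r subr0 => {}H.
have nw : 0 < nm (w - z) by rewrite nm_gt0 subr_eq0.
rewrite -(ler_pM2r nw) -nmM mulrBl divfK ?subr_eq0 //.
Qed.

Lemma mean_pole c z r : nm (z - c) < r ->
  mean c r (fun x => (x - c) / (x - z)) = 1.
Proof.
move=> zr; have r0 : 0 < r := le_lt_trans (nm_ge0 _) zr.
set q := fun x => _.
have zc (x : C) : r <= nm (x - c) -> nm (x - c) - nm (z - c) <= nm (x - z).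
  by move=> _; have -> : x - z = (x - c) - (z - c) by [ring]; exact: ler_nmB.
have hq x : r <= nm (x - c) -> x != z.
  by move=> xr; apply/eqP => e; move: xr; rewrite e leNgt zr.
have Hq x : r <= nm (x - c) -> hol q x.
  move=> /hq xz; apply/holP.
  have N := rdiffD (rdiff_id x) (rdiff_cst (- c) x).
  have D := rdiffD (rdiff_id x) (rdiff_cst (- z) x).
  have xz0 : id x + - z != 0 by rewrite subr_eq0.
  have V := @rdiffV _ (fun x => x - z) x _ _ xz0 D.
  by eexists; apply: rdiff_eq (rdiffM N V) _ _; [reflexivity | ring].
apply/eqP; rewrite -subr_eq0; apply/eqP/nm_small => e e0.
pose r' := r + nm (z - c) / e.
have n0 := nm_ge0 (z - c).
have rr' : r <= r' by rewrite lerDl divr_ge0 // ltW.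
have r'0 : 0 < r' := lt_le_trans r0 rr'.
rewrite (@mean_annulus R c r r' q r0 rr'); last by move=> x /andP[x1 _]; exact: Hq.
rewrite -[X in _ - X](mean_cst c r' (1 : C)).
have cq : ctn_circ c r' q by move=> x xr; apply: hol_ctn; apply: Hq; rewrite xr.
have c1 := @ctn_circ_cst c r' 1.
rewrite -(meanB (ltW r'0) cq c1); apply: (mean_le (ltW r'0) (ctn_circB cq c1)).
move=> x xr; have rx : r <= nm (x - c) by rewrite xr.
have xz := hq _ rx; have nx : 0 < nm (x - z) by rewrite nm_gt0 subr_eq0.
have -> : q x - 1 = (z - c) / (x - z) by rewrite /q; field; rewrite subr_eq0.
rewrite nmM nmV ler_pdivrMr //; apply: le_trans (ler_wpM2l (ltW e0) (zc _ rx)).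
rewrite xr /r' (_ : e * _ = e * (r - nm (z - c)) + nm (z - c)); last by field; rewrite gt_eqF.
by rewrite lerDr mulr_ge0 ?ltW // subr_gt0.
Qed.

Lemma cauchy f c z R0 r : hol_ball c R0 f -> nm (z - c) < r -> r < R0 ->
  f z = mean c r (fun x => f x * (x - c) / (x - z)).
Proof.
move=> hf zr rR; have r0 : 0 < r := le_lt_trans (nm_ge0 _) zr.
have zR := lt_trans zr rR.
have lin x : hol (fun x => x - c) x.
  apply/holP; eexists; apply: rdiff_eq (rdiffD (rdiff_id x) (rdiff_cst (- c) x)) _ _ => //.
  by rewrite addr0.
have M0 : mean c r (fun x => divq z f x * (x - c)) = 0.
  transitivity (divq z f c * (c - c)); last by rewrite subrr mulr0.
  apply: (@mean_value (fun x => divq z f x * (x - c)) c (nm (z - c)) R0 r); first by rewrite r0.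
    move=> x xR; have c1 : {for x, continuous (divq z f)}.
      have [->|xz] := eqVneq x z; first by apply: divq_ctn; exact: hf.
      by apply: hol_ctn; apply: divq_hol => //; exact: hf.
    exact: cvgM c1 (hol_ctn (lin x)).
  move=> x xR _ xz; have {}xz : x != z by apply: contraNneq xz => ->.
  have /holP[a A] := divq_hol xz (hf _ xR); have /holP[b B] := lin x.
  by apply/holP; eexists; apply: rdiff_eq (rdiffM A B) _ _; [reflexivity | ring].
have xz x : nm (x - c) = r -> x != z.
  by move=> xr; apply/eqP => e; move: zr; rewrite -e xr ltxx.
have hx x : nm (x - c) = r -> hol (fun x => (x - c) / (x - z)) x.
  move=> /xz {}xz; apply/holP.
  have N := rdiffD (rdiff_id x) (rdiff_cst (- c) x).
  have D := rdiffD (rdiff_id x) (rdiff_cst (- z) x).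
  have xz0 : id x + - z != 0 by rewrite subr_eq0.
  have V := @rdiffV _ (fun x => x - z) x _ _ xz0 D.
  by eexists; apply: rdiff_eq (rdiffM N V) _ _; [reflexivity | ring].
have c1 : ctn_circ c r (fun x => (x - c) / (x - z)).
  by move=> x /hx; exact: hol_ctn.
have c2 : ctn_circ c r (fun x => f x * ((x - c) / (x - z))).
  by apply: ctn_circM c1 => x xr; apply: hol_ctn; apply: hf; rewrite xr.
have c3 : ctn_circ c r (fun x => f z * ((x - c) / (x - z))).
  exact: ctn_circM (@ctn_circ_cst c r (f z)) c1.
rewrite (@eq_mean _ c r _ (fun x => f x * ((x - c) / (x - z)))) ?ltW //; last first.
  by move=> x _; rewrite mulrA.
apply/eqP; rewrite eq_sym -subr_eq0; apply/eqP; rewrite -{}M0.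
rewrite -[X in _ - X]mulr1 -(mean_pole zr) -(meanZ _ (ltW r0) c1) -(meanB (ltW r0) c2 c3).
apply: eq_mean; rewrite ?ltW // => x /xz {}xz.
by rewrite /divq (negbTE xz); field; rewrite subr_eq0.
Qed.

End Cauchy.

Section CauchyEstimates.
Context {R : realType}.
Local Notation C := (CC R).
Implicit Types (f g phi : C -> C) (c z : C) (r rho : R).

Lemma circ_bounded c r phi : 0 <= r -> ctn_circ c r phi ->
  exists2 M : R, 0 <= M & forall t, 0 <= t <= 2 * pi -> nm (phi (circ c r t)) <= M.
Proof.
move=> r0 cp; have cn : ctn_on (fun t => nm (phi (circ c r t))) 0 (2 * pi).
  by apply: ctn_on_nm; exact: ctn_circ_on.
have [|t0 _ Ht] := @EVT_max R (fun t => nm (phi (circ c r t))) 0 (2 * pi) pi2_ge0.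
  by apply: continuous_in_subspaceT => t; rewrite inE /= in_itv /=; exact: cn.
exists (nm (phi (circ c r t0))); first exact: nm_ge0.
by move=> t ht; apply: Ht; rewrite in_itv.
Qed.

Lemma mean_le_on c r f M : 0 <= r -> ctn_circ c r f ->
  (forall t, 0 <= t <= 2 * pi -> nm (f (circ c r t)) <= M) -> nm (mean c r f) <= M.
Proof.
move=> r0 cf fM; rewrite /mean nmM nm_rc ger0_norm ?invr_ge0 ?pi2_ge0 //.
rewrite mulrC ler_pdivrMr ?pi2_gt0 // -[X in M * X]subr0.
by apply: (pint_le pi2_ge0 _ fM); exact: ctn_circ_on.
Qed.

(** Differentiation under the integral sign for the Cauchy kernels. *)
Lemma mean_kernel_rdiff c r phi (k : C -> C -> C) (k' : C -> C) z (L d : R) :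
  0 <= r -> 0 < d -> 0 <= L -> ctn_circ c r phi ->
  (forall w, nm (w - z) < d -> ctn_circ c r (k w)) -> ctn_circ c r k' ->
  (forall h x, nm h < d -> nm (x - c) = r ->
     nm (k (z + h) x - k z x - h * k' x) <= L * nm h ^+ 2) ->
  rdiff (fun w => mean c r (fun x => phi x * k w x)) z (mean c r (fun x => phi x * k' x)) 0.
Proof.
move=> r0 d0 L0 cp ck ck' H e e0.
have [M M0 HM] := circ_bounded r0 cp.
pose B := M * L + 1; have B0 : 0 < B by rewrite ltr_wpDl // mulr_ge0.
exists (Num.min d (e / B)); first by rewrite lt_min d0 divr_gt0.
move=> h; rewrite lt_min => /andP[hd he].
have c1 : ctn_circ c r (k (z + h)) by apply: ck; rewrite addrAC subrr add0r.
have c2 : ctn_circ c r (k z) by apply: ck; rewrite subrr nm0.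
have p1 := ctn_circM cp c1; have p2 := ctn_circM cp c2; have p3 := ctn_circM cp ck'.
have p4 := ctn_circM (@ctn_circ_cst _ c r h) p3.
rewrite mul0r subr0 [mean c r _ * h]mulrC -(meanZ h r0 p3) -(meanB r0 p1 p2).
rewrite -(meanB r0 (ctn_circB p1 p2) p4).
have E t : 0 <= t <= 2 * pi -> nm ((fun x => phi x * k (z + h) x - phi x * k z x - h * (phi x * k' x)) (circ c r t)) <= M * (L * nm h ^+ 2).
  move=> ht; rewrite /=; set x := circ c r t.
  rewrite (_ : _ - _ = phi x * (k (z + h) x - k z x - h * k' x)); last by ring.
  by rewrite nmM ler_pM ?nm_ge0 //; [exact: HM | apply: H; rewrite // nm_circ].
apply: le_trans (mean_le_on r0 (ctn_circB (ctn_circB p1 p2) p4) E) _.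
have h0 := nm_ge0 h.
rewrite expr2 !mulrA ler_wpM2r //; move: he; rewrite ltr_pdivlMr // mulrC => /ltW.
apply: le_trans; rewrite ler_wpM2r // /B lerDl ler01 //.
Qed.

Lemma kernel_away c r z (x : C) h : nm (x - c) = r -> nm h < (r - nm (z - c)) / 2 ->
  [/\ x - z != 0, x - (z + h) != 0, nm (x - z)^-1 <= 2 / (r - nm (z - c)) &
    nm (x - (z + h))^-1 <= 2 / (r - nm (z - c))].
Proof.
move=> xr hd; have h0 := nm_ge0 h; set d := r - _ in hd *.
have d0 : 0 < d by lra.
have xz : d <= nm (x - z).
  have -> : x - z = (x - c) - (z - c) by ring.
  by rewrite /d -xr ler_nmB.
have xzh : d / 2 <= nm (x - (z + h)).
  have -> : x - (z + h) = (x - z) - h by ring.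
  by apply: le_trans (ler_nmB _ _); lra.
have d20 : 0 < d / 2 by rewrite divr_gt0.
have N (y : C) : d / 2 <= nm y -> y != 0 /\ nm y^-1 <= 2 / d.
  move=> yd; split; first by rewrite -nm_gt0 (lt_le_trans d20).
  rewrite nmV (_ : 2 / d = (d / 2)^-1); last by rewrite invf_div.
  by rewrite lef_pV2 // posrE // (lt_le_trans d20).
have [|a b] := N (x - z); first by lra.
by have [] := N _ xzh.
Qed.

Lemma hol_inv z (w : C) : w - z != 0 -> hol (fun x => (x - z)^-1) w.
Proof.
move=> wz; apply/holP.
have D := rdiffD (rdiff_id w) (rdiff_cst (- z) w).
have V := @rdiffV _ (fun x => x - z) w _ _ wz D.
by eexists; apply: rdiff_eq V _ _; [reflexivity | ring].
Qed.

Lemma ctn_circ_inv c r z : nm (z - c) < r -> ctn_circ c r (fun x => (x - z)^-1).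
Proof.
move=> zr x xr; apply: hol_ctn; apply: hol_inv.
by rewrite subr_eq0; apply/eqP => e; move: zr; rewrite -e xr ltxx.
Qed.

Lemma cauchy_kernel1 c r phi z : 0 <= r -> ctn_circ c r phi -> nm (z - c) < r ->
  rdiff (fun w => mean c r (fun x => phi x * (x - w)^-1)) z
    (mean c r (fun x => phi x * ((x - z)^-1 * (x - z)^-1))) 0.
Proof.
move=> r0 cp zr; set d := r - nm (z - c); have d0 : 0 < d by rewrite subr_gt0.
have cw w : nm (w - z) < d / 2 -> ctn_circ c r (fun x => (x - w)^-1).
  move=> wz; apply: ctn_circ_inv; have -> : w - c = (w - z) + (z - c) by ring.
  by apply: le_lt_trans (nmD _ _) _; rewrite -ltrBrDr (lt_trans wz) // ltr_pdivrMr // /d; lra.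
apply: (@mean_kernel_rdiff c r phi (fun w x => (x - w)^-1) _ z ((2 / d) ^+ 3) (d / 2) r0 _ _ cp cw).
- by rewrite divr_gt0.
- by rewrite exprn_ge0 // divr_ge0 // ltW.
- exact: ctn_circM (ctn_circ_inv zr) (ctn_circ_inv zr).
move=> h x hd xr; have [n1 n2 b1 b2] := kernel_away xr hd.
rewrite (_ : _ - _ = h ^+ 2 * ((x - z)^-1 * (x - z)^-1 * (x - (z + h))^-1)); last first.
  by field; rewrite n1 n2.
rewrite nmM nmX mulrC ler_wpM2r ?exprn_ge0 ?nm_ge0 // !nmM.
by rewrite !exprSr expr0 mul1r !ler_pM ?mulr_ge0 ?nm_ge0.
Qed.

Lemma cauchy_kernel2 c r phi z : 0 <= r -> ctn_circ c r phi -> nm (z - c) < r ->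
  exists a, rdiff (fun w => mean c r (fun x => phi x * ((x - w)^-1 * (x - w)^-1))) z a 0.
Proof.
move=> r0 cp zr; set d := r - nm (z - c); have d0 : 0 < d by rewrite subr_gt0.
have cw w : nm (w - z) < d / 2 -> ctn_circ c r (fun x => (x - w)^-1).
  move=> wz; apply: ctn_circ_inv; have -> : w - c = (w - z) + (z - c) by ring.
  by apply: le_lt_trans (nmD _ _) _; rewrite -ltrBrDr (lt_trans wz) // ltr_pdivrMr // /d; lra.
have ci := ctn_circ_inv zr.
eexists; apply: (@mean_kernel_rdiff c r phi (fun w x => (x - w)^-1 * (x - w)^-1)
  (fun x => 2 * ((x - z)^-1 * (x - z)^-1 * (x - z)^-1)) z (3 * (2 / d) ^+ 4) (d / 2) r0 _ _ cp (fun w wz => ctn_circM (cw w wz) (cw w wz))).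
- by rewrite divr_gt0.
- by rewrite mulr_ge0 // exprn_ge0 // divr_ge0 // ltW.
- exact: ctn_circM (@ctn_circ_cst _ c r 2) (ctn_circM (ctn_circM ci ci) ci).
move=> h x hd xr; have [n1 n2 b1 b2] := kernel_away xr hd.
set u := (x - z)^-1 in b1 *; set v := (x - (z + h))^-1 in b2 *.
have m0 : 0 <= 2 / d by rewrite divr_ge0 // ltW.
rewrite (_ : _ - _ = h ^+ 2 * (u * u * v * (v + 2 * u))); last first.
  by rewrite /u /v; field; rewrite n1 n2.
have B : nm (v + 2 * u) <= 3 * (2 / d).
  by apply: le_trans (nmD _ _) _; rewrite nmM nm_nat; lra.
rewrite nmM nmX mulrC ler_wpM2r ?exprn_ge0 ?nm_ge0 // !nmM.
have -> : 3 * (2 / d) ^+ 4 = (2 / d) * (2 / d) * (2 / d) * (3 * (2 / d)) by ring.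
by rewrite !ler_pM ?mulr_ge0 ?nm_ge0.
Qed.

Section Ball.
Variables (f : C -> C) (c : C) (R0 : R).
Hypothesis hf : hol_ball c R0 f.

Lemma hol_ball_circ r : r < R0 -> ctn_circ c r f.
Proof. by move=> rR x xr; apply: hol_ctn; apply: hf; rewrite xr. Qed.

Lemma ctn_circ_shift r : ctn_circ c r (fun x => x - c).
Proof.
by move=> x _; exact: rdiff_ctn (rdiffD (rdiff_id x) (rdiff_cst (- c) x)).
Qed.

Lemma cauchy_derive z r : nm (z - c) < r -> r < R0 ->
  derive1 f z = mean c r (fun x => f x * (x - c) * ((x - z)^-1 * (x - z)^-1)).
Proof.
move=> zr rR; have r0 : 0 <= r := le_trans (nm_ge0 _) (ltW zr).
apply: rdiff_derive1.
have cp := ctn_circM (hol_ball_circ rR) (@ctn_circ_shift r).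
have d0 : 0 < r - nm (z - c) by rewrite subr_gt0.
apply: (rdiff_near d0 _ (cauchy_kernel1 r0 cp zr)) => h hd.
rewrite (cauchy hf _ rR) //; have -> : z + h - c = h + (z - c) by ring.
by apply: le_lt_trans (nmD _ _) _; rewrite -ltrBrDr.
Qed.

(** Cauchy's formula expresses the derivative as the mean of a kernel that can
    be differentiated again. *)
Lemma hol_ball_derive : hol_ball c R0 (derive1 f).
Proof.
move=> z zR; pose r := (nm (z - c) + R0) / 2.
have zr : nm (z - c) < r by rewrite /r; lra.
have rR : r < R0 by rewrite /r; lra.
have r0 : 0 <= r := le_trans (nm_ge0 _) (ltW zr).
have cp := ctn_circM (hol_ball_circ rR) (@ctn_circ_shift r).
have [a A] := cauchy_kernel2 r0 cp zr.
have d0 : 0 < r - nm (z - c) by rewrite subr_gt0.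
apply/holP; exists a; apply: (rdiff_near d0 _ A) => h hd.
rewrite (cauchy_derive _ rR) //; have -> : z + h - c = h + (z - c) by ring.
by apply: le_lt_trans (nmD _ _) _; rewrite -ltrBrDr.
Qed.

Lemma cauchy_estimate r M : 0 < r < R0 -> (forall x, nm (x - c) = r -> nm (f x) <= M) ->
  nm (derive1 f c) <= M / r.
Proof.
move=> /andP[r0 rR] fM; have cr : nm (c - c) < r by rewrite subrr nm0.
rewrite (cauchy_derive cr rR).
have ci := ctn_circ_inv cr.
have cp := ctn_circM (ctn_circM (hol_ball_circ rR) (@ctn_circ_shift r)) (ctn_circM ci ci).
apply: (mean_le (ltW r0) cp) => x xr.
have xc : x - c != 0 by rewrite -nm_gt0 xr.
rewrite (_ : f x * _ * _ = f x / (x - c)); last by field.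
by rewrite nmM nmV xr ler_wpM2r ?invr_ge0 ?fM // ltW.
Qed.

Lemma cauchy_bound r M z : nm (z - c) < r -> r < R0 ->
  (forall x, nm (x - c) = r -> nm (f x) <= M) -> nm (f z) <= M * r / (r - nm (z - c)).
Proof.
move=> zr rR fM; have r0 : 0 <= r := le_trans (nm_ge0 _) (ltW zr).
rewrite (cauchy hf zr rR).
have cp := ctn_circM (ctn_circM (hol_ball_circ rR) (@ctn_circ_shift r)) (ctn_circ_inv zr).
apply: (mean_le r0 cp) => x xr; rewrite !nmM nmV xr.
have d0 : 0 < r - nm (z - c) by rewrite subr_gt0.
have xz : r - nm (z - c) <= nm (x - z).
  have -> : x - z = (x - c) - (z - c) by ring.
  by rewrite -xr ler_nmB.
apply: ler_pM; rewrite ?mulr_ge0 ?nm_ge0 ?invr_ge0 ?nm_ge0 //.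
  by rewrite ler_wpM2r // fM.
by rewrite lef_pV2 // posrE // (lt_le_trans d0).
Qed.

Lemma max_center r M : 0 < r < R0 -> (forall x, nm (x - c) = r -> nm (f x) <= M) -> nm (f c) <= M.
Proof.
move=> /andP[r0 rR] fM; rewrite -(mean_hol _ hf (r := r)) ?r0 //.
exact: (mean_le (ltW r0) (hol_ball_circ rR)).
Qed.

Lemma taylor1 r M h : nm h <= r / 2 -> 0 < r < R0 ->
  (forall x, nm (x - c) = r -> nm (f x) <= M) ->
  nm (f (c + h) - f c - derive1 f c * h) <= 2 * M / r ^+ 2 * nm h ^+ 2.
Proof.
move=> hr /andP[r0 rR] fM.
have cr : nm (c - c) < r by rewrite subrr nm0.
have hcr : nm (c + h - c) < r by rewrite addrAC subrr add0r; lra.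
have s := @ctn_circ_shift r; have f0 := hol_ball_circ rR.
have ci := ctn_circ_inv cr; have ch := ctn_circ_inv hcr.
have c1 := ctn_circM (ctn_circM f0 s) ch; have c2 := ctn_circM (ctn_circM f0 s) ci.
have c3 := ctn_circM (ctn_circM f0 s) (ctn_circM ci ci).
have c4 := ctn_circM (@ctn_circ_cst _ c r h) c3.
rewrite (cauchy hf hcr rR) (cauchy hf cr rR) (cauchy_derive cr rR) [mean _ _ _ * h]mulrC.
rewrite -(meanZ h (ltW r0) c3) -(meanB (ltW r0) c1 c2) -(meanB (ltW r0) (ctn_circB c1 c2) c4).
apply: (mean_le (ltW r0) (ctn_circB (ctn_circB c1 c2) c4)) => x xr.
have xc : x - c != 0 by rewrite -nm_gt0 xr.
have xh : r / 2 <= nm (x - (c + h)).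
  have -> : x - (c + h) = (x - c) - h by ring.
  by apply: le_trans (ler_nmB _ _); lra.
have r2 : 0 < r / 2 by rewrite divr_gt0.
have xh0 : x - (c + h) != 0 by rewrite -nm_gt0 (lt_le_trans r2).
rewrite (_ : _ - _ = f x * ((x - c)^-1 * (x - (c + h))^-1) * h ^+ 2); last by field; rewrite xc xh0.
rewrite nmM nmX ler_wpM2r ?exprn_ge0 ?nm_ge0 // !nmM !nmV xr.
rewrite (_ : 2 * M / r ^+ 2 = M * (r^-1 * (r / 2)^-1)); last by field; rewrite gt_eqF.
have K : (nm (x - (c + h)))^-1 <= (r / 2)^-1 by rewrite lef_pV2 // posrE (lt_le_trans r2).
apply: ler_pM; [exact: nm_ge0 | | exact: fM | ].
  by rewrite mulr_ge0 // invr_ge0 ?nm_ge0 // ltW.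
by rewrite ler_wpM2l // invr_ge0 ltW.
Qed.

Lemma divq_hol_ball : hol_ball c R0 (divq c f).
Proof.
move=> z zR; have [->|zc] := eqVneq z c; last by apply: divq_hol => //; exact: hf.
have R00 : 0 < R0 by apply: le_lt_trans (nm_ge0 _) zR.
pose r := R0 / 2; have r0 : 0 < r by rewrite divr_gt0.
have rR : r < R0 by rewrite /r; lra.
have cr : nm (c - c) < r by rewrite subrr nm0.
have cf := hol_ball_circ rR.
apply/holP; eexists; apply: (rdiff_near r0 _ (cauchy_kernel1 (ltW r0) cf cr)) => h hr.
have hcr : nm (c + h - c) < r by rewrite addrAC subrr add0r.
have s := @ctn_circ_shift r; have ci := ctn_circ_inv cr; have ch := ctn_circ_inv hcr.
rewrite /divq; have [e|hc] := eqVneq (c + h) c.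
  rewrite e (cauchy_derive cr rR); apply: (eq_mean (ltW r0)) => x xr.
  by have xc : x - c != 0; [rewrite -nm_gt0 xr | field].
rewrite (cauchy hf hcr rR) (cauchy hf cr rR).
have c1 := ctn_circM (ctn_circM cf s) ch; have c2 := ctn_circM (ctn_circM cf s) ci.
rewrite -(meanB (ltW r0) c1 c2) mulrC -(meanZ _ (ltW r0) (ctn_circB c1 c2)).
apply: (eq_mean (ltW r0)) => x xr.
have xc : x - c != 0 by rewrite -nm_gt0 xr.
have h0 : h != 0 by apply: contraNneq hc => ->; rewrite addr0.
have xh0 : x - (c + h) != 0.
  by rewrite subr_eq0; apply/eqP => e; move: hcr; rewrite -e xr ltxx.
have -> : c + h - c = h by ring.
by field; rewrite xc xh0 h0.
Qed.

End Ball.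

End CauchyEstimates.

(** * Zeros, logarithms and coefficient estimates *)

Section Applications.
Context {R : realType}.
Local Notation C := (CC R).
Implicit Types (f g h : C -> C) (c z : C) (r : R).

Definition entire f := forall z, hol f z.

Lemma entire_ball f c r : entire f -> hol_ball c r f.
Proof. by move=> ef z _; exact: ef. Qed.

Lemma entire_derive1 f : entire f -> entire (derive1 f).
Proof. by move=> ef z; apply: (hol_ball_derive (entire_ball (c := z) (r := 1) ef)); rewrite subrr nm0. Qed.

Lemma hol_ballS f c r c' r' : hol_ball c r f -> nm (c' - c) + r' <= r -> hol_ball c' r' f.
Proof.
move=> hf rr z zr; apply: hf; have -> : z - c = (z - c') + (c' - c) by ring.
by apply: le_lt_trans (nmD _ _) _; lra.
Qed.

Lemma hol_ball_bounded f c R0 r : hol_ball c R0 f -> r < R0 ->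
  exists2 M, 0 <= M & forall z, nm (z - c) <= r -> nm (f z) <= M.
Proof.
move=> hf rR; have [r0|r0] := leP 0 r; last first.
  by exists 0 => // z zr; move: (nm_ge0 (z - c)); rewrite leNgt (le_lt_trans zr).
pose s := (r + R0) / 2; have rs : r < s by rewrite /s; lra.
have sR : s < R0 by rewrite /s; lra.
have s0 : 0 <= s by lra.
have cf := hol_ball_circ hf sR.
have cfs := ctn_circM cf (@ctn_circ_shift _ c s).
have [M M0 HM] := circ_bounded s0 cfs.
exists (M / (s - r)); first by rewrite divr_ge0 // subr_ge0 ltW.
move=> z zr; have zs : nm (z - c) < s := le_lt_trans zr rs.
rewrite (cauchy hf zs sR); apply: (mean_le_on s0 (ctn_circM cfs (ctn_circ_inv zs))) => t ht.
rewrite nmM nmV; apply: ler_pM; rewrite ?invr_ge0 ?nm_ge0 ?HM //.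
have d0 : 0 < s - r by rewrite subr_gt0.
have K : s - r <= nm (circ c s t - z).
  have -> : circ c s t - z = (circ c s t - c) - (z - c) by ring.
  by apply: le_trans (ler_nmB _ _); rewrite nm_circ // lerB.
by rewrite lef_pV2 // posrE (lt_le_trans d0).
Qed.

(** ** Division by a power of the coordinate *)

Definition divqn c k f := iter k (divq c) f.

Lemma divqn_hol c r k f : hol_ball c r f -> hol_ball c r (divqn c k f).
Proof. by move=> hf; elim: k => [|k ih]; [exact: hf | exact: (divq_hol_ball ih)]. Qed.

Lemma divqn_entire c k f : entire f -> entire (divqn c k f).
Proof.
move=> ef z; apply: (@divqn_hol c (nm (z - c) + 1) k f (entire_ball ef)).
by rewrite ltrDl.
Qed.

Lemma divqn_taylor c k f z :
  f z = \sum_(j < k) divqn c j f c * (z - c) ^+ j + (z - c) ^+ k * divqn c k f z.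
Proof.
elim: k => [|k ih]; first by rewrite big_ord0 add0r expr0 mul1r.
rewrite {1}ih big_ord_recr /= -addrA; congr (_ + _).
by rewrite {1}(divqE c (divqn c k f) z) exprSr; ring.
Qed.

Lemma eq0_small (x M q : R) : 0 <= q < 1 -> (forall k : nat, x <= M * q ^+ k) -> x <= 0.
Proof.
move=> /andP[q0 q1] H.
have : (fun k => M * q ^+ k) @ \oo --> M * 0.
  apply: cvgM; first exact: cvg_cst.
  by apply: cvg_expr; rewrite ger0_norm.
rewrite mulr0 => cv; apply: (cvgr_to_ge cv).
exact: nearW.
Qed.

Lemma infinite_zero f c R0 : hol_ball c R0 f -> (forall k, divqn c k f c = 0) ->
  forall z, nm (z - c) < R0 -> f z = 0.
Proof.
move=> hf H0 z zR; have [r [zr rR]] : exists r, nm (z - c) < r /\ r < R0.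
  by exists ((nm (z - c) + R0) / 2); split; lra.
have r0 : 0 < r := le_lt_trans (nm_ge0 _) zr.
have [M M0 HM] := hol_ball_bounded hf rR.
have E k x : f x = (x - c) ^+ k * divqn c k f x.
  rewrite (divqn_taylor c k) big1 ?add0r // => j _; by rewrite H0 mul0r.
apply/eqP; rewrite -nm_eq0 eq_le nm_ge0 andbT.
apply: (@eq0_small _ (M * r / (r - nm (z - c))) (nm (z - c) / r)).
  by rewrite divr_ge0 ?nm_ge0 ?ltW //= ltr_pdivrMr // mul1r.
move=> k; have B x : nm (x - c) = r -> nm (divqn c k f x) <= M / r ^+ k.
  move=> xr; have := HM x; rewrite xr lexx => /(_ isT).
  by rewrite (E k) nmM nmX xr ler_pdivlMr ?exprn_gt0 // mulrC.
rewrite (E k z) nmM nmX.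
have := cauchy_bound (@divqn_hol _ _ k _ hf) zr rR B.
move=> /(ler_wpM2l (exprn_ge0 k (nm_ge0 (z - c)))) /le_trans; apply.
rewrite le_eqVlt; apply/orP; left; apply/eqP.
have rk : r ^+ k != 0 by rewrite expf_neq0 // gt_eqF.
have rn : r - nm (z - c) != 0 by rewrite gt_eqF // subr_gt0.
rewrite exprMn exprVn; move: (nm (z - c) ^+ k) (r ^+ k) (r - _) rk rn => u v d v0 d0.
by field; rewrite v0 d0.
Qed.

Lemma zero_order f c R0 : hol_ball c R0 f -> (exists2 z, nm (z - c) < R0 & f z != 0) ->
  exists m g, [/\ hol_ball c R0 g, g c != 0, (forall z, f z = (z - c) ^+ m * g z) &
    (entire f -> entire g)].
Proof.
move=> hf [z0 z0R fz0].
have [m [Hm Hlt]] : exists m, divqn c m f c != 0 /\ forall j, (j < m)%N -> divqn c j f c = 0.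
  have ex : exists m, divqn c m f c != 0.
    apply: contrapT => /forallNP H; move: fz0; rewrite (infinite_zero hf _ z0R) ?eqxx // => k.
    by apply/eqP; apply: contrapT => /negP; exact: H.
  exists (ex_minn ex); case: ex_minnP => m Hm Hmin; split=> // j jm.
  by apply/eqP; apply: contraTT jm => /Hmin; rewrite -leqNgt.
exists m, (divqn c m f); split; [exact: divqn_hol hf | exact: Hm | | exact: divqn_entire].
  move=> z; rewrite (divqn_taylor c m) big1 ?add0r // => j _.
  by rewrite Hlt // mul0r.
Qed.

Lemma isolated_zero f c R0 : 0 < R0 -> hol_ball c R0 f ->
  (forall z, nm (z - c) < R0 -> f z = 0) \/
  exists2 d, 0 < d <= R0 & forall z, 0 < nm (z - c) < d -> f z != 0.
Proof.
move=> R00 hf; have [ex|nex] := pselect (exists2 z, nm (z - c) < R0 & f z != 0); last first.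
  left=> z zR; apply/eqP; apply: contrapT => /negP fz; apply: nex; by exists z.
right; have [m [g [hg gc E _]]] := zero_order hf ex.
have /hol_ctn /ctnCP/(_ (nm (g c) / 2)) : hol g c by apply: hg; rewrite subrr nm0.
have gc0 : 0 < nm (g c) by rewrite nm_gt0.
case=> [|d d0 Hd]; first by rewrite divr_gt0.
exists (Num.min d R0); first by rewrite lt_min d0 R00 ge_min lexx orbT.
move=> z /andP[z0]; rewrite lt_min => /andP[zd zR].
rewrite E mulf_neq0 ?expf_neq0 -?nm_gt0 //.
have := Hd _ zd; rewrite nmBC => K; have := ler_nmB (g c) (g z); lra.
Qed.

(** ** Primitives and logarithms *)

Definition prim c f z : C := pint (fun t => f (c + rc t * (z - c)) * (z - c)) 0 1.

Lemma segment_in c z t : 0 <= t <= 1 -> nm (c + rc t * (z - c) - c) <= nm (z - c).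
Proof.
move=> /andP[t0 t1]; rewrite addrAC subrr add0r nmM nm_rc ger0_norm //.
by rewrite ler_piMl ?nm_ge0.
Qed.

Lemma prim_rdiff c f R0 z : hol_ball c R0 f -> nm (z - c) < R0 ->
  rdiff (prim c f) z (f z) 0.
Proof.
move=> hf zR; have [r [r0 rE]] : exists r, 0 < r /\ 2 * r = R0 - nm (z - c).
  by exists ((R0 - nm (z - c)) / 2); split; lra.
have [M M0 HM] : exists2 M, 0 <= M & forall w, nm (w - c) <= nm (z - c) + r -> nm (f w) <= M.
  by apply: (hol_ball_bounded hf); lra.
pose w t := c + rc t * (z - c).
have wb t : 0 <= t <= 1 -> nm (w t - c) <= nm (z - c) by exact: segment_in.
have hw t : 0 <= t <= 1 -> hol_ball (w t) (R0 - nm (z - c)) f.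
  by move=> /wb ht; apply: (hol_ballS hf); lra.
have rr : 0 < r < R0 - nm (z - c) by rewrite r0 /=; lra.
have Mw t x : 0 <= t <= 1 -> nm (x - w t) = r -> nm (f x) <= M.
  move=> /wb ht xr; apply: HM; have -> : x - c = (x - w t) + (w t - c) by ring.
  by apply: le_trans (nmD _ _) _; rewrite xr; lra.
have df t : 0 <= t <= 1 -> hol (derive1 f) (w t).
  move=> ht; apply: (hol_ball_derive hf).
  exact: le_lt_trans (wb _ ht) zR.
have cw : ctn_on w 0 1 by move=> t _; exact: line_continuous.
have fw v : ctn_on (fun t => c + rc t * v) 0 1 by move=> t _; exact: line_continuous.
have crc : ctn_on (fun t : R => rc t : C) 0 1 by move=> t _; exact: rc_continuous.
have cfw : ctn_on (fun t => f (w t)) 0 1.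
  apply: (ctn_on_comp cw) => t ht; apply: hol_ctn; apply: hf.
  exact: le_lt_trans (wb _ ht) zR.
have cdw : ctn_on (fun t => derive1 f (w t)) 0 1.
  by apply: (ctn_on_comp cw) => t /df /hol_ctn.
pose I t := f (w t) + rc t * (z - c) * derive1 f (w t).
have cI : ctn_on I 0 1.
  exact: ctn_onD cfw (ctn_onM (ctn_onM crc (@ctn_on_cst _ _ (z - c) 0 1)) cdw).
have FI : pint I 0 1 * (z - c) = f z * (z - c).
  (* the derivative of x |-> f x (x - c) along the segment *)
  have dF x : hol f x -> rdiff (fun x => f x * (x - c)) x (derive1 f x * (x - c) + f x) 0.
    move=> /hol_rdiff hx.
    by apply: rdiff_eq (rdiffM hx (rdiffD (rdiff_id x) (rdiff_cst (- c) x))) _ _; ring.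
  pose J x := (derive1 f x * (x - c) + f x) * (z - c).
  have wE t : J (w t) = (z - c) * I t by rewrite /J /I /w; ring.
  have fh t : 0 <= t <= 1 -> hol f (w t).
    by move=> ht; apply: hf; exact: le_lt_trans (wb _ ht) zR.
  have sh x : rdiff (fun y : C => y - c) x (1 + 0) (0 + 0).
    exact: rdiffD (rdiff_id x) (rdiff_cst (- c) x).
  have L := @pint_line R (fun x => f x * (x - c)) J c (z - c) 1 ler01.
  rewrite mulrC -(pintZ _ cI) -(eq_pint (f := fun t => J (w t))); last by move=> t _; exact: wE.
  rewrite L.
  - by rewrite rc1 mul1r subrr mulr0 subr0 addrC subrK.
  - move=> t ht; have /hol_rdiff d1 := df t ht; have /hol_rdiff d2 := fh t ht.
    exact: rdiff_ctn (rdiffM (rdiffD (rdiffM d1 (sh _)) d2) (rdiff_cst (z - c) _)).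
  - move=> t ht; eexists; eexists; split; first exact: (dF _ (fh t ht)).
    by rewrite mul0r addr0.
have {}FI : pint (fun t => I t) 0 1 = f z.
  have [zc|zc] := eqVneq z c; last by apply: (mulIf _ FI); rewrite subr_eq0.
  rewrite (eq_pint (g := fun=> f c)) ?pint_cst // ?subr0 ?rc1 ?mulr1 ?zc //.
  by move=> t _; rewrite /I /w zc subrr !mulr0 !mul0r !addr0.
move=> e e0.
pose B := nm (z - c) * (2 * M / r ^+ 2) + (M / r + 2 * M / r ^+ 2 * r) + 1.
have B0 : 0 < B.
  have a1 : 0 <= nm (z - c) * (2 * M / r ^+ 2).
    by rewrite mulr_ge0 ?nm_ge0 // divr_ge0 ?sqr_ge0 ?mulr_ge0 //.
  have a2 : 0 <= M / r by rewrite divr_ge0 // ltW.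
  have a3 : 0 <= 2 * M / r ^+ 2 * r.
    by apply: mulr_ge0; [rewrite divr_ge0 ?sqr_ge0 ?mulr_ge0 // | exact: ltW].
  by rewrite /B; lra.
exists (Num.min (r / 2) (e / B)); first by rewrite lt_min !divr_gt0.
move=> h; rewrite lt_min => /andP[hr he].
rewrite mul0r subr0 -FI /prim.
have wE t : c + rc t * (z + h - c) = w t + rc t * h by rewrite /w; ring.
have inb t : 0 <= t <= 1 -> nm (w t + rc t * h - w t) <= nm h.
  move=> /andP[t0 t1]; rewrite addrAC subrr add0r nmM nm_rc ger0_norm //.
  by rewrite ler_piMl ?nm_ge0.
have cz : ctn_on (fun t => f (c + rc t * (z + h - c)) * (z + h - c)) 0 1.
  apply: ctn_onM (@ctn_on_cst _ _ _ 0 1); apply: (ctn_on_comp (fw _)) => t ht.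
  apply: hol_ctn; rewrite wE; apply: (hw _ ht); apply: le_lt_trans (inb _ ht) _; lra.
have cz0 : ctn_on (fun t => f (w t) * (z - c)) 0 1.
  exact: ctn_onM cfw (@ctn_on_cst _ _ _ 0 1).
rewrite [_ * h]mulrC -(pintZ h cI) -(pintB cz cz0).
have cI' := ctn_onM (@ctn_on_cst _ _ h 0 1) cI.
rewrite -(pintB (ctn_onD cz (ctn_onN cz0)) cI').
have bound t : 0 <= t <= 1 -> nm (f (c + rc t * (z + h - c)) * (z + h - c) - f (w t) * (z - c) - h * I t)
    <= B * nm h * nm h.
  move=> ht; rewrite wE.
  have hh : nm (rc t * h) <= nm h by have := inb _ ht; rewrite addrAC subrr add0r.
  have hrr : nm (rc t * h) <= r / 2 by apply: le_trans hh (ltW hr).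
  have T := taylor1 (hw _ ht) hrr rr (fun x => Mw t x ht).
  have D := cauchy_estimate (hw _ ht) rr (fun x => Mw t x ht).
  set X := f (w t + rc t * h) in T *; set d := derive1 f (w t) in T D *.
  have -> : X * (z + h - c) - f (w t) * (z - c) - h * I t =
      (z - c) * (X - f (w t) - d * (rc t * h)) + h * ((X - f (w t) - d * (rc t * h)) + d * (rc t * h)).
    by rewrite /I -/d; ring.
  have nh := nm_ge0 h.
  have K0 : 0 <= 2 * M / r ^+ 2 by rewrite divr_ge0 ?sqr_ge0 ?mulr_ge0 //.
  have {}T : nm (X - f (w t) - d * (rc t * h)) <= 2 * M / r ^+ 2 * (nm h * nm h).
    by apply: le_trans T _; rewrite ler_wpM2l // -expr2 lerXn2r ?nnegrE ?nm_ge0.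
  have T2 : nm (d * (rc t * h)) <= M / r * nm h by rewrite nmM ler_pM ?nm_ge0.
  apply: le_trans (nmD _ _) _; rewrite !nmM.
  apply: le_trans (lerD (ler_wpM2l (nm_ge0 (z - c)) T) (ler_wpM2l nh (nmD _ _))) _.
  apply: le_trans (lerD (lexx _) (ler_wpM2l nh (lerD T T2))) _.
  have S : 2 * M / r ^+ 2 * (nm h * nm h) <= 2 * M / r ^+ 2 * r * nm h.
    by rewrite -[leRHS]mulrA ler_wpM2l // ler_wpM2r //; lra.
  move: (ler_wpM2l nh S) (mulr_ge0 nh nh); rewrite /B.
  move: (2 * M / r ^+ 2) (M / r) (nm (z - c)) (nm h) => k m n u q1 q2; lra.
apply: le_trans (pint_le ler01 (ctn_onD (ctn_onD cz (ctn_onN cz0)) (ctn_onN cI')) bound) _.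
rewrite subr0 mulr1 ler_wpM2r ?nm_ge0 //.
by move: he; rewrite ltr_pdivlMr // mulrC => /ltW.
Qed.

End Applications.

Section Logarithm.
Context {R : realType}.
Local Notation C := (CC R).
Implicit Types (f g h : C -> C) (c z : C) (r : R).

Lemma ctn_circ_rZ c r (k : R) (u : C -> R) : ctn_circ c r u -> ctn_circ c r (fun x => k * u x).
Proof.
move=> cu x /cu cx; have ck : {for x, continuous (fun=> k)} by exact: cst_continuous.
exact: cvgM ck cx.
Qed.
Lemma ctn_circ_rD c r (u v : C -> R) : ctn_circ c r u -> ctn_circ c r v ->
  ctn_circ c r (fun x => u x + v x).
Proof. by move=> cu cv x xr; exact: cvgD (cu x xr) (cv x xr). Qed.

Lemma rdiff_zero_cst f c z : (forall t : R, 0 <= t <= 1 -> rdiff f (c + rc t * (z - c)) 0 0) ->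
  f z = f c.
Proof.
move=> H; apply/eqP; rewrite -subr_eq0 -nm_eq0 eq_le nm_ge0 andbT.
have {1}-> : z = c + (z - c) by rewrite addrC subrK.
apply: mvi_line => t /H F; exists (0, 0) => //=.
by rewrite !mul0r addr0 nm0.
Qed.

Definition log_of c f l : C -> C := fun z => prim c (fun x => derive1 f x / f x) z + l.

Lemma log_ofP c R0 f l : hol_ball c R0 f -> (forall z, nm (z - c) < R0 -> f z != 0) ->
  cexp l = f c -> forall z, nm (z - c) < R0 ->
  hol (log_of c f l) z /\ f z = cexp (log_of c f l z).
Proof.
move=> hf f0 el.
have hq : hol_ball c R0 (fun x => derive1 f x / f x).
  move=> x xR; have := hol_ball_derive hf xR; have := hf x xR.
  move=> /holP[a A] /holP[b B]; apply/holP; eexists.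
  by apply: rdiff_eq (rdiffM B (rdiffV (f0 _ xR) A)) _ _; [reflexivity | ring].
have dl x : nm (x - c) < R0 -> rdiff (log_of c f l) x (derive1 f x / f x) 0.
  move=> xR; apply: rdiff_eq (rdiffD (prim_rdiff hq xR) (rdiff_cst l x)) _ _; ring.
move=> z zR; split; first by apply/holP; eexists; exact: dl.
pose k x := f x * cexp (- log_of c f l x).
have kc : k c = 1.
  rewrite /k /log_of /prim (eq_pint (g := fun=> 0)) ?pint_cst // ?mul0r ?add0r.
    by rewrite cexpN el mulfV // -el cexp_neq0.
  by move=> t _; rewrite subrr mulr0.
have dk x : nm (x - c) < R0 -> rdiff k x 0 0.
  move=> xR; have /hol_rdiff A := hf x xR.
  have E := rdiff_comp (rdiffN (dl _ xR)) (rdiff_cexp _).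
  apply: rdiff_eq (rdiffM A E) _ _; rewrite /=; last by ring.
  by field; exact: f0.
have : k z = k c.
  apply: rdiff_zero_cst => t ht; apply: dk.
  exact: le_lt_trans (segment_in _ _ ht) zR.
rewrite kc /k cexpN => /(congr1 (fun x => x * cexp (log_of c f l z))).
by rewrite mul1r divfK ?cexp_neq0.
Qed.

Lemma log_ball c R0 f : 0 < R0 -> hol_ball c R0 f -> (forall z, nm (z - c) < R0 -> f z != 0) ->
  exists2 h, hol_ball c R0 h & forall z, nm (z - c) < R0 -> f z = cexp (h z).
Proof.
move=> R00 hf f0; have cc : nm (c - c) < R0 by rewrite subrr nm0.
have [l el] := cexp_onto (f0 _ cc).
by exists (log_of c f l) => z zR; have [] := log_ofP hf f0 el zR.
Qed.

Lemma log_entire f : entire f -> (forall z, f z != 0) ->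
  exists2 h, entire h & forall z, f z = cexp (h z).
Proof.
move=> ef f0; have [l el] := cexp_onto (f0 0).
have K z : hol (log_of 0 f l) z /\ f z = cexp (log_of 0 f l z).
  apply: (@log_ofP 0 (nm z + 1) f l (entire_ball ef)) => //.
  by rewrite subr0 ltrDl.
by exists (log_of 0 f l) => z; have [] := K z.
Qed.

(** ** Coefficients and real parts *)

Lemma hol_shiftX c k z : hol (fun x => (x - c) ^+ k) z.
Proof.
apply/holP; eexists; apply: rdiff_eq (rdiffX k (rdiffD (rdiff_id z) (rdiff_cst (- c) z))) _ _.
  by reflexivity.
by rewrite addr0 mulr0.
Qed.

Lemma inv_circ c r (x : C) : 0 < r -> nm (x - c) = r -> (x - c)^-1 = rc (r ^- 2) * cj (x - c).
Proof.
move=> r0 xr; have xc : x - c != 0 by rewrite -nm_gt0 xr.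
by apply: (mulfI xc); rewrite mulrCA mulcj xr divff // -rcM mulVf // expf_neq0 // gt_eqF.
Qed.

Lemma cjX (x : C) k : cj (x ^+ k) = cj x ^+ k.
Proof. by elim: k => [|k ih]; rewrite ?expr0 ?cj1 // !exprS cjM ih. Qed.

Lemma mean_conj_coef c r R0 h k : 0 < r < R0 -> hol_ball c R0 h ->
  mean c r (fun x => (x - c)^-1 ^+ k.+1 * cj (h x)) = 0.
Proof.
move=> /andP[r0 rR] hh; have r00 := ltW r0.
have cX := ctn_circM (fun x (_ : nm (x - c) = r) => hol_ctn (@hol_shiftX c k.+1 x)) (hol_ball_circ hh rR).
rewrite (eq_mean (g := fun x => rc (r ^- 2) ^+ k.+1 * cj ((x - c) ^+ k.+1 * h x)) r00); last first.
  by move=> x xr; rewrite (inv_circ r0 xr) exprMn cjM cjX mulrA.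
rewrite (meanZ _ r00); last first.
  by move=> x /cX cx; apply: (continuous_comp cx); exact: cj_continuous.
rewrite (mean_cj r00 cX) (@mean_hol _ _ c R0); first by rewrite subrr expr0n /= mul0r cj0 mulr0.
  by rewrite r0.
move=> x /hh /holP[a A]; have /holP[b B] := @hol_shiftX c k.+1 x.
by apply/holP; eexists; apply: rdiff_eq (rdiffM B A) _ _; [reflexivity | ring].
Qed.

Lemma ctn_circ_invX c r k : 0 < r -> ctn_circ c r (fun x => (x - c)^-1 ^+ k).
Proof.
move=> r0; have cr : nm (c - c) < r by rewrite subrr nm0.
have H := ctn_circ_inv cr; elim: k => [|k ih].
  by under eq_fun do rewrite expr0; exact: (@ctn_circ_cst _ c r 1).
by under eq_fun do rewrite exprS; exact: ctn_circM H ih.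
Qed.

Lemma coefE c r R0 h k : 0 < r < R0 -> hol_ball c R0 h ->
  divqn c k h c = mean c r (fun x => (x - c)^-1 ^+ k * h x).
Proof.
move=> rR; have /andP[r0 rR'] := rR; have r00 := ltW r0.
elim: k h => [|k ih] h hh.
  by rewrite /= -(mean_hol rR hh); apply: eq_mean => // x _; rewrite expr0 mul1r.
rewrite [divqn c k.+1 h]/divqn iterSr -/(divqn c k (divq c h)).
have hq : hol_ball c R0 (divq c h) := divq_hol_ball hh.
rewrite (ih _ hq).
have c1 := ctn_circM (@ctn_circ_invX c r k.+1 r0) (hol_ball_circ hh rR').
have c2 := ctn_circM (@ctn_circ_invX c r k.+1 r0) (@ctn_circ_cst _ c r (cj (h c))).
have c3 := ctn_circM (@ctn_circ_invX c r k.+1 r0) (@ctn_circ_cst _ c r (h c)).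
have hc : hol_ball c R0 (fun=> cj (h c)) by move=> x _; apply/holP; exists 0; exact: rdiff_cst.
have := @mean_conj_coef c r R0 (fun=> cj (h c)) k rR hc; rewrite cjK => Z.
rewrite -[RHS]subr0 -Z -(meanB r00 c1 c3).
apply: (eq_mean r00) => x xr; have xc : x - c != 0 by rewrite -nm_gt0 xr.
rewrite /divq ifN; last by rewrite -subr_eq0.
by rewrite exprS; ring.
Qed.

Lemma coef_bound c r R0 h k : 0 < r < R0 -> hol_ball c R0 h ->
  nm (divqn c k.+1 h c) * r ^+ k.+1 <= 2 * rmean c r (fun x => `|re (h x)|).
Proof.
move=> rR hh; have /andP[r0 rR'] := rR; have r00 := ltW r0.
have ch := hol_ball_circ hh rR'; have cX := @ctn_circ_invX c r k.+1 r0.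
have cc : ctn_circ c r (fun x => cj (h x)).
  by move=> x /ch cx; apply: (continuous_comp cx); exact: cj_continuous.
have c1 := ctn_circM cX ch; have c2 := ctn_circM cX cc.
rewrite (coefE _ rR hh) -[mean _ _ _]addr0 -(mean_conj_coef k rR hh) -(meanD r00 c1 c2).
have c3 : ctn_circ c r (fun x => (x - c)^-1 ^+ k.+1 * h x + (x - c)^-1 ^+ k.+1 * cj (h x)).
  by move=> x xr; exact: cvgD (c1 x xr) (c2 x xr).
rewrite -ler_pdivlMr ?exprn_gt0 //; apply: le_trans (mean_nm r00 c3) _.
have cu : ctn_circ c r (fun x => `|re (h x)|).
  move=> x /ch cx; apply: (@continuous_comp _ _ _ (fun x => re (h x)) Num.norm).
    by apply: (continuous_comp cx); exact: re_continuous.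
  exact: norm_continuous.
rewrite mulrAC -(rmeanZ _ r00 cu); apply: (rmean_le r00).
- by move=> x /c3 cx; apply: (continuous_comp cx); exact: nm_continuous.
- exact: ctn_circ_rZ cu.
move=> x xr; rewrite -mulrDr nmM nmX nmV xr.
have -> : h x + cj (h x) = rc (2 * re (h x)) by apply: eqC; rewrite !reimE; ring.
by rewrite nm_rc normrM ger0_norm // mulrCA mulrA exprVn.
Qed.

(** The first coefficient is at most twice the mean of the absolute value of
    the real part divided by the radius; when the real part is nonnegative,
    this mean is its value at the centre. *)
Lemma gradient_bound c r R0 h : 0 < r < R0 -> hol_ball c R0 h ->
  (forall z, nm (z - c) = r -> 0 <= re (h z)) -> nm (derive1 h c) * r <= 2 * re (h c).
Proof.
move=> rR hh h0; have /andP[r0 rR'] := rR; have r00 := ltW r0.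
have := @coef_bound c r R0 h 0 rR hh; rewrite expr1 /divqn /= {1}/divq eqxx => /le_trans; apply.
rewrite -(mean_hol rR hh) re_mean ler_pM2l //.
rewrite le_eqVlt; apply/orP; left; apply/eqP; congr (_ * _); apply: eq_rint => t _.
by rewrite ger0_norm // h0 // nm_circ.
Qed.

Lemma harnack c R0 h z : hol_ball c R0 h -> (forall z, nm (z - c) < R0 -> 0 <= re (h z)) ->
  nm (z - c) <= R0 / 4 -> 0 < R0 -> re (h z) <= expR 2 * re (h c).
Proof.
move=> hh h0 zR R00; pose v := z - c.
have inb t : 0 <= t <= 1 -> nm (c + rc t * v - c) <= R0 / 4.
  by move=> ht; apply: le_trans zR; exact: segment_in.
have B t : 0 <= t <= 1 -> nm (derive1 h (c + rc t * v)) * nm v <= 2 * re (h (c + rc t * v)).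
  move=> /inb; set w := c + _ => wR.
  have hw : hol_ball w (R0 / 2) h by apply: (hol_ballS hh); lra.
  have r3 : 0 < R0 / 3 < R0 / 2 by apply/andP; split; lra.
  have G : nm (derive1 h w) * (R0 / 3) <= 2 * re (h w).
    apply: (gradient_bound r3 hw) => x xw; apply: h0; have -> : x - c = (x - w) + (w - c) by ring.
    by apply: le_lt_trans (nmD _ _) _; rewrite xw; lra.
  by apply: le_trans G; rewrite ler_wpM2l ?nm_ge0 // /v; lra.
pose phi (t : R) := expR (- 2 * t) * re (h (c + rc t * v)).
have dphi (t : R) : 0 <= t <= 1 -> exists2 d : R, is_derive t 1 phi d & d <= 0.
  move=> ht; have hw : hol h (c + rc t * v) by apply: hh; apply: le_lt_trans (inb _ ht) _; lra.
  have [D _] := rdiff_line (hol_rdiff hw).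
  have [D2 _] := rdiff_line (@rdiff_cexp R (0 + rc t * rc (- 2))).
  have E1 (s : R) : re (cexp (0 + rc s * rc (- 2))) = expR (- 2 * s).
    by rewrite add0r -rcM /cexp /cis im_rc cos0 sin0 !reimE mulr1 mulr0 subr0 mulrC.
  have E : phi = (fun s : R => re (cexp (0 + rc s * rc (- 2)))) * (fun s => re (h (c + rc s * v))).
    by apply/funext => s; rewrite /phi -E1.
  exists (expR (- 2 * t) * re (derive1 h (c + rc t * v) * v) - 2 * expR (- 2 * t) * re (h (c + rc t * v))).
    rewrite E; apply: is_derive_eq; rewrite !mul0r !addr0 [re (cexp _ * _)]reM E1.
    by rewrite re_rc im_rc mulr0 subr0 -![_ *: _]/(_ * _); ring.
  have K := B t ht; have e0 := expR_ge0 (- 2 * t).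
  have L : re (derive1 h (c + rc t * v) * v) <= 2 * re (h (c + rc t * v)).
    by apply: le_trans (re_le _) _; rewrite nmM.
  have := ler_wpM2l e0 L; lra.
have cphi (t : R) : 0 <= t <= 1 -> {for t, continuous phi}.
  by move=> /dphi[d [dt _] _]; apply/differentiable_continuous/derivable1_diffP.
have [||t t01 Ht] := @MVT_segment R phi (derive1 phi) 0 1 ler01.
- move=> x; rewrite in_itv /= => /andP[x0 x1].
  have /dphi[d [dt dd] _] : 0 <= x <= 1 by rewrite !ltW.
  by apply: DeriveDef => //; rewrite derive1E.
- by apply: continuous_in_subspaceT => t; rewrite inE /= in_itv /=; exact: cphi.
have : derive1 phi t <= 0.
  rewrite derive1E; have /dphi[d [_ ->] //] : 0 <= t <= 1 by move: t01; rewrite in_itv.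
move: Ht; rewrite subr0 mulr1 => <-.
rewrite /phi mulr1 mulr0 expR0 mul1r rc1 mul1r rc0 mul0r addr0 /v [c + _]addrC subrK subr_le0.
move=> /(ler_wpM2l (expR_ge0 2)); rewrite mulrA -expRD.
by have -> : 2 + - 2 = 0 :> R by [ring]; rewrite expR0 mul1r.
Qed.

(** The growth, on arbitrarily large circles, forces the coefficients of order
    greater than [N] to vanish. *)
Lemma poly_of_growth h (A r0 : R) N : entire h ->
  (forall r, r0 <= r -> 0 < r -> rmean 0 r (fun x => `|re (h x)|) <= A * r ^+ N) ->
  exists p : {poly C}, forall z, h z = p.[z].
Proof.
move=> eh growth.
have coef0 k : (N <= k)%N -> divqn 0 k.+1 h 0 = 0.
  move=> Nk; apply/eqP; rewrite -nm_eq0 eq_le nm_ge0 andbT.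
  set a := nm _; have a0 : 0 <= a by exact: nm_ge0.
  pose r1 := Num.max r0 1.
  have K r : r1 <= r -> a * r <= 2 * A.
    rewrite ge_max => /andP[r0r r1r]; have rp : 0 < r := lt_le_trans ltr01 r1r.
    have rr : 0 < r < r + 1 by apply/andP; split; lra.
    have := @coef_bound 0 r (r + 1) h k rr (entire_ball eh).
    move=> /le_trans/(_ (ler_wpM2l _ (growth r r0r rp))) => /(_ (ler0n _ _)).
    rewrite -/a => H; have rN : 0 < r ^+ N by rewrite exprn_gt0.
    rewrite -(ler_pM2r rN) -!mulrA -exprS; apply: le_trans H.
    by rewrite ler_wpM2l //; apply: ler_weXn2l.
  rewrite leNgt; apply/negP => ap.
  have A0 : 0 <= A.
    by have := K r1 (lexx _); have : 0 <= a * r1 by [rewrite mulr_ge0 // le_max ler01 orbT]; lra.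
  have rA : r1 <= r1 + 2 * A / a by rewrite lerDl divr_ge0 // mulr_ge0.
  have := K _ rA; rewrite mulrDr mulrC [a * (_ / _)]mulrC divfK ?gt_eqF //.
  have : 0 < r1 * a by rewrite mulr_gt0 // lt_max ltr01 orbT.
  by lra.
pose q := divqn 0 N.+1 h.
have q0 z : q z = 0.
  have eq : entire q by exact: divqn_entire.
  apply: (@infinite_zero R q 0 (nm z + 1) (entire_ball eq)); last by rewrite subr0 ltrDl.
  by move=> k; rewrite /q /divqn -iterD addnS; apply: coef0; rewrite leq_addl.
exists (\sum_(j < N.+1) (divqn 0 j h 0) *: 'X^j) => z.
rewrite (divqn_taylor 0 N.+1 h z) -/q q0 mulr0 addr0 horner_sum.
by apply: eq_bigr => j _; rewrite !hornerE subr0.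
Qed.

Lemma abs_mean h (v : C -> R) c r R0 : 0 < r < R0 -> hol_ball c R0 h -> ctn_circ c r v ->
  (forall z, nm (z - c) = r -> 0 <= v z /\ re (h z) <= v z) ->
  rmean c r (fun x => `|re (h x)|) <= 2 * rmean c r v - re (h c).
Proof.
move=> rR hh cv hv; have /andP[r0 rR'] := rR; have r00 := ltW r0.
have ch := hol_ball_circ hh rR'.
have cr : ctn_circ c r (fun x => re (h x)).
  by move=> x /ch cx; apply: (continuous_comp cx); exact: re_continuous.
have cu : ctn_circ c r (fun x => `|re (h x)|).
  move=> x /cr cx; apply: (@continuous_comp _ _ _ (fun x => re (h x)) Num.norm); first exact: cx.
  exact: norm_continuous.
have c2 : ctn_circ c r (fun x => 2 * v x).
  exact: ctn_circ_rZ cv.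
have cm : ctn_circ c r (fun x => - 1 * re (h x)).
  exact: ctn_circ_rZ cr.
rewrite -(mean_hol rR hh) re_mean -mulN1r -(rmeanZ _ r00 cv) -(rmeanZ _ r00 cr) -(rmeanD r00 c2 cm).
apply: (rmean_le r00 cu).
  exact: ctn_circ_rD c2 cm.
move=> x /hv[v0 vh]; rewrite ler_norml; apply/andP; split; lra.
Qed.

(** ** Entire functions with finitely many zeros *)

Lemma finite_zeros (s : seq C) f : entire f -> (exists z, f z != 0) ->
  (forall z, f z = 0 -> z \in s) ->
  exists p g, [/\ entire g, (forall z, g z != 0), (forall z, f z = p.[z] * g z) &
    exists rho : R, forall z, rho <= nm z -> 1 <= nm p.[z]].
Proof.
elim: s f => [|a s ih] f ef [z0 fz0] fs.
  exists 1, f; split=> //.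
  - by move=> z; apply/eqP => /fs.
  - by move=> z; rewrite hornerE mul1r.
  - by exists 0 => z _; rewrite hornerE nm1.
have [|m [g [_ ga E eg]]] := @zero_order R f a (nm (z0 - a) + 1) (entire_ball ef).
  by exists z0 => //; rewrite ltrDl.
have {}eg := eg ef.
have [||p [k [ek k0 E2 [rho Hrho]]]] := ih g eg.
- by exists a.
- move=> z gz; have /fs : f z = 0 by rewrite E gz mulr0.
  by rewrite inE => /predU1P[za|//]; move: ga; rewrite -za gz eqxx.
exists (('X - a%:P) ^+ m * p), k; split=> //.
  by move=> z; rewrite E E2 hornerM horner_exp hornerXsubC mulrA.
exists (Num.max rho (nm a + 1)) => z; rewrite ge_max => /andP[/Hrho z1 za].
rewrite hornerM horner_exp hornerXsubC nmM nmX; apply: mulr_ege1 => //; apply: exprn_ege1.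
by have := ler_nmB z a; lra.
Qed.

End Logarithm.

(** * Growth of entire curves with bounded spherical derivative *)

Section ParamIntegral.
Context {R : realType}.
Local Notation mu := (@lebesgue_measure R).

Lemma rint_param (f df : R -> R -> R) (a b s B : R) :
  (forall x, ctn_on (f x) a b) ->
  (forall t x : R, is_derive x 1 (f^~ t) (df x t)) ->
  (forall x t, x <= s + 1 -> `|df x t| <= B) ->
  is_derive s 1 (fun x => rint (f x) a b) (rint (df s) a b).
Proof.
move=> cf ddf HB.
have B0 : 0 <= B by apply: le_trans (HB s 0 _); rewrite ?normr_ge0 // lerDl.
have sI : [set` `]s - 1, s + 1[] s by rewrite /= in_itv /=; apply/andP; split; lra.
have mB : measurable [set` `[a, b]] by exact: measurable_itv.
have intU (x : R) : [set` `]s - 1, s + 1[] x -> mu.-integrable `[a, b] (EFin \o f x).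
  by move=> _; have := ctn_on_integrable (cf x).
have E x t : partial1of2 f x t = df x t.
  by rewrite partial1of2E; have [_ ->] := ddf t x.
have derU (x t : R) : [set` `]s - 1, s + 1[] x -> [set` `[a, b]] t -> derivable (f^~ t) x 1.
  by move=> _ _; have [] := ddf t x.
have G0 (t : R) : 0 <= (fun=> B : R) t by [].
have intG : mu.-integrable `[a, b] (EFin \o (fun=> B : R)).
  exact: ctn_on_integrable (@ctn_on_cst _ _ B a b).
have ubG (x t : R) : [set` `]s - 1, s + 1[] x -> [set` `[a, b]] t ->
    `|partial1of2 f x t| <= (fun=> B : R) t.
  by rewrite /= in_itv /= => /andP[_ xs] _; rewrite E; apply: HB; exact: ltW.
have D1 := @derivable_under_integral R _ _ mu f _ mB _ _ _ sI intU derU _ G0 intG ubG.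
have D2 := @differentiation_under_integral R _ _ mu f _ mB _ _ _ sI intU derU _ G0 intG ubG.
apply: DeriveDef; first exact: D1.
by rewrite -derive1E [LHS]D2; apply: eq_rint => t _; rewrite E.
Qed.
End ParamIntegral.

Section SphericalDerivative.
Context {R : realType} (m : nat).
Local Notation C := (CC R).
Implicit Types (th : 'I_m -> C -> C) (z w : C).

(** [sq] is the squared norm of a curve, [wr] the squared norm of its first
    associated curve, and [sph] the squared spherical derivative. *)
Definition sq th z : R := \sum_i nm (th i z) ^+ 2.
Definition wr th z : R :=
  \sum_i \sum_j nm (th i z * derive1 (th j) z - th j z * derive1 (th i) z) ^+ 2.
Definition sph th z : R := wr th z / sq th z ^+ 2.

Lemma sq_ge0 th z : 0 <= sq th z.
Proof. by apply: sumr_ge0 => i _; rewrite sqr_ge0. Qed.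

Lemma wr_ge0 th z : 0 <= wr th z.
Proof. by apply: sumr_ge0 => i _; apply: sumr_ge0 => j _; rewrite sqr_ge0. Qed.

Lemma sph_ge0 th z : 0 <= sph th z.
Proof. by rewrite divr_ge0 ?wr_ge0 ?sqr_ge0. Qed.

Lemma nm_le_sq th z i : nm (th i z) ^+ 2 <= sq th z.
Proof.
by rewrite /sq (bigD1 i) //= lerDl sumr_ge0 // => j _; rewrite sqr_ge0.
Qed.

(** Lagrange's identity; it turns the dbar derivative of [dlogsq] into the
    spherical derivative. *)
Lemma lagrange (a b : 'I_m -> C) :
  (\sum_i b i * cj (b i)) * (\sum_i a i * cj (a i)) -
  (\sum_i b i * cj (a i)) * (\sum_i a i * cj (b i)) =
  rc (2^-1 * \sum_i \sum_j nm (a i * b j - a j * b i) ^+ 2).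
Proof.
have E i j : rc (nm (a i * b j - a j * b i) ^+ 2) =
    (b j * cj (b j)) * (a i * cj (a i)) + (b i * cj (b i)) * (a j * cj (a j)) -
    (b j * cj (a j)) * (a i * cj (b i)) - (b i * cj (a i)) * (a j * cj (b j)).
  by rewrite -mulcj cjB !cjM; ring.
have RS : rc (\sum_i \sum_j nm (a i * b j - a j * b i) ^+ 2) = \sum_i \sum_j
    ((b j * cj (b j)) * (a i * cj (a i)) + (b i * cj (b i)) * (a j * cj (a j)) -
    (b j * cj (a j)) * (a i * cj (b i)) - (b i * cj (a i)) * (a j * cj (b j))).
  by rewrite rc_sum; apply: eq_bigr => i _; rewrite rc_sum; apply: eq_bigr => j _; exact: E.
rewrite rcM RS.
have big2 (u v : 'I_m -> C) : \sum_i \sum_j u i * v j = (\sum_i u i) * (\sum_i v i).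
  by rewrite mulr_suml; apply: eq_bigr => i _; rewrite mulr_sumr.
have big2' (u v : 'I_m -> C) : \sum_i \sum_j u j * v i = (\sum_i u i) * (\sum_i v i).
  by rewrite exchange_big; exact: big2.
transitivity (rc 2^-1 * (\sum_i \sum_j (b j * cj (b j)) * (a i * cj (a i)) +
    \sum_i \sum_j (b i * cj (b i)) * (a j * cj (a j)) -
    \sum_i \sum_j (b j * cj (a j)) * (a i * cj (b i)) -
    \sum_i \sum_j (b i * cj (a i)) * (a j * cj (b j)))).
  by rewrite !big2 !big2' rcV rc_nat; field.
congr (_ * _); rewrite -big_split /= -!sumrB; apply: eq_bigr => i _.
by rewrite -big_split /= -!sumrB.
Qed.

Lemma sqC th z : rc (sq th z) = \sum_i th i z * cj (th i z).
Proof. by rewrite /sq rc_sum; apply: eq_bigr => i _; rewrite mulcj. Qed.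

Section AtPoint.
Variables (th : 'I_m -> C -> C) (z : C).
Hypothesis hth : forall i, hol (th i) z.

Let P := \sum_i derive1 (th i) z * cj (th i z).

Lemma rdiff_sq : rdiff (fun w => rc (sq th w)) z P (cj P).
Proof.
have -> : (fun w => rc (sq th w)) = (fun w => \sum_i th i w * cj (th i w)).
  by apply/funext => w; exact: sqC.
have H i := rdiffM (hol_rdiff (@hth i)) (rdiff_cj (hol_rdiff (@hth i))).
apply: rdiff_eq (rdiff_sum _ H) _ _; first by apply: eq_bigr => i _; rewrite cj0 mulr0 addr0.
by rewrite /P cj_sum; apply: eq_bigr => i _; rewrite mul0r add0r cjM cjK mulrC.
Qed.

Lemma sq_ctn : {for z, continuous (sq th)}.
Proof.
have := rdiff_ctn rdiff_sq => H.
have -> : sq th = (fun w => re (rc (sq th w))) by apply/funext => w; rewrite re_rc.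
by apply: (continuous_comp H); exact: re_continuous.
Qed.

Definition dlogsq w : C := (\sum_i derive1 (th i) w * cj (th i w)) / rc (sq th w).

Lemma rdiff_dlogsq : (forall i, hol (derive1 (th i)) z) -> sq th z != 0 ->
  exists a, rdiff dlogsq z a (rc (2^-1 * sph th z)).
Proof.
move=> hd s0; have s0' : rc (sq th z) != 0 :> C by rewrite rc_eq0.
have H i := rdiffM (hol_rdiff (hd i)) (rdiff_cj (hol_rdiff (@hth i))).
have V := rdiffV s0' rdiff_sq.
eexists; apply: rdiff_eq (rdiffM (rdiff_sum _ H) V) _ _; first by reflexivity.
have -> : \sum_(i <- index_enum 'I_m) (0 * cj (th i z) + derive1 (th i) z * cj (derive1 (th i) z)) =
    \sum_i derive1 (th i) z * cj (derive1 (th i) z).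
  by apply: eq_bigr => i _; rewrite mul0r add0r.
rewrite -/P.
have L := lagrange (fun i => th i z) (fun i => derive1 (th i) z).
have cP : cj P = \sum_i th i z * cj (derive1 (th i) z).
  by rewrite /P cj_sum; apply: eq_bigr => i _; rewrite cjM cjK mulrC.
rewrite -sqC -/P -cP in L.
have -> : rc (2^-1 * sph th z) = rc (2^-1 * wr th z) / rc (sq th z) ^+ 2.
  by rewrite /sph mulrA rcM rcV rcX.
rewrite /wr -L.
by field.
Qed.

End AtPoint.

End SphericalDerivative.

Section Growth.
Context {R : realType} (m : nat).
Local Notation C := (CC R).
Variables (th : 'I_m -> C -> C) (K : R) (l : 'I_m).
Hypotheses (eth : forall i, entire (th i)) (th1 : forall z, th l z = 1)
  (thK : forall z, sph th z <= K).

Lemma sq_ge1 z : 1 <= sq th z.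
Proof. by have := nm_le_sq th z l; rewrite th1 nm1 expr1n. Qed.

Let sq_neq0 z : sq th z != 0.
Proof. by rewrite gt_eqF // (lt_le_trans ltr01) ?sq_ge1. Qed.

Let hth z i : hol (th i) z. Proof. exact: @eth. Qed.

Let F (w : C) : C := cexp w * dlogsq th (cexp w).
Let I (s : R) : C := vert F s 0 (2 * pi).
Let U (s t : R) : R := ln (sq th (cexp (mkc s t))).
Let M (s : R) : R := rint (U s) 0 (2 * pi).

Let dF w : exists a b, rdiff F w a b /\ nm b <= expR (re w) ^+ 2 * (K / 2).
Proof.
have [a A] := rdiff_dlogsq (@hth (cexp w)) (fun i => @entire_derive1 R (th i) (@eth i) (cexp w)) (sq_neq0 (cexp w)).
have B := rdiffM (rdiff_cexp w) (rdiff_chain (rdiff_cexp w) A).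
eexists; eexists; split; first exact: B.
have s0 : 0 <= 2^-1 * sph th (cexp w) by rewrite mulr_ge0 ?sph_ge0.
rewrite mul0r mulr0 !add0r nmM nm_cexp nmM nm_cj nm_cexp nm_rc (ger0_norm s0).
rewrite [leLHS](_ : _ = expR (re w) ^+ 2 * (sph th (cexp w) / 2)); last by ring.
by rewrite ler_wpM2l ?sqr_ge0 // ler_wpM2r.
Qed.

Let I_growth (s : R) : 0 <= s -> re (I s) <= nm (I 0) + 2 * (expR s ^+ 2 * (K / 2)) * (s * (2 * pi)).
Proof.
move=> s0; have K0 : 0 <= K := le_trans (sph_ge0 th 0) (thK 0).
have := @periodic_strip R F 0 s (expR s ^+ 2 * (K / 2)) s0 _ _; rewrite subr0 -/(I s) -/(I 0) => H.
have tri (x y : C) : re x <= nm y + nm (x - y).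
  by apply: le_trans (re_le _) _; apply: le_trans (nmD _ _); rewrite addrC subrK.
apply: le_trans (tri (I s) (I 0)) _; rewrite lerD2l; apply: H.
  by move=> t; rewrite /F !cexp_mk cis_2pi cis0.
move=> z /andP[z0 zs]; have [a [b [A B]]] := dF z; exists a, b; split=> //.
apply: le_trans B _; rewrite ler_wpM2r ?divr_ge0 // lerXn2r ?nnegrE ?expR_ge0 //.
by rewrite ler_expR.
Qed.

Let F_ctn w : {for w, continuous F}.
Proof. by have [a [b [/rdiff_ctn]]] := dF w. Qed.

Let dU (t s : R) : is_derive s 1 (U^~ t) (2 * re (F (mkc s t))).
Proof.
have D := rdiff_chain (rdiff_cexp (mkc s t)) (rdiff_sq (@hth (cexp (mkc s t)))).
have E (x : R) : mkc x t = mkc 0 t + rc x * 1 by apply: eqC; rewrite !reimE; ring.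
rewrite E in D; have [D1 _] := rdiff_line D.
have -> : U^~ t = @ln R \o (fun x => re (((fun w => rc (sq th w)) \o cexp) (mkc 0 t + rc x * 1))).
  by apply/funext => x; rewrite /U E.
have sp : 0 < re (((fun w => rc (sq th w)) \o cexp) (mkc 0 t + rc s * 1)).
  by rewrite /= (lt_le_trans ltr01) ?sq_ge1.
have D0 := is_derive1_ln sp.
apply: is_derive_eq (is_derive1_comp D0 D1) _.
rewrite -E !cj1 !mulr1 !cj0 !mulr0 !addr0 add0r /F /dlogsq.
set P := \sum_i _; set e := cexp _; set q := sq th e.
have q0 : q != 0 by exact: sq_neq0.
rewrite [X in X^-1](_ : _ = q); last exact: re_rc.
have alg (p u : C) (x : R) : x * re (p * u + cj p * cj u) = 2 * re (u * (p * rc x)).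
  by rewrite !reimE; ring.
by rewrite -rcV; exact: alg.
Qed.

Let cI (s : R) : ctn_on (fun t => F (mkc s t)) 0 (2 * pi).
Proof. by apply: ctn_on_comp => t _; [exact: vert_continuous | exact: F_ctn]. Qed.

Let F_bound (s0 : R) : exists2 B, 0 <= B & forall s t, s <= s0 -> nm (F (mkc s t)) <= B.
Proof.
have B1 i : exists2 B, 0 <= B & forall z, nm z <= expR s0 -> nm (th i z) <= B.
  have [|B B0 HB] := @hol_ball_bounded R (th i) 0 (expR s0 + 1) (expR s0) (entire_ball (@eth i)).
    by rewrite ltrDl.
  by exists B => // z zs; apply: HB; rewrite subr0.
have B2 i : exists2 B, 0 <= B & forall z, nm z <= expR s0 -> nm (derive1 (th i) z) <= B.
  have [|B B0 HB] := @hol_ball_bounded R _ 0 (expR s0 + 1) (expR s0)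
    (entire_ball (entire_derive1 (@eth i))).
    by rewrite ltrDl.
  by exists B => // z zs; apply: HB; rewrite subr0.
have /choice[b1 Hb1] : forall i, exists B, 0 <= B /\ forall z, nm z <= expR s0 -> nm (th i z) <= B.
  by move=> i; have [B ? ?] := B1 i; exists B.
have /choice[b2 Hb2] : forall i, exists B, 0 <= B /\ forall z, nm z <= expR s0 -> nm (derive1 (th i) z) <= B.
  by move=> i; have [B ? ?] := B2 i; exists B.
exists (expR s0 * \sum_i b2 i * b1 i).
  by rewrite mulr_ge0 ?expR_ge0 // sumr_ge0 // => i _; rewrite mulr_ge0 ?(Hb1 i).1 ?(Hb2 i).1.
move=> s t ss0; rewrite /F /dlogsq nmM nm_cexp re_mk nmM.
have nz : nm (cexp (mkc s t)) <= expR s0 by rewrite nm_cexp re_mk ler_expR.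
apply: ler_pM; rewrite ?expR_ge0 ?mulr_ge0 ?nm_ge0 ?ler_expR //.
rewrite nmV nm_rc ger0_norm ?sq_ge0 //.
apply: (@le_trans _ _ (nm (\sum_i derive1 (th i) (cexp (mkc s t)) * cj (th i (cexp (mkc s t)))))).
  by rewrite ler_piMr ?nm_ge0 // invf_le1 ?sq_ge1 // (lt_le_trans ltr01) ?sq_ge1.
apply: le_trans (nm_sum _ _ _) _; apply: ler_sum => i _.
by rewrite nmM nm_cj ler_pM ?nm_ge0 ?(Hb1 i).2 ?(Hb2 i).2.
Qed.

Let cU (s : R) : ctn_on (U s) 0 (2 * pi).
Proof.
move=> t _.
have c1 : {for t, continuous (fun t : R => cexp (mkc s t))}.
  exact: continuous_comp (@vert_continuous R s t) (@cexp_continuous R _).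
have c2 : {for t, continuous (fun t : R => sq th (cexp (mkc s t)))}.
  exact: continuous_comp c1 (sq_ctn (@hth _)).
apply: (continuous_comp c2); apply: continuous_ln.
by rewrite (lt_le_trans ltr01) ?sq_ge1.
Qed.

Let dM (s : R) : is_derive s 1 M (2 * re (I s)).
Proof.
have [B B0 HB] := F_bound (s + 1).
have <- : rint (fun t => 2 * re (F (mkc s t))) 0 (2 * pi) = 2 * re (I s).
  exact: rintZ (ctn_on_re (@cI s)).
apply: (@rint_param R U (fun x t => 2 * re (F (mkc x t))) 0 (2 * pi) s (2 * B)).
- exact: cU.
- by move=> t x; exact: dU.
move=> x t xs; rewrite normrM ger0_norm // ler_wpM2l //.
by apply: le_trans (re_le_nm _) _; exact: HB.
Qed.

(** The derivative of the circle mean with respect to the logarithm of the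
    radius is the real part of a vertical integral in logarithmic coordinates,
    which [periodic_strip] bounds. *)
Lemma growth : exists A, forall r, 1 <= r -> rmean 0 r (fun z => ln (sq th z)) <= A * r ^+ 4.
Proof.
have K0 : 0 <= K := le_trans (sph_ge0 th 0) (thK 0).
have p0 : 0 < 2 * pi :> R := pi2_gt0.
pose A1 := 2 * (nm (I 0) + K * (2 * pi)).
have A10 : 0 <= A1 by rewrite /A1 mulr_ge0 // addr_ge0 ?nm_ge0 // mulr_ge0 // ltW.
have ses (s : R) : s <= expR s by have := expR_ge1Dx s; lra.
have Mb s : 0 <= s -> M s <= M 0 + A1 * expR s ^+ 4.
  move=> s0; have cM x : {for x, continuous M}.
    by have [dMx _] := dM x; apply/differentiable_continuous/derivable1_diffP.
  have [||x xs] := @MVT_segment R M (fun x => 2 * re (I x)) 0 s s0.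
  - by move=> x _; exact: dM.
  - by apply: continuous_in_subspaceT => x _; exact: cM.
  rewrite subr0 => /eqP; rewrite subr_eq addrC => /eqP ->; rewrite lerD2l.
  have /andP[x0 xs'] : 0 <= x <= s by move: xs; rewrite in_itv.
  have es1 : 1 <= expR s by rewrite -[1]expR0 ler_expR.
  have ex : expR x <= expR s by rewrite ler_expR.
  have e0 := expR_ge0 s.
  have H : re (I x) <= (nm (I 0) + K * (2 * pi)) * expR s ^+ 3.
    apply: le_trans (I_growth x0) _; rewrite [leRHS]mulrDl; apply: lerD.
      by rewrite ler_peMr ?nm_ge0 // exprn_ege1.
    have -> : 2 * (expR x ^+ 2 * (K / 2)) * (x * (2 * pi)) = K * (2 * pi) * (expR x ^+ 2 * x) by field.
    rewrite ler_wpM2l ?mulr_ge0 ?pi_ge0 // [leRHS]exprSr ler_pM ?exprn_ge0 ?expR_ge0 //.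
      by rewrite lerXn2r ?nnegrE ?expR_ge0.
    exact: le_trans xs' (ses s).
  have H' : 2 * re (I x) <= A1 * expR s ^+ 3 by rewrite /A1; lra.
  apply: le_trans (ler_wpM2r s0 H') _.
  have e3 (e : R) : e ^+ 4 = e ^+ 3 * e by rewrite exprSr.
  by rewrite e3 mulrA; apply: ler_wpM2l (ses s); exact: mulr_ge0 A10 (exprn_ge0 _ e0).
exists ((2 * pi)^-1 * (`|M 0| + A1)) => r r1.
have r0 : 0 < r := lt_le_trans ltr01 r1.
have -> : rmean 0 r (fun z => ln (sq th z)) = (2 * pi)^-1 * M (ln r).
  congr (_ * _); apply: eq_rint => t _.
  by rewrite /U cexp_mk lnK ?posrE // /circ add0r.
rewrite -mulrA ler_wpM2l ?invr_ge0 ?pi2_ge0 //.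
apply: le_trans (Mb _ (ln_ge0 r1)) _; rewrite lnK ?posrE // mulrDl lerD2r.
by apply: le_trans (ler_norm _) _; rewrite ler_peMr // exprn_ege1.
Qed.

(** Removing a power of the coordinate leaves an exponential, and [growth]
    bounds from above the means of the real part of the exponent, which is
    therefore a polynomial. *)
Lemma component_exp i : (exists z, th i z != 0) -> (forall z, z != 0 -> th i z != 0) ->
  exists k (h : {poly C}), forall z, th i z = z ^+ k * cexp h.[z].
Proof.
move=> [z0 z0i] nz; have [A HA] := growth.
have [|k [g [_ g0 E eg]]] := @zero_order R (th i) 0 (nm z0 + 1) (entire_ball (@eth i)).
  by exists z0 => //; rewrite subr0 ltrDl.
have {}eg := eg (@eth i).
have gnz z : g z != 0.
  have [->//|z0'] := eqVneq z 0; have := nz _ z0'.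
  by rewrite E mulf_eq0 negb_or => /andP[].
have [h eh Eh] := log_entire eg gnz.
pose v z : R := 2^-1 * ln (sq th z).
have csq : forall r, ctn_circ 0 r v.
  move=> r; apply: ctn_circ_rZ => z _; apply: (continuous_comp (sq_ctn (@hth z))).
  by apply: continuous_ln; rewrite (lt_le_trans ltr01) ?sq_ge1.
have [p Hp] : exists p : {poly C}, forall z, h z = p.[z].
  apply: (@poly_of_growth R h (A + nm (h 0)) 1 4 eh) => r r1 r0.
  have rr : 0 < r < r + 1 by apply/andP; split; lra.
  have cl : ctn_circ 0 r (fun z => ln (sq th z)).
    move=> z _; apply: (continuous_comp (sq_ctn (@hth z))).
    by apply: continuous_ln; rewrite (lt_le_trans ltr01) ?sq_ge1.
  apply: le_trans (@abs_mean R h v 0 r (r + 1) rr (entire_ball eh) (csq r) _) _.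
    move=> z; rewrite subr0 => zr; have l0 : 0 <= ln (sq th z) by rewrite ln_ge0 ?sq_ge1.
    split; first by rewrite mulr_ge0.
    have -> : re (h z) = ln (nm (g z)) by rewrite Eh nm_cexp expRK.
    have gp : 0 < nm (g z) by rewrite nm_gt0.
    have : ln (nm (g z) ^+ 2) <= ln (sq th z).
      rewrite ler_ln ?posrE ?exprn_gt0 //; last by rewrite (lt_le_trans ltr01) ?sq_ge1.
      apply: le_trans (nm_le_sq th z i); rewrite E subr0 nmM nmX zr exprMn.
      by rewrite ler_peMl ?exprn_ge0 ?nm_ge0 // -exprM exprn_ege1.
    by rewrite lnXn // /v; lra.
  rewrite /v (rmeanZ _ (ltW r0) cl) mulrA divff // mul1r mulrDl; apply: lerD; first exact: HA.
  apply: le_trans (ler_norm _) _; rewrite normrN; apply: le_trans (re_le_nm _) _.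
  by rewrite ler_peMr ?nm_ge0 // exprn_ege1.
by exists k, p => z; rewrite E Eh Hp subr0.
Qed.

End Growth.

(** * Exponential polynomials *)

Section ExponentialPolynomials.
Context {R : realType}.
Local Notation C := (CC R).
Implicit Types (p P Q h : {poly C}) (z w : C) (f g G : C -> C).

Lemma rdiff_horner p z : rdiff (horner p) z p^`().[z] 0.
Proof.
elim/poly_ind: p => [|p c ih].
  have -> : horner (0 : {poly C}) = fun=> 0 by apply/funext => w; rewrite horner0.
  by rewrite derivC horner0; exact: rdiff_cst.
have -> : horner (p * 'X + c%:P) = fun w => p.[w] * w + c.
  by apply/funext => w; rewrite hornerMXaddC.
apply: rdiff_eq (rdiffD (rdiffM ih (rdiff_id z)) (rdiff_cst c z)) _ _; last by ring.
by rewrite derivMXaddC !hornerE; ring.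
Qed.

Lemma horner_entire p : entire (horner p).
Proof. by move=> z; apply/holP; exists p^`().[z]; exact: rdiff_horner. Qed.

Lemma horner_inj p : (forall z, p.[z] = 0) -> p = 0.
Proof.
move=> H; apply/eqP/negPn/negP => p0.
pose rs := [seq (i%:R : C) | i <- iota 0 (size p)].
have /= := @max_poly_roots _ p rs p0.
rewrite size_map size_iota ltnn => K; suff : false by []; apply: K.
  by apply/allP => x _; rewrite /root H.
rewrite map_inj_uniq ?iota_uniq // => i j /eqP; rewrite eqr_nat => /eqP //.
Qed.

Lemma entire_zero_ball f c (d : R) : 0 < d -> entire f ->
  (forall z, nm (z - c) < d -> f z = 0) -> forall z, f z = 0.
Proof.
move=> d0 ef H z; have R0 : 0 < nm (z - c) + 1 by rewrite ltr_wpDl ?nm_ge0.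
have [K|[e /andP[e0 _] K]] := isolated_zero R0 (entire_ball (c := c) ef).
  by apply: K; rewrite ltrDl.
pose s := Num.min d e / 2; have s0 : 0 < s by rewrite divr_gt0 // lt_min d0.
have [sd se] : s < d /\ s < e.
  have : Num.min d e <= d by rewrite ge_min lexx.
  have : Num.min d e <= e by rewrite ge_min lexx orbT.
  by rewrite /s; split; lra.
have E : nm (c + rc s - c) = s by rewrite addrAC subrr add0r nm_rc gtr0_norm.
have := K (c + rc s); rewrite E s0 se => /(_ isT) /eqP; case.
by apply: H; rewrite E.
Qed.

(** ** Order of vanishing *)

Definition vanish q G z := forall i, (i < q)%N -> derive1n i G z = 0.

Lemma vanishS q G z : vanish q.+1 G z <-> G z = 0 /\ vanish q (derive1 G) z.
Proof.
split=> [H|[H0 H] [|i] iq]; last by rewrite derive1Sn; exact: H.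
  by split=> [|i iq]; [exact: (H 0%N) | rewrite -derive1Sn; exact: H].
by rewrite derive1n0.
Qed.

Lemma vanish_le q q' G z : (q' <= q)%N -> vanish q G z -> vanish q' G z.
Proof. by move=> qq H i iq; apply: H; exact: leq_trans qq. Qed.

Lemma entireD f g : entire f -> entire g -> entire (fun z => f z + g z).
Proof.
move=> ef eg z; apply/holP; eexists.
by apply: rdiff_eq (rdiffD (hol_rdiff (ef z)) (hol_rdiff (eg z))) _ _; [reflexivity | ring].
Qed.

Lemma entireM f g : entire f -> entire g -> entire (fun z => f z * g z).
Proof.
move=> ef eg z; apply/holP; eexists.
by apply: rdiff_eq (rdiffM (hol_rdiff (ef z)) (hol_rdiff (eg z))) _ _; [reflexivity | ring].
Qed.

Lemma entireN f : entire f -> entire (fun z => - f z).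
Proof.
move=> ef z; apply/holP; eexists.
by apply: rdiff_eq (rdiffN (hol_rdiff (ef z))) _ _; [reflexivity | ring].
Qed.

Lemma derive1D f g : entire f -> entire g ->
  derive1 (fun z => f z + g z) = fun z => derive1 f z + derive1 g z.
Proof.
move=> ef eg; apply/funext => z; apply: rdiff_derive1.
by apply: rdiff_eq (rdiffD (hol_rdiff (ef z)) (hol_rdiff (eg z))) _ _; [reflexivity | rewrite addr0].
Qed.

Lemma derive1M f g : entire f -> entire g ->
  derive1 (fun z => f z * g z) = fun z => derive1 f z * g z + f z * derive1 g z.
Proof.
move=> ef eg; apply/funext => z; apply: rdiff_derive1.
by apply: rdiff_eq (rdiffM (hol_rdiff (ef z)) (hol_rdiff (eg z))) _ _; [reflexivity | rewrite mul0r mulr0 addr0].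
Qed.

Lemma vanishD q f g z : entire f -> entire g -> vanish q f z -> vanish q g z ->
  vanish q (fun w => f w + g w) z.
Proof.
elim: q f g => [|q ih] f g ef eg; first by move=> _ _ i.
move=> /vanishS[f0 vf] /vanishS[g0 vg]; apply/vanishS; split; first by rewrite f0 g0 addr0.
by rewrite (derive1D ef eg); exact: (ih _ _ (entire_derive1 ef) (entire_derive1 eg) vf vg).
Qed.

Lemma vanishM q f g z : entire f -> entire g -> vanish q g z ->
  vanish q (fun w => f w * g w) z.
Proof.
elim: q f g => [|q ih] f g ef eg; first by move=> _ i.
move=> H; have /vanishS[g0 vg] := H; apply/vanishS; split; first by rewrite g0 mulr0.
have ef' := entire_derive1 ef; have eg' := entire_derive1 eg.
rewrite (derive1M ef eg); apply: (vanishD (entireM ef' eg) (entireM ef eg')).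
  by apply: (ih _ _ ef' eg); exact: vanish_le H.
exact: (ih _ _ ef eg' vg).
Qed.

(** ** Terms [P exp h] *)

Definition ev (t : {poly C} * {poly C}) z : C := t.1.[z] * cexp t.2.[z].

Lemma rdiff_ev t z : rdiff (ev t) z ((t.1^`() + t.1 * t.2^`()).[z] * cexp t.2.[z]) 0.
Proof.
apply: rdiff_eq (rdiffM (rdiff_horner t.1 z) (rdiff_comp (rdiff_horner t.2 z) (rdiff_cexp _))) _ _.
  by rewrite /= hornerD hornerM; ring.
by rewrite mul0r !mulr0 add0r.
Qed.

Lemma ev_entire t : entire (ev t).
Proof. by move=> z; apply/holP; eexists; exact: rdiff_ev. Qed.

(** The operator [f |-> P f' - (P' + P h') f], whose kernel is spanned by
    [P exp h], on functions and on terms. *)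
Definition kill (t : {poly C} * {poly C}) G : C -> C := fun z =>
  t.1.[z] * derive1 G z + (- (t.1^`() + t.1 * t.2^`()).[z]) * G z.

Definition killt (t u : {poly C} * {poly C}) : {poly C} * {poly C} :=
  (t.1 * u.1^`() - t.1^`() * u.1 + t.1 * u.1 * (u.2^`() - t.2^`()), u.2).

Lemma kill_ev t u : kill t (ev u) = ev (killt t u).
Proof.
apply/funext => z; rewrite /kill (rdiff_derive1 (rdiff_ev u z)) /killt /ev /= !(hornerD, hornerM, hornerN); ring.
Qed.

Lemma killt_self t : (killt t t).1 = 0.
Proof. by rewrite /killt /=; ring. Qed.

Lemma killD t f g : entire f -> entire g ->
  kill t (fun z => f z + g z) = fun z => kill t f z + kill t g z.
Proof. by move=> ef eg; apply/funext => z; rewrite /kill (derive1D ef eg) !mulrDr addrACA. Qed.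

Lemma killZ t (c : C) f : entire f -> kill t (fun z => c * f z) = fun z => c * kill t f z.
Proof.
move=> ef; apply/funext => z; rewrite /kill.
rewrite (rdiff_derive1 (a := c * derive1 f z)); first by rewrite mulrDr mulrCA [_ * (c * _)]mulrCA.
by apply: rdiff_eq (rdiffM (rdiff_cst c z) (hol_rdiff (ef z))) _ _; rewrite mul0r ?mulr0 ?add0r.
Qed.

Lemma kill_vanish t q G z : entire G -> vanish q.+1 G z -> vanish q (kill t G) z.
Proof.
move=> eG H; have /vanishS[_ H1] := H.
have e1 : entire (horner t.1) by exact: horner_entire.
have e2 : entire (fun w => - (t.1^`() + t.1 * t.2^`()).[w]).
  by apply: entireN; exact: horner_entire.
have eG' := entire_derive1 eG.
apply: (vanishD (entireM e1 eG') (entireM e2 eG)); first exact: vanishM e1 eG' H1.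
by apply: (vanishM e2 eG); exact: vanish_le H.
Qed.

Definition comb (cs : seq C) (ts : seq ({poly C} * {poly C})) z : C :=
  \sum_(p <- zip cs ts) p.1 * ev p.2 z.

Lemma comb_cons c cs t ts : comb (c :: cs) (t :: ts) = fun z => c * ev t z + comb cs ts z.
Proof. by apply/funext => z; rewrite /comb /= big_cons. Qed.

Lemma cst_entire (c : C) : entire (fun=> c).
Proof. by move=> z; apply/holP; exists 0; exact: rdiff_cst. Qed.

Lemma comb_entire cs ts : entire (comb cs ts).
Proof.
elim: cs ts => [|c cs ih] [|t ts].
1-3: by rewrite (_ : comb _ _ = fun=> 0); [exact: cst_entire | apply/funext => z; rewrite /comb ?zip0s ?zips0 /= big_nil].
rewrite comb_cons; apply: entireD; last exact: ih.
by apply: entireM; [exact: cst_entire | exact: ev_entire].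
Qed.

Lemma kill_comb t cs ts : kill t (comb cs ts) = comb cs (map (killt t) ts).
Proof.
have K0 : kill t (fun=> 0) = fun=> 0.
  apply/funext => z; by rewrite /kill (rdiff_derive1 (rdiff_cst 0 z)) !mulr0 addr0.
have N cs' ts' : zip cs' ts' = [::] -> comb cs' ts' = fun=> 0.
  by move=> E; apply/funext => z; rewrite /comb E big_nil.
elim: cs ts => [|c cs ih] [|u ts].
- by rewrite !N.
- by rewrite !N.
- by rewrite !N.
rewrite /= !comb_cons killD; last exact: comb_entire.
  rewrite killZ; last exact: ev_entire.
  by rewrite ih kill_ev.
by apply: entireM; [exact: cst_entire | exact: ev_entire].
Qed.

Definition indep ts := forall cs, size cs = size ts ->
  (forall z, comb cs ts z = 0) -> all (pred1 0) cs.

Lemma indep_head t ts : indep (t :: ts) -> t.1 != 0.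
Proof.
move=> H; apply/eqP => t0.
have /= := H (1 :: nseq (size ts) 0); rewrite /= size_nseq => /(_ erefl) K.
suff /andP[/eqP/eqP] : all (pred1 0) ((1 : C) :: nseq (size ts) 0) by rewrite oner_eq0.
apply: K => z; rewrite comb_cons {1}/ev t0 horner0 mul0r mulr0 add0r /comb.
elim: ts {H} => [|u ts ih]; first by rewrite big_nil.
by rewrite /= big_cons mul0r add0r.
Qed.

Lemma poly_nonroot p : p != 0 -> exists z, p.[z] != 0.
Proof.
move=> p0; apply: contrapT => /forallNP H; move: p0; rewrite (_ : p = 0) ?eqxx //.
by apply: horner_inj => z; apply/eqP; apply: contrapT => /negP; exact: H.
Qed.

(** Where [t.1] does not vanish, the quotient by [ev t] has derivative zero. *)
Lemma kill_kernel t G : t.1 != 0 -> entire G -> (forall z, kill t G z = 0) ->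
  exists c, forall z, G z = c * ev t z.
Proof.
move=> t0 eG H; have [z0 tz0] := poly_nonroot t0.
have /ctnCP/(_ (nm t.1.[z0] / 2)) : {for z0, continuous (horner t.1)}.
  exact: rdiff_ctn (rdiff_horner _ _).
have n0 : 0 < nm t.1.[z0] by rewrite nm_gt0.
case=> [|d d0 Hd]; first by rewrite divr_gt0.
have nz w : nm (w - z0) < d -> t.1.[w] != 0.
  move=> /Hd K; rewrite -nm_gt0; have := ler_nmB t.1.[z0] t.1.[w]; rewrite nmBC in K; lra.
have ez w : nm (w - z0) < d -> ev t w != 0.
  by move=> /nz K; rewrite /ev mulf_neq0 ?cexp_neq0.
exists (G z0 / ev t z0) => z; apply/eqP; rewrite -subr_eq0; apply/eqP; move: z.
apply: (@entire_zero_ball (fun z => G z - G z0 / ev t z0 * ev t z) z0 d d0).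
  by apply: (entireD eG); apply: entireN; apply: entireM; [exact: cst_entire | exact: ev_entire].
move=> z zd; suff -> : G z = (G z / ev t z) * ev t z.
  rewrite (@rdiff_zero_cst _ (fun w => G w / ev t w) z0 z) ?subrr // => s hs.
  set w := z0 + _; have wd : nm (w - z0) < d by apply: le_lt_trans zd; exact: segment_in.
  apply: rdiff_eq (rdiffM (hol_rdiff (eG w)) (rdiffV (ez _ wd) (rdiff_ev t w))) _ _; last by ring.
  have Hw : derive1 G w = (t.1^`() + t.1 * t.2^`()).[w] * G w / t.1.[w].
    apply: (canRL (mulfK (nz _ wd))); have := H w; rewrite /kill mulNr => /subr0_eq.
    by rewrite mulrC.
  have T0 := nz _ wd; have e0 := cexp_neq0 (t.2.[w]).
  rewrite Hw /ev; field; rewrite e0 T0 //.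
by rewrite divfK // ez.
Qed.

Lemma kill_indep t ts : indep (t :: ts) -> indep (map (killt t) ts).
Proof.
move=> H cs; rewrite size_map => sz E.
have [c Hc] := @kill_kernel t (comb cs ts) (indep_head H) (@comb_entire cs ts)
  (fun z => etrans (f_equal (fun f => f z) (kill_comb t cs ts)) (E z)).
have /= := H (- c :: cs); rewrite /= sz => /(_ erefl) K.
have /andP[] // : all (pred1 0) (- c :: cs).
by apply: K => z; rewrite comb_cons Hc mulNr addNr.
Qed.

Definition monomial (t : {poly C} * {poly C}) := exists c m, t.1 = c *: 'X^m.

Lemma killt_monomial t u : monomial t -> monomial u -> t.2 = u.2 -> monomial (killt t u).
Proof.
case=> [c [m E]] [d [k E']] e; rewrite /monomial /killt /= E E' e subrr mulr0 addr0.
exists (c * d * (k%:R - m%:R)), (m + k).-1.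
have A (x : C) j : (x *: 'X^j : {poly C})^`() = (x * j%:R) *: 'X^(j.-1).
  by rewrite derivZ derivXn -scaler_nat scalerA.
have B (x y : C) i j : (x *: 'X^i) * (y *: 'X^j) = (x * y) *: 'X^(i + j) :> {poly C}.
  by rewrite -scalerAl -scalerAr scalerA exprD.
rewrite !A !B; case: m {E} => [|m]; case: k {E'} => [|k] /=.
- by rewrite !(mulr0, mul0r, scale0r, subrr).
- by rewrite !(mulr0, mul0r, scale0r, subr0) !add0n mulrA.
- rewrite !(mulr0, mul0r, scale0r, sub0r) !addn0 mulrN scaleNr.
  by congr (- (_ *: _)); ring.
by rewrite addnS addSn /= -scalerBl; congr (_ *: _); ring.
Qed.

(** Killing the terms one by one, each at the cost of one order of vanishing,
    leaves a single nonzero term. *)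
Lemma elimination t ts cs G : indep (t :: ts) -> size cs = (size ts).+1 ->
  all (fun c => c != 0) cs -> (forall z, G z = comb cs (t :: ts) z) ->
  exists2 P : {poly C}, P != 0 /\
    ((forall u, u \in t :: ts -> monomial u /\ u.2 = t.2) -> exists c k, P = c *: 'X^k) &
    forall z, vanish (size ts).+1 G z -> P.[z] = 0.
Proof.
have [n] := ubnP (size ts).
elim: n ts t cs G => // n ih [|u ts] t [|c cs] // G /= ltn It [sz] /andP[c0 cs0] E.
  exists t.1; first split.
  - exact: indep_head It.
  - by move=> /(_ t); rewrite mem_head => /(_ isT)[[d [k ->]] _]; exists d, k.
  move=> z /vanishS[]; rewrite E comb_cons /comb; case: cs sz {cs0 E} => // _.
  rewrite big_nil addr0 /ev => /eqP; rewrite mulf_eq0 (negbTE c0) /= mulf_eq0.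
  by rewrite (negbTE (cexp_neq0 _)) orbF => /eqP.
have EG : G = comb (c :: cs) [:: t, u & ts] by apply/funext.
have eG : entire G by rewrite EG; exact: comb_entire.
have K1 : kill t G = comb cs (map (killt t) (u :: ts)).
  rewrite EG kill_comb [map _ _]/=; rewrite comb_cons; apply/funext => z.
  by rewrite {1}/ev killt_self horner0 mul0r mulr0 add0r.
have {ih} ihm := fun t' cs' G' => ih (map (killt t) ts) t' cs' G'.
rewrite size_map in ihm; have {}ihm := fun t' cs' G' => ihm t' cs' G' ltn.
have It' : indep (killt t u :: map (killt t) ts) := kill_indep It.
have [P [P0 PX] HP] := ihm (killt t u) cs (kill t G) It' sz cs0 (fun z => f_equal (fun f => f z) K1).
exists P; last by move=> z vz; apply: HP; exact: kill_vanish.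
split=> // Hm; apply: PX => v; rewrite -map_cons => /mapP[w wu ->].
have [tm _] := Hm t (mem_head _ _).
have [wm we] := Hm w (mem_behead (s := t :: _) wu).
have [_ ue] := Hm u (mem_behead (s := t :: _) (mem_head _ _)).
split; first by apply: killt_monomial.
by rewrite /killt /= we ue.
Qed.

End ExponentialPolynomials.

(** * Exponential polynomials with few terms *)

Section FewTerms.
Context {R : realType}.
Local Notation C := (CC R).
Implicit Types (p P Q h : {poly C}) (z w : C) (G : C -> C).

Lemma horner_growth p : exists A N, 0 <= A /\ forall z, 1 <= nm z -> nm p.[z] <= A * nm z ^+ N.
Proof.
elim/poly_ind: p => [|p c [A [N [A0 H]]]].
  by exists 0, 0%N; split=> // z _; rewrite horner0 nm0 mul0r.
exists (A + nm c), N.+1; split=> [|z z1]; first by rewrite addr_ge0 ?nm_ge0.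
rewrite hornerMXaddC; apply: le_trans (nmD _ _) _; rewrite [leRHS]mulrDl nmM; apply: lerD.
  by rewrite [X in _ <= _ * X]exprSr mulrA ler_wpM2r ?nm_ge0 ?H.
by rewrite ler_peMr ?nm_ge0 // exprn_ege1.
Qed.

Definition exp_growth G := exists A N, 0 <= A /\
  forall z, 1 <= nm z -> nm (G z) <= expR (A * nm z ^+ N).

Lemma horner_exp_growth p : exp_growth (horner p).
Proof.
have [A [N [A0 H]]] := horner_growth p; exists A, N; split=> // z /H Hz.
by apply: le_trans Hz (le_trans _ (expR_ge1Dx _)); rewrite lerDr.
Qed.

Lemma cexp_exp_growth p : exp_growth (fun z => cexp p.[z]).
Proof.
have [A [N [A0 H]]] := horner_growth p; exists A, N; split=> // z /H Hz.
by rewrite nm_cexp ler_expR; exact: le_trans (re_le _) Hz.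
Qed.

Lemma growth_le (A r : R) N M : 0 <= A -> 1 <= r -> A * r ^+ N <= A * r ^+ (N + M).
Proof. by move=> A0 r1; rewrite ler_wpM2l // ler_weXn2l // leq_addr. Qed.

Lemma exp_growthM f g : exp_growth f -> exp_growth g -> exp_growth (fun z => f z * g z).
Proof.
move=> [A [N [A0 HA]]] [B [M [B0 HB]]]; exists (A + B), (N + M)%N.
split=> [|z z1]; first by rewrite addr_ge0.
rewrite nmM mulrDl expRD; apply: ler_pM; rewrite ?nm_ge0 //.
  by apply: le_trans (HA _ z1) _; rewrite ler_expR growth_le.
by apply: le_trans (HB _ z1) _; rewrite ler_expR addnC growth_le.
Qed.

Lemma exp_growthD f g : exp_growth f -> exp_growth g -> exp_growth (fun z => f z + g z).
Proof.
move=> [A [N [A0 HA]]] [B [M [B0 HB]]]; exists (A + B + 1), (N + M)%N.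
split=> [|z z1]; first by rewrite !addr_ge0.
have rp : 1 <= nm z ^+ (N + M) by rewrite exprn_ege1.
set r := nm z ^+ (N + M) in rp *; have r0 : 0 <= r by lra.
have Ar : nm (f z) <= expR ((A + B) * r).
  apply: le_trans (HA _ z1) _; rewrite ler_expR; apply: le_trans (growth_le N M A0 z1) _.
  by rewrite ler_wpM2r // lerDl.
have Br : nm (g z) <= expR ((A + B) * r).
  apply: le_trans (HB _ z1) _; rewrite ler_expR; apply: le_trans (growth_le M N B0 z1) _.
  by rewrite [(M + N)%N]addnC ler_wpM2r // lerDr.
apply: le_trans (nmD _ _) _; apply: (@le_trans _ _ (expR ((A + B) * r) * 2)); first by lra.
rewrite (_ : (A + B + 1) * r = (A + B) * r + r); last by ring.
rewrite expRD ler_wpM2l ?expR_ge0 //.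
by apply: le_trans (expR_ge1Dx _); lra.
Qed.

Lemma deriv_eq0 p : p^`() = 0 -> p = p.[0]%:P.
Proof.
move=> p0; apply/polyP => -[|i]; rewrite coefC /= ?horner_coef0 //.
have := congr1 (fun q : {poly C} => q`_i) p0; rewrite coef_deriv coef0 => /eqP.
by rewrite mulrn_eq0 /= => /eqP.
Qed.

(** Comparing degrees: the last summand dominates the first two. *)
Lemma wronskian_degree P Q h : P != 0 -> Q != 0 -> h != 0 ->
  P * Q^`() - P^`() * Q + P * Q * h != 0.
Proof.
move=> P0 Q0 h0; rewrite addrC addr_eq0; apply/eqP => E.
have PQ0 : P * Q != 0 by rewrite mulf_neq0.
have sP : (0 < size P)%N by rewrite size_poly_gt0.
have sQ : (0 < size Q)%N by rewrite size_poly_gt0.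
have sh : (0 < size h)%N by rewrite size_poly_gt0.
have dP := lt_size_deriv P0; have dQ := lt_size_deriv Q0.
have S1 := size_polyMleq P Q^`(); have S2 := size_polyMleq P^`() Q.
have S3 := size_polyD (P * Q^`()) (- (P^`() * Q)).
have S4 : size (P * Q * h) = (size P + size Q + size h).-2.
  rewrite !size_mul //; move: sP sQ sh; case: (size P) => // sp; case: (size Q) => // sq; case: (size h) => // s _ _ _.
have : (size (P * Q * h)%R < (size P + size Q).-1)%N.
  rewrite E size_polyN; apply: leq_ltn_trans S3 _; rewrite size_polyN gtn_max.
  have N (x y w : nat) : (0 < x -> w < y -> (x + w).-1 < (x + y).-1)%N by lia.
  apply/andP; split; first exact: leq_ltn_trans S1 (N _ _ _ sP dQ).
  by apply: leq_ltn_trans S2 _; rewrite addnC [X in (_ < X.-1)%N]addnC; exact: N.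
rewrite S4; move: sP sQ sh; case: (size P) => // sp; case: (size Q) => // sq; case: (size h) => // s _ _ _.
by rewrite !addSn !addnS /=; lia.
Qed.

(** Applying [kill t] for one term [t] shortens the relation; by degrees, the
    other nonzero terms survive, since their exponents differ from that of [t]
    by more than a constant. *)
Lemma exp_free (ts : seq ({poly C} * {poly C})) (cs : seq C) :
  uniq (map snd ts) -> all (fun t => t.2.[0] == 0) ts ->
  size cs = size ts -> all (fun c => c != 0) cs ->
  (forall z, comb cs ts z = 0) -> forall t, t \in ts -> t.1 = 0.
Proof.
have [n] := ubnP (size ts).
elim: n ts cs => // n ih [|t ts] // [|c cs] //= ltn /andP[tn un] /andP[t0 z0] [sz].
move=> /andP[c0 cs0] E.
have [tz|tnz] := eqVneq t.1 0.
  move=> u; rewrite inE => /orP[/eqP ->//|]; apply: (ih ts cs) => // z.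
  by have := E z; rewrite comb_cons /ev tz horner0 mul0r mulr0 add0r.
have K u : u \in ts -> u.1 = 0.
  move=> uts; apply/eqP/negPn/negP => u0.
  have snds : map snd (map (killt t) ts) = map snd ts by rewrite -map_comp.
  have := @ih (map (killt t) ts) cs; rewrite size_map snds all_map => /(_ ltn un z0 sz cs0) H.
  have {}H : (killt t u).1 = 0.
    apply: H; last by rewrite map_f.
    move=> z; have KC := kill_comb t (c :: cs) (t :: ts).
    rewrite (_ : comb (c :: cs) (t :: ts) = fun=> 0) in KC; last exact/funext.
    have := congr1 (fun f : C -> C => f z) KC; rewrite [map _ _]/= comb_cons /=.
    rewrite {1}/ev killt_self horner0 mul0r mulr0 add0r => <-.
    by rewrite /kill (rdiff_derive1 (rdiff_cst 0 z)) !mulr0 addr0.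
  have [d0|d0] := eqVneq (u.2^`() - t.2^`()) 0; last first.
    by have := wronskian_degree tnz u0 d0; rewrite /killt /= in H *; rewrite H eqxx.
  have /deriv_eq0 : (u.2 - t.2)^`() = 0 by rewrite derivB.
  rewrite !hornerE (eqP t0) (eqP (allP z0 _ uts)) subrr polyC0 => /subr0_eq e.
  by move: tn; rewrite -e map_f.
move=> u; rewrite inE => /orP[/eqP ->|/K //].
have ev0 z : ev t z = 0.
  have := E z; rewrite comb_cons (_ : comb cs ts z = 0).
    by rewrite addr0 => /eqP; rewrite mulf_eq0 (negbTE c0) => /eqP.
  rewrite /comb big_seq big1 // => -[c' v] /(map_f snd).
  rewrite -/(unzip2 _) unzip2_zip ?sz // => /K /= v0.
  by rewrite /ev /= v0 horner0 mul0r mulr0.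
apply: horner_inj => z; have /eqP := ev0 z; rewrite /ev mulf_eq0.
by rewrite (negbTE (cexp_neq0 _)) orbF => /eqP.
Qed.

Lemma sum_pred1_seq (T : eqType) (s : seq T) x (F : T -> C) : uniq s -> x \in s ->
  \sum_(y <- s | y == x) F y = F x.
Proof. by move=> us xs; rewrite -big_filter filter_pred1_uniq // big_seq1. Qed.

Definition tm (u : nat * {poly C}) : {poly C} * {poly C} := ('X^(u.1), u.2).

Variables (us : seq (nat * {poly C})).
Hypotheses (uus : uniq us) (us0 : all (fun u => u.2.[0] == 0) us).

Section Coefficients.
Variable b : nat * {poly C} -> C.

Lemma one_exponent p q : q.[0] = 0 ->
  (forall z, \sum_(u <- us) b u * ev (tm u) z = ev (p, q) z) ->
  forall u, u \in us -> b u != 0 -> u.2 = q.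
Proof.
move=> q0 E u uin bu; apply/eqP/negPn/negP => uq.
pose hs := undup (q :: map snd us).
pose P h := \sum_(v <- us | v.2 == h) b v *: 'X^(v.1) - (if h == q then p else 0).
have uh : u.2 \in hs by rewrite mem_undup inE map_f ?orbT.
have Phs : P u.2 = 0.
  suff H t : t \in [seq (P h, h) | h <- hs] -> t.1 = 0.
    by apply: (H (P u.2, u.2)); exact: (map_f (fun h => (P h, h)) uh).
  apply: (@exp_free _ (nseq (size hs) 1)).
  - by rewrite -map_comp map_id_in ?undup_uniq.
  - rewrite all_map; apply/allP => h; rewrite mem_undup inE /= => /orP[/eqP ->|/mapP[v vin ->]].
      by rewrite q0.
    exact: (allP us0).
  - by rewrite size_nseq size_map.
  - by apply/allP => c /nseqP[-> _]; rewrite oner_eq0.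
  move=> z; transitivity (\sum_(h <- hs) ev (P h, h) z).
    rewrite /comb; elim: hs {uh} => [|h hs' ih]; first by rewrite !big_nil.
    by rewrite /= !big_cons mul1r ih.
  have S h : ev (P h, h) z = \sum_(v <- us | v.2 == h) b v * ev (tm v) z - (if h == q then ev (p, q) z else 0).
    rewrite /ev /P /= hornerD hornerN mulrBl horner_sum mulr_suml; congr (_ - _).
      by apply: eq_bigr => v /eqP e; rewrite /ev /= hornerZ e -mulrA.
    by case: eqP => [->//|_]; rewrite horner0 mul0r.
  rewrite (eq_bigr _ (fun h _ => S h)) sumrB -big_mkcond /=.
  rewrite (exchange_big_dep xpredT) //=.
  have qh : q \in hs by rewrite mem_undup mem_head.
  rewrite (sum_pred1_seq _ (undup_uniq _) qh) -(E z).
  apply/eqP; rewrite subr_eq0; apply/eqP; rewrite [LHS]big_seq_cond [RHS]big_seq_cond.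
  apply: eq_bigr => v; rewrite andbT => vin.
  have vh : v.2 \in hs by rewrite mem_undup inE map_f ?orbT.
  rewrite (eq_bigl (fun h => h == v.2)) => [|h]; last by rewrite eq_sym.
  by rewrite (sum_pred1_seq _ (undup_uniq _) vh).
have := congr1 (fun r : {poly C} => r`_u.1) Phs.
rewrite /P (negbTE uq) subr0 coef0 coef_sum big_mkcond (bigD1_seq u) //= eqxx.
rewrite coefZ coefXn eqxx mulr1 big1 ?addr0 => [/eqP|v vu]; first by rewrite (negbTE bu).
case: eqP => // v2; rewrite coefZ coefXn; case: eqP => [e|_]; rewrite ?mulr0 //.
by move: vu; rewrite [v]surjective_pairing [X in _ != X]surjective_pairing -e v2 eqxx.
Qed.

Lemma types_free : (forall z, \sum_(u <- us) b u * ev (tm u) z = 0) ->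
  forall u, u \in us -> b u = 0.
Proof.
move=> E u uin; apply/eqP/negPn/negP => bu.
have : u.2 = u.2 + 'X.
  apply: (@one_exponent 0 _ _ _ u uin bu); first by rewrite !hornerE (eqP (allP us0 _ uin)) ?addr0.
  by move=> z; rewrite E /ev horner0 mul0r.
by move/eqP; rewrite -subr_eq0 opprD addrA subrr sub0r oppr_eq0 polyX_eq0.
Qed.

End Coefficients.

Lemma types_indep : indep (map tm us).
Proof.
move=> cs; rewrite size_map => sz E.
pose b u := nth 0 cs (index u us).
have csE : cs = map b us.
  apply: (@eq_from_nth _ 0); first by rewrite size_map.
  move=> i ics; rewrite (nth_map (0%N, 0)) ?sz -?sz // /b index_uniq -?sz //.
have /types_free H z : \sum_(u <- us) b u * ev (tm u) z = 0.
  by apply: etrans (E z); rewrite [in RHS]csE /comb zip_map big_map.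
by rewrite csE all_map; apply/allP => u /H /= ->.
Qed.

Variable b : nat * {poly C} -> C.

Lemma comb_sum (vs : seq (nat * {poly C})) z :
  comb (map b vs) (map tm vs) z = \sum_(u <- vs) b u * ev (tm u) z.
Proof. by rewrite /comb zip_map big_map. Qed.

Definition term_sum z : C := \sum_(u <- us) b u * ev (tm u) z.

Lemma term_sum_entire : entire term_sum.
Proof.
rewrite (_ : term_sum = comb (map b us) (map tm us)); first exact: @comb_entire.
by apply/funext => z; rewrite comb_sum.
Qed.

Lemma term_sum_growth : exp_growth term_sum.
Proof.
rewrite /term_sum; elim: (us) => [|u vs ih].
  rewrite (_ : (fun z => _) = horner 0); first exact: horner_exp_growth.
  by apply/funext => z; rewrite big_nil horner0.
rewrite (_ : (fun z => _) = (fun z => (b u *: 'X^(u.1)).[z] * cexp u.2.[z] +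
    \sum_(v <- vs) b v * ev (tm v) z)).
  apply: exp_growthD ih; apply: exp_growthM; first exact: horner_exp_growth.
  exact: cexp_exp_growth.
by apply/funext => z; rewrite big_cons /ev /= hornerZ -mulrA.
Qed.

Hypothesis b0 : forall u, u \in us -> b u != 0.

(** A linear combination of terms whose zeros off the origin have order at
    least the number of terms is trivial. By elimination it has finitely many
    zeros, so it is a polynomial times the exponential of a polynomial, by its
    growth; then all the exponents agree, and it is a polynomial without zeros
    off the origin. *)
Lemma few_terms : (forall z, z != 0 -> term_sum z = 0 -> vanish (size us) term_sum z) ->
  (size us <= 1)%N.
Proof.
move=> HV; rewrite leqNgt; apply/negP => s2.
have eG := term_sum_entire; have [A [N [A0 GA]]] := term_sum_growth.
have [u0 [v0 [vs Eus]]] : exists u v vs, us = [:: u, v & vs].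
  by case: us s2 => [|u [|v vs]] // _; exists u, v, vs.
have u0in : u0 \in us by rewrite Eus mem_head.
have v0in : v0 \in us by rewrite Eus !inE eqxx orbT.
have uv : u0 != v0 by move: uus; rewrite Eus /= inE negb_or -andbA => /andP[].
have Gnz : exists z, term_sum z != 0.
  apply: contrapT => /forallNP H; have := b0 u0in; rewrite (types_free _ u0in) ?eqxx // => z.
  by apply/eqP; apply: contrapT => /negP; exact: H.
have It : indep (tm u0 :: map tm (v0 :: vs)) by rewrite -map_cons -Eus; exact: types_indep.
have [|||P [P0 PX] HP] := @elimination R (tm u0) (map tm (v0 :: vs)) (map b us) term_sum It.
- by rewrite !size_map Eus.
- by rewrite all_map; apply/allP => u uin; exact: b0.
- by move=> z; rewrite -map_cons -Eus comb_sum.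
have {}HP z : z != 0 -> term_sum z = 0 -> P.[z] = 0.
  by move=> z0 Gz; apply: HP; rewrite size_map; have := HV z z0 Gz; rewrite Eus.
have [rs Ers] := closed_field_poly_normal P.
have [|p [g [eg gnz EG [rho Hrho]]]] := @finite_zeros R (0 :: rs) term_sum eG Gnz.
  move=> z Gz; rewrite inE; have [//|z0] := eqVneq z 0.
  have := HP z z0 Gz; rewrite Ers hornerZ => /eqP; rewrite mulf_eq0 lead_coef_eq0 (negbTE P0) /=.
  by rewrite -/(root _ _) root_prod_XsubC.
have [H eH EH] := log_entire eg gnz.
have [q Hq] : exists q : {poly C}, forall z, H z = q.[z].
  apply: (@poly_of_growth R H (2 * A + nm (H 0)) (Num.max rho 1) N eH) => r; rewrite ge_max => /andP[rr r1] r0.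
  have rr1 : 0 < r < r + 1 by apply/andP; split; lra.
  have Ar0 : 0 <= A * r ^+ N by rewrite mulr_ge0 // exprn_ge0 // ltW.
  apply: le_trans (@abs_mean R H (fun=> A * r ^+ N) 0 r (r + 1) rr1 (entire_ball eH) _ _) _.
  - by move=> x _; exact: cst_continuous.
  - move=> z; rewrite subr0 => zr; split=> //.
    have -> : re (H z) = ln (nm (g z)) by rewrite EH nm_cexp expRK.
    have gp : 0 < nm (g z) by rewrite nm_gt0.
    rewrite -ler_expR lnK ?posrE //; apply: (@le_trans _ _ (nm (term_sum z))).
      by rewrite EG nmM ler_peMl ?nm_ge0 // Hrho ?zr.
    by have := GA z; rewrite zr; exact.
  have -> : rmean 0 r (fun=> A * r ^+ N) = A * r ^+ N.
    by rewrite /rmean rint_cst ?pi2_ge0 // subr0 mulrCA mulVf ?mulr1 // gt_eqF // pi2_gt0.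
  rewrite [leRHS]mulrDl mulrA lerD2l.
  apply: le_trans (ler_norm _) _; rewrite normrN; apply: le_trans (re_le_nm _) _.
  by rewrite ler_peMr ?nm_ge0 // exprn_ege1.
have same u : u \in us -> u.2 = q - q.[0]%:P.
  move=> uin; apply: (@one_exponent b (cexp q.[0] *: p)) (b0 uin) => //.
    by rewrite !hornerE subrr.
  move=> z; rewrite -/(term_sum z) EG EH Hq /ev /= hornerZ hornerD hornerN hornerC.
  have -> : cexp q.[z] = cexp (q.[z] - q.[0]) * cexp q.[0] by rewrite -cexpD subrK.
  by rewrite mulrA [LHS]mulrC mulrA.
have [|c [k EP]] := PX.
  move=> t; rewrite -map_cons -Eus => /mapP[u uin ->]; split.
    by exists 1, u.1; rewrite scale1r.
  by rewrite /= !same.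
pose Q : {poly C} := \sum_(u <- us) b u *: 'X^(u.1).
have GQ z : term_sum z = Q.[z] * cexp (q - q.[0]%:P).[z].
  rewrite horner_sum mulr_suml /term_sum big_seq [RHS]big_seq; apply: eq_bigr => u uin.
  by rewrite /ev /= (same u uin) hornerZ -mulrA.
have Qnz z : z != 0 -> Q.[z] != 0.
  move=> z0; apply/eqP => Qz; have := HP z z0; rewrite GQ Qz mul0r EP => /(_ erefl) /eqP.
  rewrite hornerZ hornerXn mulf_eq0 expf_eq0 (negbTE z0) andbF orbF => /eqP c0.
  by move: P0; rewrite EP c0 scale0r eqxx.
have QX : exists k, Q = lead_coef Q *: 'X^k.
  have [ss Ess] := closed_field_poly_normal Q; exists (size ss).
  rewrite {1}Ess; congr (_ *: _).
  have {Ess} : all (fun s => s == 0) ss.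
    apply/allP => s sin; apply: contraPT Ess => /Qnz Qs Ess; move: Qs; rewrite Ess hornerZ.
    by rewrite (_ : (\prod_(z <- ss) _).[s] = 0) ?mulr0 ?eqxx //; apply/eqP; rewrite -/(root _ _) root_prod_XsubC.
  elim: ss => [|s ss ih] /=; first by rewrite big_nil expr0.
  by move=> /andP[/eqP -> /ih]; rewrite big_cons => ->; rewrite subr0 exprS.
have Qc u : u \in us -> Q`_u.1 != 0.
  move=> uin; rewrite coef_sum (bigD1_seq u) //= coefZ coefXn eqxx mulr1.
  rewrite big_seq_cond big1 ?addr0 ?b0 // => v /andP[vin vu].
  rewrite coefZ coefXn; case: eqP => [e|_]; rewrite ?mulr0 //.
  by move: vu; rewrite [v]surjective_pairing [X in _ != X]surjective_pairing -e !same // eqxx.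
have [K EQ] := QX.
have mK u : u \in us -> u.1 = K.
  move=> /Qc; have [//|uK] := eqVneq u.1 K; by rewrite EQ coefZ coefXn (negbTE uK) mulr0 eqxx.
move: uv; rewrite [u0]surjective_pairing [v0]surjective_pairing !same // !mK // eqxx //.
Qed.

End FewTerms.

(** * Rigidity of entire curves *)

Section Rigidity.
Context {R : realType} (n : nat).
Local Notation C := (CC R).
Variable a : 'I_(2 * n + 1) -> 'rV[C]_n.+1.
Hypothesis gp : forall S : {set 'I_(2 * n + 1)}, #|S| = n.+1 ->
  forall c : 'rV[C]_n.+1, (forall k, k \in S -> pairing (a k) c = 0) -> c = 0.
Hypothesis coord : forall (k : 'I_(2 * n + 1)) (l : 'I_n.+1), k = l :> nat ->
  forall c : 'rV[C]_n.+1, c ord0 l = 0 -> pairing (a k) c = 0.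

Definition supp (c : 'rV[C]_n.+1) : {set 'I_n.+1} := [set l | c ord0 l != 0].
Definition killers (c : 'rV[C]_n.+1) : {set 'I_(2 * n + 1)} :=
  [set k : 'I_(2 * n + 1) | (n < k)%N && (pairing (a k) c == 0)].

(** With the coordinate hyperplanes off the support, too many killers would
    give [n.+1] hyperplanes through one point. *)
Lemma card_killers c : c != 0 -> (#|killers c| < #|supp c|)%N.
Proof.
move=> c0; rewrite ltnNge; apply/negP => le.
have : (0 < #|[set T : {set 'I_(2 * n + 1)} | T \subset killers c & #|T| == #|supp c|]|)%N.
  by rewrite cards_draws bin_gt0.
case/card_gt0P => T.
rewrite inE => /andP[TK /eqP cT].
have le1 : (n.+1 <= 2 * n + 1)%N by lia.
pose W := widen_ord le1 @: (~: supp c).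
have dis : T :&: W = finset.set0.
  apply/finset.setP => k; rewrite !inE; apply/negP => /andP[/(fintype.subsetP TK)].
  rewrite inE => /andP[nk _] /imsetP[l _ E]; move: nk; rewrite E /=; have := ltn_ord l; lia.
have wi : injective (widen_ord le1) by move=> x y /(congr1 val) /= /val_inj.
have cS : #|T :|: W| = n.+1.
  by rewrite cardsU dis cards0 subn0 cT card_imset // cardsC card_ord.
suff cz : c = 0 by rewrite cz eqxx in c0.
apply: (gp cS) => k; rewrite !inE => /orP[/(fintype.subsetP TK)|/imsetP[l]].
  by rewrite inE => /andP[_ /eqP].
by rewrite !inE negbK => /eqP cl ->; apply: coord cl.
Qed.

Definition non_coord : {set 'I_(2 * n + 1)} := [set k : 'I_(2 * n + 1) | (n < k)%N].

Lemma card_non_coord : #|non_coord| = n.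
Proof.
have le1 : (n.+1 <= 2 * n + 1)%N by lia.
have -> : non_coord = ~: (widen_ord le1 @: [set: 'I_n.+1]%SET).
  apply/finset.setP => k; rewrite !inE; apply/idP/idP => [nk|].
    by apply/imsetP => -[l _ E]; move: nk; rewrite E /= ltnNge -ltnS ltn_ord.
  apply: contraR; rewrite -leqNgt -ltnS => kn; apply/imsetP; exists (Ordinal kn) => //.
  exact: val_inj.
have := cardsC (widen_ord le1 @: [set: 'I_n.+1]%SET).
rewrite card_imset; last by move=> x y /(congr1 val) /= /val_inj.
rewrite cardsT !card_ord => H; apply: (@addnI n.+1); apply: etrans H _; lia.
Qed.

Variables (th : 'I_n.+1 -> C -> C) (K : R) (l : 'I_n.+1).
Hypotheses (eth : forall i, entire (th i)) (th1 : forall z, th l z = 1)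
  (thK : forall z, sph th z <= K).
Hypothesis zero_free : forall i,
  (forall z, th i z = 0) \/ (forall z, z != 0 -> th i z != 0).

Let Gam k z : C := \sum_i a k ord0 i * th i z.

Hypothesis multiple : forall k : 'I_(2 * n + 1), (n < k)%N ->
  forall z, z != 0 -> Gam k z = 0 -> vanish n.+1 (Gam k) z.

Let types : exists (c : 'I_n.+1 -> C) (u : 'I_n.+1 -> nat * {poly C}),
  forall i, (u i).2.[0] = 0 /\ forall z, th i z = c i * ev (tm (u i)) z.
Proof.
have H i : exists p : C * (nat * {poly C}), p.2.2.[0] = 0 /\ forall z, th i z = p.1 * ev (tm p.2) z.
  have [z0|nz] := pselect (forall z, th i z = 0).
    by exists (0, (0%N, 0)); split=> [|z]; rewrite ?horner0 //= mul0r.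
  have zi : exists z, th i z != 0.
    by apply: contrapT => /forallNP H; apply: nz => z; apply/eqP/negPn/negP; exact: H.
  have zf : forall z, z != 0 -> th i z != 0 by have [] := zero_free i.
  have [k [h E]] := component_exp eth th1 thK zi zf.
  exists (cexp h.[0], (k, h - h.[0]%:P)); split=> [|z] /=.
    by rewrite hornerD hornerN hornerC subrr.
  rewrite E /ev /= hornerXn hornerD hornerN hornerC [RHS]mulrCA -cexpD.
  by rewrite [h.[0] + _]addrC subrK.
by have [p Hp] := choice H; exists (fun i => (p i).1), (fun i => (p i).2).
Qed.

(** If two components had different types, the coefficient vectors of these two
    types would have disjoint supports, and by [few_terms] every further
    hyperplane would kill one of the two vectors, against [card_killers]. *)
Lemma rigidity z : sph th z = 0.
Proof.
have [c [u Hu]] := types.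
have same i j : c i != 0 -> c j != 0 -> u i = u j.
  move=> ci cj; apply/eqP/negPn/negP => uij.
  pose cv v : 'rV[C]_n.+1 := \row_i (if u i == v then c i else 0).
  have cv0 i' : c i' != 0 -> cv (u i') != 0.
    by move=> ci'; apply/eqP => /rowP/(_ i'); rewrite !mxE eqxx; exact/eqP.
  have K1 := card_killers (cv0 _ ci); have K2 := card_killers (cv0 _ cj).
  have dis : supp (cv (u i)) :&: supp (cv (u j)) = finset.set0.
    apply/finset.setP => m; rewrite !inE !mxE; have [->|_] := eqVneq (u m) (u i); last by rewrite eqxx.
    by rewrite (negbTE uij) eqxx andbF.
  have J : (#|supp (cv (u i))| + #|supp (cv (u j))| <= n.+1)%N.
    rewrite -[X in (X <= _)%N](subn0) -(cards0 'I_n.+1) -dis -cardsU.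
    by rewrite -[X in (_ <= X)%N]card_ord max_card.
  suff : (non_coord \subset killers (cv (u i)) :|: killers (cv (u j))).
    by move=> /subset_leq_card; rewrite card_non_coord cardsU; lia.
  apply/fintype.subsetP => k; rewrite !inE => nk; rewrite nk /=.
  apply/negPn/negP; rewrite negb_or => /andP[ni nj].
  pose us0 := undup [seq u m | m : 'I_n.+1].
  pose b v := pairing (a k) (cv v).
  pose us := [seq v <- us0 | b v != 0].
  have uus : uniq us by rewrite filter_uniq ?undup_uniq.
  have us00 : all (fun u => u.2.[0] == 0) us.
    apply/allP => v; rewrite mem_filter mem_undup => /andP[_ /mapP[m _ ->]].
    by rewrite (Hu m).1.
  have b0 v : v \in us -> b v != 0 by rewrite mem_filter => /andP[].
  have EG : Gam k = term_sum us b.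
    apply/funext => w; rewrite /term_sum big_filter big_mkcond /=.
    have -> : \sum_(v <- us0) (if b v != 0 then b v * ev (tm v) w else 0) =
        \sum_(v <- us0) \sum_(m | u m == v) a k ord0 m * th m w.
      apply: eq_bigr => v _; have -> : b v = \sum_(m | u m == v) a k ord0 m * c m.
        rewrite /b /pairing [RHS]big_mkcond; apply: eq_bigr => m _; rewrite mxE.
        by case: eqP; rewrite ?mulr0.
      rewrite [RHS](_ : _ = (\sum_(m | u m == v) a k ord0 m * c m) * ev (tm v) w); last first.
        by rewrite mulr_suml; apply: eq_bigr => m /eqP <-; rewrite (Hu m).2 mulrA.
      by case: eqP => //= ->; rewrite mul0r.
    rewrite (exchange_big_dep xpredT) //=; apply: eq_bigr => m _.
    rewrite (eq_bigl (fun v => v == u m)) => [|v]; last by rewrite eq_sym.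
    by rewrite sum_pred1_seq ?undup_uniq // mem_undup map_f // mem_enum.
  have : (size us <= 1)%N.
    apply: (@few_terms R us uus us00 b b0) => w w0; rewrite -EG => Gw.
    have := multiple nk w0 Gw; apply: vanish_le.
    apply: (@leq_trans (size us0)); first by rewrite size_filter count_size.
    by apply: leq_trans (size_undup _) _; rewrite size_map -cardE card_ord.
  have iin m : b (u m) != 0 -> u m \in us.
    by move=> bm; rewrite mem_filter bm mem_undup map_f // mem_enum.
  have := iin _ ni; have := iin _ nj; case: (us) => [|v [|//]]; rewrite // !inE.
  by move=> /eqP ej /eqP ei _; move: uij; rewrite ei ej eqxx.
have cl : c l != 0.
  by apply: contraTneq isT => cl; have := (Hu l).2 0; rewrite th1 cl mul0r => /eqP; rewrite oner_eq0.
pose e := ev (tm (u l)).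
have E i : th i = fun w => c i * e w.
  apply/funext => w; rewrite (Hu i).2; have [->|ci] := eqVneq (c i) 0; first by rewrite !mul0r.
  by rewrite /e (same i l).
have D i : derive1 (th i) z = c i * derive1 e z.
  rewrite E; apply: (rdiff_derive1 (a := c i * derive1 e z)).
  have he := hol_rdiff (@ev_entire R (tm (u l)) z).
  by apply: rdiff_eq (rdiffM (rdiff_cst (c i) z) he) _ _; rewrite mul0r ?mulr0 ?add0r.
rewrite /sph /wr big1 ?mul0r // => i _; rewrite big1 // => j _.
rewrite !D (E i) (E j) [X in nm X](_ : _ = 0) ?nm0 ?expr0n //.
by move: (derive1 e z) => d; ring.
Qed.

End Rigidity.

(** * Limits of holomorphic functions along an ultrafilter *)

Section Square.
Context {R : realType}.
Local Notation C := (CC R).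

Definition square (c : C) (s : R) : set C :=
  [set z | `|re (z - c)| <= s /\ `|im (z - c)| <= s].

Lemma compact_square c s : compact (square c s).
Proof.
pose f (p : R * R) : C := c + mkc p.1 p.2.
have cf : continuous f.
  move=> p; apply/cvgCP => e e0.
  have h0 : 0 < e / 2 by rewrite divr_gt0.
  have h1 : \forall q \near p, `|p.1 - q.1| < e / 2.
    by have /cvgrPdist_lt/(_ _ h0) : fst q @[q --> p] --> p.1 by exact: cvg_fst.
  have h2 : \forall q \near p, `|p.2 - q.2| < e / 2.
    by have /cvgrPdist_lt/(_ _ h0) : snd q @[q --> p] --> p.2 by exact: cvg_snd.
  near=> q; have q1 : `|p.1 - q.1| < e / 2 by near: q.
  have q2 : `|p.2 - q.2| < e / 2 by near: q.
  apply: le_trans (nm_le_reim _) _.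
  have -> : re (f p - f q) = p.1 - q.1 by rewrite /f !reimE; ring.
  have -> : im (f p - f q) = p.2 - q.2 by rewrite /f !reimE; ring.
  lra.
pose A : set R := [set` `[- s, s]%R].
have -> : square c s = f @` (A `*` A).
  apply/seteqP; split=> z.
    move=> [h1 h2]; exists (re (z - c), im (z - c)).
      by split; rewrite /A /= in_itv /= -ler_norml.
    by rewrite /f /=; apply: eqC; rewrite !reimE; ring.
  move=> [[x y] [/=]]; rewrite /A /= !in_itv /= -!ler_norml => hx hy <-.
  have E : f (x, y) - c = mkc x y by rewrite /f addrC addKr.
  by rewrite /square /mkset E re_mk im_mk.
apply: continuous_compact; first by apply: continuous_subspaceT.
by apply: compact_setX; exact: segment_compact.
Unshelve. all: by end_near. Qed.

Lemma ball_square (c z : C) s : nm (z - c) <= s -> square c s z.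
Proof. by move=> h; split; apply: le_trans h; [exact: re_le_nm | exact: im_le_nm]. Qed.

Lemma square_ball (c z : C) s : square c s z -> nm (z - c) <= s + s.
Proof. by move=> [h1 h2]; apply: le_trans (nm_le_reim _) (lerD h1 h2). Qed.

End Square.

Section Ultralimit.
Context {R : realType} (J : Type) (U : set_system J) (UU : UltraFilter U).
Local Notation C := (CC R).
Implicit Types (x y : J -> C) (l m : C).

Let PU : ProperFilter U := @ultra_proper _ _ UU.
Let FU : Filter U := @filter_filter _ _ PU.

Definition ul x l := forall e : R, 0 < e -> U [set j | nm (x j - l) < e].

Lemma U_ex (A : set J) : U A -> exists j, A j.
Proof. exact: filter_ex. Qed.

Lemma U_or (A : set J) : U A \/ U (~` A).
Proof. exact: in_ultra_setVsetC. Qed.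

Lemma U_not (A : set J) : U A -> U (~` A) -> False.
Proof. by move=> a b; have [j []] := U_ex (filterI a b). Qed.

Lemma U_all (I : finType) (A : I -> set J) : (forall i, U (A i)) ->
  U [set j | forall i, A i j].
Proof. exact: filter_forall. Qed.

Lemma U_pigeon (I : finType) (A : I -> set J) : U [set j | exists i, A i j] ->
  exists i, U (A i).
Proof.
move=> H; apply: contrapT => /forallNP N.
have K : U [set j | forall i, ~ A i j].
  by apply: (@U_all _ (fun i => ~` A i)) => i; have [/N//|] := U_or (A i).
by have [j [[i Aij] /(_ i)]] := U_ex (filterI H K); apply.
Qed.

(** The image of the ultrafilter clusters in a compact square. *)
Lemma ul_ex x (B : R) : U [set j | nm (x j) <= B] -> exists l, ul x l.
Proof.
move=> H; have K := @compact_square R 0 B.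
have xK : U [set j | square 0 B (x j)].
  by apply: filterS H => j /= Bj; apply: ball_square; rewrite subr0.
have [p [_ clp]] := K (x @ U) (fmap_proper_filter x PU) xK.
exists p => e e0; have [//|N] := U_or [set j | nm (x j - p) < e].
have xU : (x @ U) (~` [set z | nm (z - p) < e]) by [].
have nb : nbhs p [set z | nm (z - p) < e] by apply/nbhsCP; exists e.
by have [z []] := clp _ _ xU nb.
Qed.

Lemma ul_eq x y l : U [set j | x j = y j] -> ul x l -> ul y l.
Proof. by move=> E H e /H K; apply: filterS (filterI E K) => j /= [->]. Qed.

Lemma ul_unique x l m : ul x l -> ul x m -> l = m.
Proof.
move=> h k; apply/eqP; rewrite -subr_eq0; apply/eqP; apply: nm_small => e e0.
have e2 : 0 < e / 2 by rewrite divr_gt0.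
have [j /= [h1 h2]] := U_ex (filterI (h _ e2) (k _ e2)).
have -> : l - m = - (x j - l) + (x j - m) by ring.
by apply: le_trans (nmD _ _) _; rewrite nmN; lra.
Qed.

Lemma ul_cst l : ul (fun=> l) l.
Proof. by move=> e e0; apply: filterS filterT => j _ /=; rewrite subrr nm0. Qed.

Lemma ul_ctn (f : C -> C) x l : {for l, continuous f} -> ul x l -> ul (f \o x) (f l).
Proof.
move=> /ctnCP cf h e e0; have e2 : 0 < e / 2 by rewrite divr_gt0.
have [d d0 Hd] := cf _ e2; apply: filterS (h _ d0) => j /= /Hd; lra.
Qed.

Lemma ulD x y l m : ul x l -> ul y m -> ul (fun j => x j + y j) (l + m).
Proof.
move=> h k e e0; have e2 : 0 < e / 2 by rewrite divr_gt0.
apply: filterS (filterI (h _ e2) (k _ e2)) => j /= [h1 h2].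
have -> : x j + y j - (l + m) = (x j - l) + (y j - m) by ring.
by apply: le_lt_trans (nmD _ _) _; lra.
Qed.

Lemma ul_bound x l : ul x l -> U [set j | nm (x j) <= nm l + 1].
Proof.
move=> h; apply: filterS (h _ ltr01) => j /= xj; rewrite -[x j](subrK l).
by apply: le_trans (nmD _ _) _; rewrite addrC lerD2l ltW.
Qed.

Lemma ulM x y l m : ul x l -> ul y m -> ul (fun j => x j * y j) (l * m).
Proof.
move=> h k e e0; pose d := e / (nm l + nm m + 2).
have s0 : 0 < nm l + nm m + 2 by rewrite ltr_wpDl // addr_ge0 ?nm_ge0.
have d0 : 0 < d by rewrite divr_gt0.
have Ed : d * (nm l + nm m + 2) = e by rewrite /d divfK // gt_eqF.
apply: filterS (filterI (filterI (h _ d0) (k _ d0)) (ul_bound k)) => j /= [[h1 h2] h3].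
have -> : x j * y j - l * m = (x j - l) * y j + l * (y j - m) by ring.
apply: le_lt_trans (nmD _ _) _; rewrite !nmM.
have n1 := nm_ge0 l; have n2 := nm_ge0 m; have n3 := nm_ge0 (y j).
have p1 : nm (x j - l) * nm (y j) <= d * (nm m + 1) by apply: ler_pM; rewrite ?nm_ge0 // ltW.
have p2 : nm l * nm (y j - m) <= nm l * d by rewrite ler_wpM2l // ltW.
by rewrite -Ed; lra.
Qed.

Lemma ulN x l : ul x l -> ul (fun j => - x j) (- l).
Proof. by move=> h e /h; apply: filterS => j /=; rewrite -nmN opprB opprK addrC. Qed.

Lemma ulB x y l m : ul x l -> ul y m -> ul (fun j => x j - y j) (l - m).
Proof. by move=> h /ulN k; exact: ulD. Qed.

Lemma ul_sum (I : finType) (x : I -> J -> C) (l : I -> C) :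
  (forall i, ul (x i) (l i)) -> ul (fun j => \sum_i x i j) (\sum_i l i).
Proof.
move=> h; rewrite -[index_enum I]/(index_enum I); elim: (index_enum I) => [|i s ih].
  by rewrite big_nil; apply: ul_eq (@ul_cst 0); apply: filterS filterT => j _; rewrite /= big_nil.
rewrite big_cons; apply: ul_eq (ulD (h i) ih).
by apply: filterS filterT => j _; rewrite /= big_cons.
Qed.

Lemma ulV x l : l != 0 -> ul x l -> ul (fun j => (x j)^-1) l^-1.
Proof. by move=> l0; apply: (@ul_ctn GRing.inv); exact: rdiff_ctn (rdiff_inv l0). Qed.

Lemma ul_nm x l : ul x l -> ul (fun j => rc (nm (x j))) (rc (nm l)).
Proof.
move=> h e /h; apply: filterS => j /=; rewrite -rcB nm_rc; apply: le_lt_trans.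
have := ler_nmB (x j) l; have := ler_nmB l (x j); rewrite nmBC => a b.
by rewrite ler_norml; apply/andP; split; lra.
Qed.

Lemma ul_le x l (B : R) : ul x l -> U [set j | nm (x j) <= B] -> nm l <= B.
Proof.
move=> h k; rewrite leNgt; apply/negP => lt.
have d0 : 0 < nm l - B by rewrite subr_gt0.
have [j /= [h1 h2]] := U_ex (filterI (h _ d0) k).
by have := ler_nmB l (x j); rewrite nmBC; lra.
Qed.

Lemma ul_lerc (x : J -> R) (l B : R) : ul (fun j => rc (x j)) (rc l) -> U [set j | x j <= B] -> l <= B.
Proof.
move=> h k; rewrite leNgt; apply/negP => lt.
have d0 : 0 < l - B by rewrite subr_gt0.
have [j /= [h1 h2]] := U_ex (filterI (h _ d0) k).
by move: h1; rewrite -rcB nm_rc ltr_norml => /andP[]; lra.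
Qed.

(** ** Locally bounded families *)

Definition ul_family (c : C) (r B : R) (f : J -> C -> C) (g : C -> C) :=
  [/\ 0 < r, 0 <= B,
    U [set j | hol_ball c r (f j) /\ forall z, nm (z - c) < r -> nm (f j z) <= B] &
    forall z, nm (z - c) < r -> ul (f^~ z) (g z)].

Lemma ul_family_sub c r B f g c' r' : ul_family c r B f g -> 0 < r' ->
  nm (c' - c) + r' <= r -> ul_family c' r' B f g.
Proof.
move=> [r0 B0 H Hg] r'0 le.
have sub z : nm (z - c') < r' -> nm (z - c) < r.
  move=> zr; have -> : z - c = (z - c') + (c' - c) by ring.
  by apply: le_lt_trans (nmD _ _) _; lra.
split=> //; last by move=> z /sub; exact: Hg.
by apply: filterS H => j [h b]; split=> [z /sub|z /sub]; [exact: h | exact: b].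
Qed.

Lemma derive_bound c r B (f : C -> C) p : 0 < r -> hol_ball c r f ->
  (forall z, nm (z - c) < r -> nm (f z) <= B) -> nm (p - c) <= r / 2 ->
  nm (derive1 f p) <= 4 * B / r.
Proof.
move=> r0 hf bf pr; have hp : hol_ball p (r / 2) f by apply: (hol_ballS hf); lra.
have r4 : 0 < r / 4 < r / 2 by apply/andP; split; lra.
have -> : 4 * B / r = B / (r / 4) by field; rewrite gt_eqF.
apply: (cauchy_estimate hp r4) => x xr; apply: bf.
have -> : x - c = (x - p) + (p - c) by ring.
by apply: le_lt_trans (nmD _ _) _; lra.
Qed.

(** The quadratic Taylor estimate is uniform in the family, so it passes to the
    limit. *)
Lemma ul_family_derive c r B f g : ul_family c r B f g ->
  hol_ball c r g /\
  ul_family c (r / 2) (4 * B / r) (fun j => derive1 (f j)) (derive1 g).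
Proof.
move=> [r0 B0 H Hg].
have r2 : 0 < r / 2 by rewrite divr_gt0.
have K p : nm (p - c) < r -> exists2 d, rdiff g p d 0 & ul (fun j => derive1 (f j) p) d.
  move=> pr; have [s s0 Es] : exists2 s, 0 < s & s + s = r - nm (p - c).
    by exists ((r - nm (p - c)) / 2); lra.
  have in_r z : nm (z - p) <= s -> nm (z - c) < r.
    move=> zs; have -> : z - c = (z - p) + (p - c) by ring.
    by apply: le_lt_trans (nmD _ _) _; lra.
  have s2 : 0 < s < s + s by apply/andP; split; lra.
  have hb j : hol_ball c r (f j) -> hol_ball p (s + s) (f j) by move=> h; apply: (hol_ballS h); lra.
  have [d ud] : exists d, ul (fun j => derive1 (f j) p) d.
    apply: (@ul_ex _ (B / s)); apply: filterS H => j /= [h b].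
    by apply: (cauchy_estimate (hb _ h) s2) => z zs; apply/b/in_r; rewrite zs.
  exists d => //.
  have T h : nm h <= s / 2 -> nm (g (p + h) - g p - d * h) <= 2 * B / s ^+ 2 * nm h ^+ 2.
    move=> hs; have ph : nm (p + h - c) < r by apply: in_r; rewrite addrAC subrr add0r; lra.
    apply: (ul_le (ulB (ulB (Hg _ ph) (Hg _ pr)) (ulM ud (@ul_cst h)))).
    apply: filterS H => j /= [hj b]; apply: (taylor1 (hb _ hj) hs s2) => z zs.
    by apply/b/in_r; rewrite zs.
  move=> e e0; pose A := 2 * B / s ^+ 2.
  have A0 : 0 <= A by rewrite /A divr_ge0 ?mulr_ge0 ?exprn_ge0 // ltW.
  exists (Num.min (s / 2) (e / (A + 1))); first by rewrite lt_min !divr_gt0 // ltr_wpDl.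
  move=> h; rewrite lt_min => /andP[h1 h2].
  rewrite mul0r subr0; apply: le_trans (T h (ltW h1)) _; rewrite -/A expr2 mulrA.
  rewrite ler_wpM2r ?nm_ge0 //; apply: (@le_trans _ _ ((A + 1) * (e / (A + 1)))).
    by apply: ler_pM; rewrite ?nm_ge0 // ?lerDl // ltW.
  by rewrite mulrC divfK // gt_eqF // ltr_wpDl.
split; first by move=> p /K[d D _]; apply/holP; exists d.
split=> //; first by rewrite divr_ge0 ?mulr_ge0 // ltW.
  apply: filterS H => j [h b]; split=> z zr; last by apply: derive_bound h b (ltW zr).
  by apply: (hol_ball_derive h); lra.
by move=> z zr; have [|d D u] := K z; [lra | rewrite (rdiff_derive1 D)].
Qed.

Lemma lipschitz_ball c r B (f : C -> C) z : 0 < r -> hol_ball c r f ->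
  (forall z, nm (z - c) < r -> nm (f z) <= B) -> nm (z - c) <= r / 2 ->
  nm (f z - f c) <= 4 * B / r * nm (z - c).
Proof.
move=> r0 hf bf zr; rewrite -[z in f z](subrK c) [_ + c]addrC; apply: mvi_line => t t01.
have ti : nm (c + rc t * (z - c) - c) <= r / 2 by exact: le_trans (segment_in _ _ t01) zr.
exists (derive1 f (c + rc t * (z - c)), 0) => /=.
  by apply: hol_rdiff; apply: hf; lra.
by rewrite mul0r addr0 nmM ler_wpM2r ?nm_ge0 //; exact: derive_bound hf bf ti.
Qed.

Lemma ul_unif c r B f g e : ul_family c r B f g -> 0 < e ->
  exists2 d, 0 < d & U [set j | forall z, nm (z - c) < d -> nm (f j z - g c) < e].
Proof.
move=> [r0 B0 H Hg] e0.
have cc : nm (c - c) < r by rewrite subrr nm0.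
pose L := 4 * B / r; have L0 : 0 <= L by rewrite divr_ge0 ?mulr_ge0 // ltW.
have e2 : 0 < e / 2 by rewrite divr_gt0.
exists (Num.min (r / 2) (e / 2 / (L + 1))); first by rewrite lt_min !divr_gt0 // ltr_wpDl.
apply: filterS (filterI H (Hg _ cc _ e2)) => j /= [[h b] u1] z.
rewrite lt_min => /andP[x1 x2].
have -> : f j z - g c = (f j z - f j c) + (f j c - g c) by ring.
apply: le_lt_trans (nmD _ _) _.
have := lipschitz_ball r0 h b (ltW x1); rewrite -/L => Lx.
have : L * nm (z - c) <= (L + 1) * (e / 2 / (L + 1)).
  by apply: ler_pM; rewrite ?nm_ge0 // ?lerDl // ltW.
rewrite [leRHS]mulrC divfK ?gt_eqF // ?ltr_wpDl //; lra.
Qed.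

Lemma ul_unif_derive q c r B f g e : ul_family c r B f g -> 0 < e ->
  exists2 d, 0 < d &
    U [set j | forall z, nm (z - c) < d -> nm (derive1n q (f j) z - derive1n q g c) < e].
Proof.
elim: q r B f g => [|q ih] r B f g H e0; first by have := ul_unif H e0.
have [_ H'] := ul_family_derive H; have [d d0 Hd] := ih _ _ _ _ H' e0.
exists d => //; apply: filterS Hd => j Hj z zd.
by rewrite !derive1Sn; exact: Hj.
Qed.

Lemma ul_moving_derive q c r B f g x : ul_family c r B f g -> ul x c ->
  ul (fun j => derive1n q (f j) (x j)) (derive1n q g c).
Proof.
move=> H ux e e0; have [d d0 Hd] := ul_unif_derive q H e0.
by apply: filterS (filterI Hd (ux _ d0)) => j /= [h /h].
Qed.

(** Hurwitz: otherwise the minimum principle gives points of a small circle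
    at which the functions are as small as at the centre, and the limit would
    vanish on that circle. *)
Lemma hurwitz c r B f g : ul_family c r B f g -> g c = 0 ->
  (exists2 z, nm (z - c) < r & g z != 0) ->
  forall e, 0 < e -> U [set j | exists2 z, nm (z - c) < e & f j z = 0].
Proof.
move=> H gc [z0 z0r gz0]; have [hg _] := ul_family_derive H; have [r0 B0 Hj Hg] := H.
have [N|[d /andP[d0 dr] dg]] := isolated_zero r0 hg; first by rewrite N ?eqxx // in gz0.
move=> e e0; have [//|N] := U_or [set j | exists2 z, nm (z - c) < e & f j z = 0]; exfalso.
pose s := Num.min e d / 2.
have s0 : 0 < s by rewrite divr_gt0 // lt_min e0.
have [se sd] : s < e /\ s < d.
  have a1 : Num.min e d <= e by rewrite ge_min lexx.
  have a2 : Num.min e d <= d by rewrite ge_min lexx orbT.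
  by rewrite /s; split; lra.
have cc : nm (c - c) < r by rewrite subrr nm0.
have M j : (forall z, nm (z - c) < e -> f j z != 0) -> hol_ball c r (f j) ->
    exists t, nm (t - c) = s /\ nm (f j t) <= 2 * nm (f j c).
  move=> nz hj; apply: contrapT => /forallNP T.
  have fc0 : 0 < nm (f j c) by rewrite nm_gt0 nz // subrr nm0.
  have hi : hol_ball c (Num.min e r) (fun z => (f j z)^-1).
    move=> z; rewrite lt_min => /andP[ze zr]; apply/holP; eexists.
    by apply: rdiff_eq (rdiffV (nz _ ze) (hol_rdiff (hj _ zr))) _ _; [reflexivity | ring].
  have sr : 0 < s < Num.min e r by rewrite s0 lt_min se (lt_le_trans sd).
  have := max_center hi sr (M := (2 * nm (f j c))^-1).
  have Ht t : nm (t - c) = s -> nm (f j t)^-1 <= (2 * nm (f j c))^-1.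
    move=> ts; have := T t => /not_andP[//|/negP]; rewrite -ltNge => lt.
    by rewrite nmV lef_pV2 ?posrE ?mulr_gt0 // ?ltW // (lt_trans _ lt) // mulr_gt0.
  move=> /(_ Ht); rewrite nmV lef_pV2 ?posrE ?mulr_gt0 //; lra.
pose t j := if pselect (exists t, nm (t - c) = s /\ nm (f j t) <= 2 * nm (f j c))
  is left h then projT1 (cid h) else c.
have tP : U [set j | nm (t j - c) = s /\ nm (f j (t j)) <= 2 * nm (f j c)].
  apply: filterS (filterI N Hj) => j /= [nz [hj _]]; rewrite /t; case: pselect => [h|nh].
    by case: cid.
  exfalso; apply: nh; apply: M hj => z ze; apply/eqP => fz; apply: nz; by exists z.
have [p up] : exists p, ul (fun j => t j - c) p.
  by apply: (@ul_ex _ s); apply: filterS tP => j /= [-> _].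
have ut : ul t (p + c).
  by apply: ul_eq (ulD up (@ul_cst c)); apply: filterS filterT => j _ /=; rewrite subrK.
have np : nm p = s.
  apply/eqP; rewrite -subr_eq0 -(rc_eq0 (R := R)) rcB subr_eq0; apply/eqP.
  apply: (ul_unique (ul_nm up)); apply: ul_eq (@ul_cst (rc s)).
  by apply: filterS tP => j /= [-> _].
have pd : nm (p + c - c) = s by rewrite addrK.
have fam : ul_family (p + c) (r - s) B f g by apply: (ul_family_sub H); rewrite ?pd; lra.
have := dg (p + c); rewrite pd s0 sd => /(_ isT) /eqP; apply.
apply: nm_small => e1 e10; apply: (ul_le (ul_moving_derive 0 fam ut)).
have e2 : 0 < e1 / 2 by rewrite divr_gt0.
have := Hg _ cc _ e2; rewrite gc => Hc.
by apply: filterS (filterI Hc tP) => j /= [h1 [_ h2]]; move: h1; rewrite subr0; lra.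
Qed.

End Ultralimit.

(** * Normalisation of curves with bounded spherical derivative *)

Section Rescaling.
Context {R : realType} (m : nat).
Local Notation C := (CC R).
Variables (phi : 'I_m -> C -> C) (c : C) (rho : R) (l : 'I_m).

Definition rescale (i : 'I_m) (z : C) : C := phi i (c + rc rho * z) / phi l (c + rc rho * z).

Lemma rdiff_affine z : rdiff (fun w : C => c + rc rho * w) z (rc rho) 0.
Proof.
by apply: rdiff_eq (rdiffD (rdiff_cst c z) (rdiffM (rdiff_cst (rc rho) z) (rdiff_id z))) _ _; ring.
Qed.

Variable z : C.
Let p := c + rc rho * z.
Hypotheses (hphi : forall i, hol (phi i) p) (l0 : phi l p != 0).

Lemma rdiff_rescale i : rdiff (rescale i) z
  (rc rho * (derive1 (phi i) p * phi l p - phi i p * derive1 (phi l) p) / phi l p ^+ 2) 0.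
Proof.
have h j : rdiff (fun w => phi j (c + rc rho * w)) z (derive1 (phi j) p * rc rho) 0.
  apply: rdiff_eq (rdiff_comp (rdiff_affine z) (hol_rdiff (@hphi j))) _ _; first reflexivity.
  exact: mulr0.
have l0' : (fun w => phi l (c + rc rho * w)) z != 0 := l0.
have M := rdiffM (h i) (rdiffV l0' (h l)).
apply: rdiff_eq M _ _; rewrite -/p.
  by move: (derive1 _ _) (derive1 _ _) => x y; field.
by move: (phi l p) (phi i p) => x y; ring.
Qed.

Lemma sph_rescale : sph rescale z = rho ^+ 2 * sph phi p.
Proof.
set N := nm (phi l p); have N0 : N != 0 by rewrite nm_eq0.
have s0 : sq phi p != 0.
  by rewrite gt_eqF // (lt_le_trans _ (nm_le_sq phi p l)) // exprn_gt0 // nm_gt0.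
have alg (x y x' y' w w' r : C) : w != 0 ->
    x / w * (r * (y' * w - y * w') / w ^+ 2) - y / w * (r * (x' * w - x * w') / w ^+ 2) =
    r * (x * y' - y * x') / w ^+ 2 by move=> w0; field.
have -> : sph rescale z = (rho ^+ 2 / N ^+ 4 * wr phi p) / (sq phi p / N ^+ 2) ^+ 2.
  rewrite /sph; congr (_ / _ ^+ 2).
    rewrite /wr mulr_sumr; apply: eq_bigr => i _; rewrite mulr_sumr; apply: eq_bigr => j _.
    rewrite !(rdiff_derive1 (rdiff_rescale _)) /rescale -/p.
    rewrite (alg _ _ _ _ _ _ _ l0).
    have norms (x w : C) : nm (rc rho * x / w ^+ 2) ^+ 2 = rho ^+ 2 / nm w ^+ 4 * nm x ^+ 2.
      have -> : nm (rc rho * x / w ^+ 2) = `|rho| * nm x * (nm w)^-1 ^+ 2.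
        by rewrite nmM nmM nm_rc nmV nmX exprVn.
      rewrite -[rho ^+ 2]real_normK ?num_real // -exprVn.
      by move: (nm w)^-1 (nm x) `|rho| => u v t; ring.
    exact: norms.
  rewrite /sq mulr_suml; apply: eq_bigr => i _.
  have norms (x w : C) : nm (x / w) ^+ 2 = nm x ^+ 2 / nm w ^+ 2.
    by rewrite nmM nmV expr_div_n.
  exact: norms.
by rewrite /sph; field; rewrite s0 N0.
Qed.

End Rescaling.

Section Normalisation.
Context {R : realType} (m : nat).
Local Notation C := (CC R).
Implicit Types (th : 'I_m -> C -> C) (k : R).

Lemma le_sum1 (I : finType) (F : I -> R) i : (forall i, 0 <= F i) -> F i <= \sum_j F j.
Proof. by move=> F0; rewrite (bigD1 i) //= lerDl sumr_ge0. Qed.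

Lemma wronskian_le th z k i j : 0 <= k -> sph th z <= k ^+ 2 -> 0 < sq th z ->
  nm (th i z * derive1 (th j) z - th j z * derive1 (th i) z) <= k * sq th z.
Proof.
move=> k0 H s0; have ks : 0 <= k * sq th z by rewrite mulr_ge0 // ltW.
rewrite -ler_sqr ?nnegrE ?nm_ge0 // [leRHS]exprMn.
apply: (@le_trans _ _ (wr th z)); last by rewrite -ler_pdivrMr ?exprn_gt0.
pose F i j : R := nm (th i z * derive1 (th j) z - th j z * derive1 (th i) z) ^+ 2.
have F0 i' j' : 0 <= F i' j' by exact: sqr_ge0.
apply: (@le_trans _ _ (\sum_j' F i j')); first exact: (@le_sum1 _ (F i) j (F0 i)).
by apply: (@le_sum1 _ (fun i' => \sum_j' F i' j') i) => i'; exact: sumr_ge0.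
Qed.

Lemma nmM_le_sq th z i j : nm (th i z) * nm (th j z) <= sq th z.
Proof.
have a := nm_le_sq th z i; have b := nm_le_sq th z j.
have := sqr_ge0 (nm (th i z) - nm (th j z)); rewrite sqrrB; lra.
Qed.

(** The numerator of the derivative is a combination of the wronskians that
    make up [wr]. *)
Lemma rdiff_ratio th z k l : (forall i, hol (th i) z) -> 0 <= k -> sph th z <= k ^+ 2 ->
  0 < sq th z -> exists2 b : C, rdiff (fun w => rc (nm (th l w) ^+ 2 / sq th w)) z b (cj b) &
  nm b <= m%:R * k.
Proof.
move=> hth k0 H s0; have s0' : rc (sq th z) != 0 :> C by rewrite rc_eq0 gt_eqF.
pose P := \sum_i derive1 (th i) z * cj (th i z).
pose S : C := rc (sq th z).
exists ((derive1 (th l) z * cj (th l z) * S - th l z * cj (th l z) * P) / S ^+ 2).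
  have -> : (fun w => rc (nm (th l w) ^+ 2 / sq th w)) =
      (fun w => th l w * cj (th l w) * (rc (sq th w))^-1).
    by apply/funext => w; rewrite rcM rcV -mulcj.
  have h := hol_rdiff (hth l).
  apply: rdiff_eq (rdiffM (rdiffM h (rdiff_cj h)) (rdiffV s0' (rdiff_sq hth))) _ _.
    by rewrite cj0 -/P -/S; field.
  rewrite !(cjM, cjB, cjK) -exprVn exprVn /S -/P.
  have -> : cj ((rc (sq th z) ^+ 2)^-1) = (rc (sq th z) ^+ 2)^-1 by rewrite -rcX -rcV cj_rc.
  by rewrite cj_rc; field.
have alg (x x' d u u' d' : C) : d * x' * (u * u') - x * x' * (d' * u') = x' * u' * (u * d - x * d').
  by ring.
have -> : derive1 (th l) z * cj (th l z) * S - th l z * cj (th l z) * P =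
    \sum_i cj (th l z) * cj (th i z) * (th i z * derive1 (th l) z - th l z * derive1 (th i) z).
  rewrite /S sqC /P [X in X - _]mulr_sumr [X in _ - X]mulr_sumr -sumrB.
  apply: eq_bigr => i _; exact: alg.
rewrite nmM nmV nmX nm_rc gtr0_norm // ler_pdivrMr ?exprn_gt0 //.
apply: le_trans (nm_sum _ _ _) _.
apply: (@le_trans _ _ (\sum_(i < m) sq th z * (k * sq th z))).
  apply: ler_sum => i _; rewrite nmM nmM !nm_cj; apply: ler_pM; rewrite ?mulr_ge0 ?nm_ge0 //.
    exact: nmM_le_sq.
  exact: wronskian_le.
rewrite sumr_const card_ord -mulr_natl; move: (sq th z) => s.
by rewrite le_eqVlt; apply/orP; left; apply/eqP; ring.
Qed.

Lemma ratio_lipschitz th p v k l (d : R) : 0 <= k ->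
  (forall w, nm (w - p) < d -> [/\ forall i, hol (th i) w, sph th w <= k ^+ 2 & 0 < sq th w]) ->
  nm v < d ->
  `|nm (th l (p + v)) ^+ 2 / sq th (p + v) - nm (th l p) ^+ 2 / sq th p| <= 2 * m%:R * k * nm v.
Proof.
move=> k0 H vd; rewrite -nm_rc rcB.
apply: (@mvi_line _ (fun w => rc (nm (th l w) ^+ 2 / sq th w))) => t t01.
have [|h1 h2 h3] := H (p + rc t * v).
  rewrite addrAC subrr add0r nmM nm_rc; case/andP: t01 => t0 t1.
  by rewrite ger0_norm //; apply: le_lt_trans vd; rewrite ler_piMl ?nm_ge0.
have [b Db Hb] := rdiff_ratio l h1 k0 h2 h3.
exists (b, cj b) => //=; apply: le_trans (nmD _ _) _; rewrite !nmM !nm_cj.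
have := ler_wpM2r (nm_ge0 v) Hb; lra.
Qed.

End Normalisation.

Section Chain.
Context {R : realType} (n : nat).
Local Notation C := (CC R).
Implicit Types (th : 'I_n.+1 -> C -> C) (k : R).
Definition dimR : R := n.+1%:R.
Local Notation m := dimR.
Let m1 : 1 <= m. Proof. by rewrite /dimR ler1n. Qed.

Lemma max_component th (z : C) : exists l, forall i, nm (th i z) <= nm (th l z).
Proof.
have [l _ H] := @arg_maxP _ R _ ord0 xpredT (fun i => nm (th i z)) isT.
by exists l => i; exact: H.
Qed.

Definition chain_radius k : R := (4 * m ^+ 2 * (k + 1))^-1.

Lemma chain_radius_gt0 k : 0 <= k -> 0 < chain_radius k.
Proof.
by move=> k0; rewrite invr_gt0 !mulr_gt0 ?exprn_gt0 ?ltr_wpDl // (lt_le_trans ltr01).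
Qed.

Lemma chain_radius_le1 k : 0 <= k -> chain_radius k <= 1.
Proof.
move=> k0; rewrite invf_le1; last by rewrite -invr_gt0 chain_radius_gt0.
have mm : 1 <= m ^+ 2 by rewrite exprn_ege1.
by have := mulr_ge0 (le_trans ler01 mm) k0; lra.
Qed.

(** The squared modulus of the maximal component is at least the fraction [1/m]
    of [sq] at [p]; by [ratio_lipschitz] the fraction cannot drop below half of
    this within [chain_radius]. *)
Lemma dominant th p l k : 0 <= k ->
  (forall w, nm (w - p) < chain_radius k ->
     [/\ forall i, hol (th i) w, sph th w <= k ^+ 2 & 0 < sq th w]) ->
  (forall i, nm (th i p) <= nm (th l p)) ->
  forall z, nm (z - p) < chain_radius k -> sq th z <= 2 * m * nm (th l z) ^+ 2.
Proof.
move=> k0 H Hl z zp.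
have m0 : 0 < m := lt_le_trans ltr01 m1.
have d0 := chain_radius_gt0 k0.
have [_ _ sp] := H p (eq_ind_r (fun x => x < _) d0 (etrans (congr1 nm (subrr p)) nm0)).
have [_ _ sz] := H z zp.
have L := ratio_lipschitz l k0 H zp; rewrite [p + _]addrC subrK in L.
have : m^-1 <= nm (th l p) ^+ 2 / sq th p.
  rewrite ler_pdivlMr // mulrC ler_pdivrMr //.
  apply: (@le_trans _ _ (\sum_(i < n.+1) nm (th l p) ^+ 2)).
    by apply: ler_sum => i _; rewrite lerXn2r ?nnegrE ?nm_ge0.
  by rewrite sumr_const card_ord -mulr_natr mulrC.
have : 2 * m * k * nm (z - p) <= m^-1 / 2.
  apply: (@le_trans _ _ (2 * m * k * chain_radius k)).
    by apply: ler_wpM2l (ltW zp); rewrite !mulr_ge0 // ltW.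
  have -> : m^-1 / 2 = 2 * m * (k + 1) * chain_radius k.
    by rewrite /chain_radius; field; rewrite !gt_eqF // ltr_wpDl.
  apply: ler_wpM2r; first exact: ltW.
  by apply: ler_wpM2l; [rewrite mulr_ge0 // ltW | rewrite lerDl].
move=> a b; have : m^-1 / 2 <= nm (th l z) ^+ 2 / sq th z.
  move: L a b; rewrite -/m ler_norml => /andP[]; move: (_ / sq th z) (_ / sq th p) => x y.
  by move: (2 * m * k * _) (m^-1) => u v; lra.
rewrite ler_pdivlMr // => /(ler_wpM2l (ltW m0)).
have alg (x y : R) : y != 0 -> y * (y^-1 / 2 * x) = x / 2 by move=> y0; field.
by rewrite alg ?gt_eqF // -mulrA; move: (sq th z) (m * _) => x y; lra.
Qed.

Definition chain_step (B : R) : R := 2 * m * expR (expR 2 * (ln B + ln (2 * m))).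

Lemma chain_step_ge1 B : 1 <= B -> 1 <= chain_step B.
Proof.
move=> B1; have m1' := m1; have e1 : 1 <= expR (expR 2 * (ln B + ln (2 * m))).
  apply: le_trans (expR_ge1Dx _); rewrite lerDl mulr_ge0 ?expR_ge0 // addr_ge0 ?ln_ge0 //.
  lra.
have m20 : 0 <= 2 * m by lra.
have := ler_wpM2l m20 e1; rewrite mulr1 /chain_step; apply: le_trans; lra.
Qed.

(** Harnack's inequality for the logarithm of the dominant component, which is
    bounded below since some component is constant. *)
Lemma chain1 th p k B l1 : 0 <= k -> 1 <= B ->
  (forall w, nm (w - p) < chain_radius k ->
     [/\ forall i, hol (th i) w, sph th w <= k ^+ 2 & th l1 w = 1]) ->
  (forall i, nm (th i p) <= B) ->
  forall z i, nm (z - p) <= chain_radius k / 4 -> nm (th i z) <= chain_step B.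
Proof.
move=> k0 B1 H HB z i zp; have [l Hl] := max_component th p.
have d0 := chain_radius_gt0 k0; have m1' := m1.
have sq1 w : nm (w - p) < chain_radius k -> 1 <= sq th w.
  by move=> /H[_ _ e]; have := nm_le_sq th w l1; rewrite e nm1 expr1n.
have H' w : nm (w - p) < chain_radius k ->
    [/\ forall i, hol (th i) w, sph th w <= k ^+ 2 & 0 < sq th w].
  by move=> wp; have [h1 h2 _] := H w wp; split=> //; have := sq1 w wp; lra.
have Hd := dominant k0 H' Hl.
have low w : nm (w - p) < chain_radius k -> (2 * m)^-1 <= nm (th l w).
  move=> wp; have a := le_trans (sq1 w wp) (Hd w wp); rewrite leNgt; apply/negP => lt.
  have x0 := nm_ge0 (th l w); set x := nm _ in a lt x0.
  have lt1 : x * (2 * m) < 1 by rewrite -ltr_pdivlMr ?div1r //; lra.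
  have x1 : 1 <= x.
    apply: le_trans a _; rewrite (_ : 2 * m * x ^+ 2 = x * (x * (2 * m))); last by ring.
    by rewrite ler_piMr // ltW.
  have := ler_wpM2l x0 m1'; nra.
have hl : hol_ball p (chain_radius k) (th l) by move=> w /H[h _ _]; exact: h.
have nz w : nm (w - p) < chain_radius k -> th l w != 0.
  by move=> /low a; rewrite -nm_gt0; apply: lt_le_trans a; rewrite invr_gt0; lra.
have [h hh Eh] := log_ball d0 hl nz.
pose L := ln (2 * m).
have reh w : nm (w - p) < chain_radius k -> re (h w) = ln (nm (th l w)).
  by move=> wp; rewrite (Eh w wp) nm_cexp expRK.
have hc : hol_ball p (chain_radius k) (fun w => h w + rc L).
  move=> w wp; apply/holP; eexists.
  by apply: rdiff_eq (rdiffD (hol_rdiff (hh w wp)) (rdiff_cst (rc L) w)) _ _; [reflexivity | ring].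
have zd : nm (z - p) < chain_radius k by lra.
have pd : nm (p - p) < chain_radius k by rewrite subrr nm0.
have hpos w : nm (w - p) < chain_radius k -> 0 <= re (h w + rc L).
  move=> wp; rewrite reD re_rc (reh w wp) -[L]opprK subr_ge0 -lnV ?posrE; last lra.
  by rewrite ler_ln ?posrE ?invr_gt0 ?nm_gt0 ?nz ?low //; lra.
have := harnack hc hpos zp d0; rewrite !reD !re_rc (reh _ zd) (reh _ pd) => Hk.
have : ln (nm (th l p)) <= ln B by rewrite ler_ln ?posrE ?nm_gt0 ?nz //; lra.
have L0 : 0 <= L by rewrite ln_ge0 //; lra.
move=> lB; have Nz : nm (th l z) <= expR (expR 2 * (ln B + L)).
  rewrite -[nm _]lnK ?posrE ?nm_gt0 ?nz // ler_expR.
  apply: (@le_trans _ _ (ln (nm (th l z)) + L)); first by rewrite lerDl.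
  by apply: le_trans Hk _; rewrite ler_pM2l ?expR_gt0 // lerD2r.
have N0 := nm_ge0 (th l z).
have m20 : 0 <= 2 * m by lra.
have Y0 : 0 <= 2 * m * nm (th l z) by rewrite mulr_ge0.
apply: (@le_trans _ _ (2 * m * nm (th l z))); last by apply: ler_wpM2l Nz.
rewrite -ler_sqr ?nnegrE ?nm_ge0 //.
apply: le_trans (nm_le_sq th z i) (le_trans (Hd z zd) _).
have alg (x y : R) : 1 <= x -> x * y ^+ 2 <= (x * y) ^+ 2.
  by move=> x1; rewrite exprMn ler_wpM2r ?sqr_ge0 // expr2 ler_peMl // (le_trans ler01).
by apply: alg; lra.
Qed.

(** Steps of a quarter of [chain_radius] lead from the origin to every point of
    the disc; their number depends on [k] and [T] only. *)
Lemma chain k T : 0 <= k -> 0 <= T -> exists B : R, forall th l1 S, T + 1 <= S ->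
  (forall i, hol_ball 0 S (th i)) -> (forall z, nm z < S -> th l1 z = 1) ->
  (forall z, nm z < S -> sph th z <= k ^+ 2) -> (forall i, nm (th i 0) <= 1) ->
  forall z i, nm z <= T -> nm (th i z) <= B.
Proof.
move=> k0 T0; pose d := chain_radius k / 4.
have d0 : 0 < d by rewrite divr_gt0 // chain_radius_gt0.
pose Bq q := iter q chain_step 1.
have Bq1 q : 1 <= Bq q by elim: q => [|q ih] /=; [| exact: chain_step_ge1].
have [q Hq] : exists q : nat, T <= q%:R * d.
  exists (Num.bound (T / d)); rewrite -ler_pdivrMr //; apply/ltW.
  exact: archi_boundP (divr_ge0 T0 (ltW d0)).
exists (Bq q) => th l1 S TS hth th1 thK th0 z i zT.
suff K q' z' : nm z' <= q'%:R * d -> nm z' <= T -> forall i, nm (th i z') <= Bq q'.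
  exact: (K q z (le_trans zT Hq) zT i).
elim: q' z' => [|q' ih] z' z'q z'T i'.
  by move: z'q; rewrite mul0r => z'0; have /eqP -> : z' == 0; rewrite ?th0 // -nm_eq0 eq_le z'0 nm_ge0.
pose s : R := q'%:R / q'.+1%:R.
have q0 : 0 < q'.+1%:R :> R by rewrite ltr0n.
have s01 : 0 <= s <= 1 by rewrite /s divr_ge0 //= ler_pdivrMr // mul1r ler_nat.
have [s0 s1] := andP s01.
pose p := rc s * z'.
have pN : nm p = s * nm z' by rewrite nmM nm_rc ger0_norm.
have pT : nm p <= T by rewrite pN; apply: le_trans z'T; rewrite ler_piMl ?nm_ge0.
have pq : nm p <= q'%:R * d.
  rewrite pN; apply: (@le_trans _ _ (s * (q'.+1%:R * d))); first by rewrite ler_wpM2l.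
  by rewrite mulrA /s divfK // gt_eqF.
have zp : nm (z' - p) <= d.
  have -> : z' - p = rc (1 - s) * z' by rewrite rcB /p -[rc 1]/(1 : C); ring.
  rewrite nmM nm_rc ger0_norm; last by rewrite subr_ge0.
  have -> : 1 - s = (q'.+1%:R)^-1.
    have e : q'.+1%:R = q'%:R + 1 :> R by rewrite -natr1.
    by rewrite /s e; field; rewrite -e gt_eqF.
  by rewrite mulrC ler_pdivrMr // mulrC.
apply: (@chain1 th p k (Bq q') l1 k0 (Bq1 q') _ _ z' i' zp); last by move=> j; exact: ih.
move=> w wp.
have wS : nm w < S.
  have -> : w = (w - p) + p by rewrite subrK.
  by apply: le_lt_trans (nmD _ _) _; have := chain_radius_le1 k0; lra.
by split; [move=> j; apply: hth; rewrite subr0 | exact: thK | exact: th1].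
Qed.

End Chain.

(** * Rescaling limits *)

Section Zalcman.
Context {R : realType} (n : nat).
Local Notation C := (CC R).
Implicit Types (phi : 'I_n.+1 -> C -> C).

Lemma sph_bounded phi l0 z0 r0 rho : (forall i, hol_ball z0 r0 (phi i)) ->
  (forall z, nm (z - z0) < r0 -> phi l0 z = 1) -> rho < r0 ->
  exists2 W : R, 0 <= W & forall z, nm (z - z0) <= rho -> sph phi z <= W.
Proof.
move=> hphi p1 rr.
have /choice[M HM] : forall i, exists M, 0 <= M /\ forall z, nm (z - z0) <= rho -> nm (phi i z) <= M.
  by move=> i; have [B ? ?] := hol_ball_bounded (hphi i) rr; exists B.
have /choice[N HN] : forall i, exists M, 0 <= M /\ forall z, nm (z - z0) <= rho -> nm (derive1 (phi i) z) <= M.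
  by move=> i; have [B ? ?] := hol_ball_bounded (hol_ball_derive (hphi i)) rr; exists B.
exists (\sum_i \sum_j (M i * N j + M j * N i) ^+ 2).
  by apply: sumr_ge0 => i _; apply: sumr_ge0 => j _; exact: sqr_ge0.
move=> z zr; have zr0 : nm (z - z0) < r0 := le_lt_trans zr rr.
have s1 : 1 <= sq phi z by have := nm_le_sq phi z l0; rewrite p1 // nm1 expr1n.
apply: (@le_trans _ _ (wr phi z)).
  have s1' : 1 <= sq phi z ^+ 2 by rewrite exprn_ege1.
  have s0' : 0 < sq phi z ^+ 2 := lt_le_trans ltr01 s1'.
  by rewrite /sph ler_pdivrMr // ler_peMr // wr_ge0.
have bd i j : nm (phi i z * derive1 (phi j) z) <= M i * N j.
  by rewrite nmM; apply: ler_pM; rewrite ?nm_ge0 ?(HM i).2 ?(HN j).2.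
apply: ler_sum => i _; apply: ler_sum => j _.
rewrite lerXn2r ?nnegrE ?nm_ge0 //.
  by rewrite addr_ge0 // mulr_ge0 ?(HM _).1 ?(HN _).1.
by apply: le_trans (nmB _ _) _; apply: lerD; exact: bd.
Qed.

(** The weight makes a nearly maximal point stay away from the boundary, on the
    scale of its spherical derivative. *)
Lemma zalcman_point phi l0 z0 r0 rho w (A : R) : 0 < rho < r0 ->
  (forall i, hol_ball z0 r0 (phi i)) -> (forall z, nm (z - z0) < r0 -> phi l0 z = 1) ->
  nm (w - z0) <= rho / 2 -> 0 < A -> A < sph phi w ->
  exists z1, [/\ nm (z1 - z0) < rho, 0 < sph phi z1,
    (rho / 2) ^+ 2 * A / 2 <= (rho - nm (z1 - z0)) ^+ 2 * sph phi z1 &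
    forall z, nm (z - z1) <= (rho - nm (z1 - z0)) / 2 ->
      nm (z - z0) < rho /\ sph phi z <= 8 * sph phi z1].
Proof.
move=> /andP[rho0 rr] hphi p1 wr A0 Aw.
have [W W0 HW] := sph_bounded hphi p1 rr.
pose E z : R := (rho - nm (z - z0)) ^+ 2 * sph phi z.
pose V : set R := [set E z | z in [set z | nm (z - z0) < rho]].
have wV : V (E w) by exists w => //=; lra.
have hV : has_sup V.
  split; first by exists (E w).
  exists (rho ^+ 2 * W) => _ [z /= zr <-].
  apply: ler_pM; rewrite ?sqr_ge0 ?sph_ge0 //; last by apply: HW; exact: ltW.
  by rewrite lerXn2r ?nnegrE; have := nm_ge0 (z - z0); lra.
have Ew : (rho / 2) ^+ 2 * A <= E w.
  apply: ler_pM; [exact: sqr_ge0 | exact: ltW | | exact: ltW].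
  by rewrite lerXn2r ?nnegrE; have := nm_ge0 (w - z0); lra.
have q0 : 0 < (rho / 2) ^+ 2 * A by rewrite mulr_gt0 // exprn_gt0 // divr_gt0.
have sE z : nm (z - z0) < rho -> E z <= sup V.
  by move=> zr; apply: (sup_upper_bound hV); exists z.
have s0 : 0 < sup V by have := sE w; lra.
have s2 : 0 < sup V / 2 by rewrite divr_gt0.
have [_ [z1 /= z1r <-] Hz1] := sup_adherent s2 hV.
have Ez1 : sup V <= 2 * E z1 by lra.
have sEw := sE w; have {}sEw : E w <= sup V by apply: sEw; lra.
have sp : 0 < sph phi z1.
  rewrite lt_neqAle sph_ge0 andbT; apply/eqP => e; move: Ez1; rewrite /E -e mulr0 mulr0; lra.
exists z1; split=> //; first by rewrite -/(E z1); lra.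
set d := rho - _; have d0 : 0 < d by rewrite subr_gt0.
move=> z zd.
have zN : nm (z - z0) <= rho - d / 2.
  have -> : z - z0 = (z - z1) + (z1 - z0) by ring.
  by apply: le_trans (nmD _ _) _; rewrite /d in zd *; lra.
have zr : nm (z - z0) < rho by lra.
split=> //; have Ez := sE z zr; rewrite /E in Ez Ez1; rewrite -/d in Ez1.
have : (d / 2) ^+ 2 * sph phi z <= (rho - nm (z - z0)) ^+ 2 * sph phi z.
  by rewrite ler_wpM2r ?sph_ge0 // lerXn2r ?nnegrE; lra.
move=> K; have {}K : d ^+ 2 * sph phi z <= d ^+ 2 * (8 * sph phi z1).
  have -> : d ^+ 2 * sph phi z = 4 * ((d / 2) ^+ 2 * sph phi z) by field.
  have -> : d ^+ 2 * (8 * sph phi z1) = 4 * (2 * (d ^+ 2 * sph phi z1)) by ring.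
  by rewrite ler_wpM2l //; lra.
by move: K; rewrite ler_pM2l // exprn_gt0.
Qed.

End Zalcman.

Section HigherDerivatives.
Context {R : realType}.
Local Notation C := (CC R).
Implicit Types (f g : C -> C) (z : C).

Lemma derive1n_near q f g z (d : R) : 0 < d -> (forall w, nm (w - z) < d -> f w = g w) ->
  derive1n q f z = derive1n q g z.
Proof.
elim: q z d => [|q ih] z d d0 H; first by rewrite !derive1n0 H // subrr nm0.
rewrite !derive1nS !derive1E; apply: near_eq_derive.
apply/nbhsCP; exists (d / 2); first by rewrite divr_gt0.
move=> w wz; apply: (ih w (d / 2)); first by rewrite divr_gt0.
move=> x xw; apply: H; have -> : x - z = (x - w) + (w - z) by ring.
by apply: le_lt_trans (nmD _ _) _; lra.
Qed.

Lemma derive1n_zero q z : derive1n q (fun=> 0 : C) z = 0.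
Proof.
suff -> : derive1n q (fun=> 0 : C) = fun=> 0 by [].
elim: q => [|q ih]; first by rewrite derive1n0.
by rewrite derive1nS ih; apply/funext => w; exact: rdiff_derive1 (rdiff_cst 0 w).
Qed.

Lemma hol_ball_derive1n q g p r : hol_ball p r g -> hol_ball p r (derive1n q g).
Proof.
move=> hg; elim: q => [|q ih]; first by rewrite derive1n0.
by rewrite derive1nS; exact: hol_ball_derive ih.
Qed.

Lemma derive1n_affine g p r c (rho : R) q z : hol_ball p r g -> nm (c + rc rho * z - p) < r ->
  derive1n q (fun w => g (c + rc rho * w)) z = rc rho ^+ q * derive1n q g (c + rc rho * z).
Proof.
move=> hg; elim: q z => [|q ih] z zr; first by rewrite !derive1n0 expr0 mul1r.
pose H w := rc rho ^+ q * derive1n q g (c + rc rho * w).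
have hq : hol (derive1n q g) (c + rc rho * z) := hol_ball_derive1n hg zr.
have D := rdiffM (rdiff_cst (rc rho ^+ q) z) (rdiff_comp (rdiff_affine c rho z) (hol_rdiff hq)).
rewrite !derive1nS; apply: rdiff_derive1.
pose d := (r - nm (c + rc rho * z - p)) / (`|rho| + 1).
have rp : 0 < `|rho| + 1 by rewrite ltr_wpDl.
have d0 : 0 < d by rewrite divr_gt0 // subr_gt0.
have N : rdiff (derive1n q (fun w => g (c + rc rho * w))) z
    (0 * (derive1n q g \o (fun w => c + rc rho * w)) z +
     rc rho ^+ q * (derive1 (derive1n q g) (c + rc rho * z) * rc rho))
    (0 * (derive1n q g \o (fun w => c + rc rho * w)) z +
     rc rho ^+ q * (derive1 (derive1n q g) (c + rc rho * z) * 0)).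
  apply: (rdiff_near d0 _ D) => h hd; apply/esym/ih.
  have -> : c + rc rho * (z + h) - p = (c + rc rho * z - p) + rc rho * h by ring.
  apply: le_lt_trans (nmD _ _) _; rewrite nmM nm_rc.
  have : `|rho| * nm h <= (`|rho| + 1) * nm h by rewrite ler_wpM2r ?nm_ge0 // lerDl.
  have : (`|rho| + 1) * nm h < (`|rho| + 1) * d by rewrite ltr_pM2l.
  have -> : (`|rho| + 1) * d = r - nm (c + rc rho * z - p) by rewrite /d mulrC divfK ?gt_eqF.
  lra.
apply: rdiff_eq N _ _; last by rewrite !mul0r mulr0 mulr0 addr0.
rewrite mul0r add0r exprS; move: (derive1 _ _) (rc rho ^+ q) => x y.
by ring.
Qed.

End HigherDerivatives.

Section UltralimitSph.
Context {R : realType} (J : Type) (U : set_system J) (UU : UltraFilter U) (m : nat).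
Local Notation C := (CC R).

Lemma ul_sph (th : J -> 'I_m -> C -> C) (g : 'I_m -> C -> C) (x : J -> C) p :
  (forall i, ul U (fun j => th j i (x j)) (g i p)) ->
  (forall i, ul U (fun j => derive1 (th j i) (x j)) (derive1 (g i) p)) ->
  sq g p != 0 -> ul U (fun j => rc (sph (th j) (x j))) (rc (sph g p)).
Proof.
move=> h0 h1 s0.
have sqrn (y : J -> C) (l : C) : ul U y l -> ul U (fun j => rc (nm (y j) ^+ 2)) (rc (nm l ^+ 2)).
  move=> /(ul_nm UU) k; have := ulM UU k k; rewrite -rcM -expr2.
  by apply: (ul_eq UU); apply: filterS filterT => j _; rewrite /= -rcM -expr2.
have hsq : ul U (fun j => rc (sq (th j) (x j))) (rc (sq g p)).
  rewrite /sq rc_sum; have := ul_sum UU (fun i => sqrn _ _ (h0 i)); apply: (ul_eq UU).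
  by apply: filterS filterT => j _; rewrite /= rc_sum.
have hW i k := ulB UU (ulM UU (h0 i) (h1 k)) (ulM UU (h0 k) (h1 i)).
pose W (h : 'I_m -> C -> C) i k w := h i w * derive1 (h k) w - h k w * derive1 (h i) w.
have E (h : 'I_m -> C -> C) w : rc (wr h w) = \sum_i \sum_k rc (nm (W h i k w) ^+ 2).
  by rewrite /wr rc_sum; apply: eq_bigr => i _; rewrite rc_sum.
have K i k : ul U (fun j => rc (nm (W (th j) i k (x j)) ^+ 2)) (rc (nm (W g i k p) ^+ 2)).
  exact: sqrn (hW i k).
have K1 i : ul U (fun j => \sum_k rc (nm (W (th j) i k (x j)) ^+ 2)) (\sum_k rc (nm (W g i k p) ^+ 2)).
  exact: (ul_sum UU (K i)).
have hwr : ul U (fun j => rc (wr (th j) (x j))) (rc (wr g p)).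
  have -> : (fun j => rc (wr (th j) (x j))) =
      (fun j => \sum_i \sum_k rc (nm (W (th j) i k (x j)) ^+ 2)).
    by apply/funext => j; exact: E.
  rewrite (E g p); exact: (ul_sum UU K1).
have s0' : rc (sq g p) ^+ 2 != 0 :> C by rewrite expf_neq0 // rc_eq0.
have hsq2 := ulM UU hsq hsq; rewrite -expr2 in hsq2.
have H := ulM UU hwr (ulV UU s0' hsq2).
have -> : rc (sph g p) = rc (wr g p) * (rc (sq g p) ^+ 2)^-1 by rewrite /sph rcM rcV rcX.
move: H; apply: (ul_eq UU); apply: filterS filterT => j _.
by rewrite /= /sph rcM rcV rcX expr2.
Qed.

End UltralimitSph.

Section LocalBound.
Context {R : realType} (n : nat).
Local Notation C := (CC R).
Variable a : 'I_(2 * n + 1) -> 'rV[C]_n.+1.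
Hypothesis gp : forall S : {set 'I_(2 * n + 1)}, #|S| = n.+1 ->
  forall c : 'rV[C]_n.+1, (forall k, k \in S -> pairing (a k) c = 0) -> c = 0.
Hypothesis coord : forall (k : 'I_(2 * n + 1)) (l : 'I_n.+1), k = l :> nat ->
  forall c : 'rV[C]_n.+1, c ord0 l = 0 -> pairing (a k) c = 0.
Variables (Phi : set ('I_n.+1 -> C -> C)) (z0 : C) (r0 M : R) (l0 : 'I_n.+1).
Hypothesis r00 : 0 < r0.
Hypothesis hPhi : forall phi, Phi phi -> forall i, hol_ball z0 r0 (phi i).
Hypothesis Phi1 : forall phi, Phi phi -> forall z, nm (z - z0) < r0 -> phi l0 z = 1.
Hypothesis Phi0 : forall phi, Phi phi -> forall i,
  (forall z, nm (z - z0) < r0 -> phi i z = 0) \/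
  (forall z, 0 < nm (z - z0) < r0 -> phi i z != 0).
Hypothesis PhiM : forall phi, Phi phi -> forall l (k : 'I_(2 * n + 1)) q z,
  (n < k)%N -> (1 <= q <= n)%N -> nm (z - z0) < r0 -> phi l z != 0 ->
  \sum_i a k ord0 i * phi i z = 0 ->
  nm (derive1n q (fun w => (\sum_i a k ord0 i * phi i w) / phi l w) z) <= M.

Let rho0 : R := r0 / 2.

Section Sequence.
Variables (ph : nat -> 'I_n.+1 -> C -> C) (zz : nat -> C).
Let s j : R := sph (ph j) (zz j).
Let d j : R := rho0 - nm (zz j - z0).
Let rho j : R := (Num.sqrt (s j))^-1.
Hypothesis Phij : forall j, Phi (ph j).
Hypothesis zzr : forall j, nm (zz j - z0) < rho0.
Hypothesis s0 : forall j, 0 < s j.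
Hypothesis ds : forall j, (rho0 / 2) ^+ 2 * j.+1%:R / 2 <= d j ^+ 2 * s j.
Hypothesis near : forall j z, nm (z - zz j) <= d j / 2 ->
  nm (z - z0) < rho0 /\ sph (ph j) z <= 8 * s j.

Let rho_gt0 j : 0 < rho j. Proof. by rewrite invr_gt0 sqrtr_gt0. Qed.
Let rho_s j : rho j ^+ 2 * s j = 1.
Proof. by rewrite exprVn sqr_sqrtr ?(ltW (s0 j)) // mulVf // gt_eqF. Qed.
Let rr : rho0 < r0. Proof. by rewrite /rho0 ltr_pdivrMr //; move: r00; lra. Qed.
Let rho00 : 0 < rho0. Proof. by rewrite /rho0 divr_gt0. Qed.
Let d0 j : 0 < d j. Proof. by rewrite subr_gt0. Qed.

Variable U : set_system nat.
Hypotheses (UU : UltraFilter U) (Uoo : \oo `<=` U).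
Let FU : Filter U := @filter_filter _ _ (@ultra_proper _ _ UU).

Let big (X : R) : 0 <= X -> U [set j | X * rho j <= d j / 2].
Proof.
move=> X0; pose Y := X ^+ 2 * 8 / (rho0 / 2) ^+ 2.
have q0 : 0 < (rho0 / 2) ^+ 2 by rewrite exprn_gt0 // divr_gt0.
have Y0 : 0 <= Y by rewrite /Y divr_ge0 ?mulr_ge0 ?sqr_ge0 // ltW.
apply: Uoo; exists (Num.bound Y) => // j /= jN.
have jY : Y <= j.+1%:R.
  by apply/ltW/(lt_le_trans (archi_boundP Y0)); rewrite ler_nat ltnW.
have : X ^+ 2 * 8 <= j.+1%:R * (rho0 / 2) ^+ 2 by rewrite -ler_pdivrMr.
move=> K1; have K2 := ds j.
have K3 : X ^+ 2 * 4 <= d j ^+ 2 * s j.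
  by apply: le_trans K2; rewrite [X in X / 2]mulrC; move: K1; move: (_ * (rho0 / 2) ^+ 2) (X ^+ 2) => t u; lra.
have dj0 : 0 <= d j / 2 by rewrite divr_ge0 // ltW.
rewrite -ler_sqr ?nnegrE // ?mulr_ge0 // ?(ltW (rho_gt0 j)) //.
rewrite [leLHS]exprMn [leRHS](_ : _ = d j ^+ 2 / 4); last by field.
rewrite ler_pdivlMr // mulrAC.
apply: le_trans (ler_wpM2r (sqr_ge0 (rho j)) K3) _.
by rewrite -mulrA [s j * _]mulrC rho_s mulr1.
Qed.

Let rho_small e : 0 < e -> U [set j | rho j <= e].
Proof.
move=> e0; have X0 : 0 <= rho0 / (2 * e) by rewrite divr_ge0 ?mulr_ge0 // ltW.
apply: filterS (big X0) => j /= H.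
have : rho0 / (2 * e) * rho j <= rho0 / 2.
  by apply: le_trans H _; rewrite ler_wpM2r // /d gerBl nm_ge0.
have -> : rho0 / (2 * e) * rho j = rho0 / 2 * (rho j / e) by field; rewrite gt_eqF.
by rewrite ger_pMr ?divr_gt0 // ler_pdivrMr // mul1r.
Qed.

Let centres : exists (c ze : nat -> C) (xi : C), [/\ forall j, zz j = c j + rc (rho j) * ze j,
  ul U ze xi & forall T, U [set j | forall z, nm z <= T -> z != 0 -> c j + rc (rho j) * z != z0]].
Proof.
pose tau j := (z0 - zz j) / rc (rho j).
have rn j : rc (rho j) != 0 :> C by rewrite rc_eq0 gt_eqF.
have tauE j : rc (rho j) * tau j = z0 - zz j by rewrite mulrC /tau divfK.
have [[T HT]|N] := pselect (exists T, U [set j | nm (tau j) <= T]).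
  have [x ux] := ul_ex UU HT.
  exists (fun=> z0), (fun j => - tau j), (- x); split.
  - by move=> j; rewrite mulrN tauE; ring.
  - exact: ulN.
  move=> T'; apply: filterS filterT => j _ z _ z_0; rewrite addrC -subr_eq0 addrK mulf_neq0 //.
exists zz, (fun=> 0), 0; split.
- by move=> j; rewrite mulr0 addr0.
- exact: (ul_cst UU).
move=> T; have [H|H] := U_or UU [set j | nm (tau j) <= T]; first by case: N; exists T.
apply: filterS H => j /= Hj z zT _; apply/eqP => e; apply: Hj.
have -> : tau j = z by apply: (mulfI (rn j)); rewrite tauE -e; ring.
exact: zT.
Qed.

(** The rescaled curves converge along [U] to an entire curve that [rigidity]
    makes constant, although its spherical derivative at [xi] is 1. *)
Lemma sequence_absurd : False.
Proof.
have [c [ze [xi [Ec uze c0]]]] := centres.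
have n00 (T : R) : 0 <= T -> nm (0 : C) <= T by move=> T0; rewrite nm0.
pose pt j z := c j + rc (rho j) * z.
have dom T : 0 <= T -> U [set j | forall z, nm z <= T ->
    nm (pt j z - z0) < rho0 /\ sph (ph j) (pt j z) <= 8 * s j].
  move=> T0; have X0 : 0 <= T + (nm xi + 1) by rewrite !addr_ge0 ?nm_ge0.
  apply: filterS (filterI (big X0) (ul_bound UU uze)) => j /= [H1 H2] z zT; apply: near.
  have -> : pt j z - zz j = rc (rho j) * (z - ze j) by rewrite /pt Ec; ring.
  apply: le_trans H1; rewrite nmM nm_rc gtr0_norm // mulrC; apply: ler_wpM2r; first exact: ltW.
  by apply: le_trans (nmB _ _) _; rewrite lerD.
have [l1 Hl1] : exists l1, U [set j | forall i, nm (ph j i (c j)) <= nm (ph j l1 (c j))].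
  apply: (U_pigeon UU); apply: filterS filterT => j _.
  by have [l Hl] := max_component (ph j) (c j); exists l.
pose thj j := rescale (ph j) (c j) (rho j) l1.
have pt0 j : pt j 0 = c j by rewrite /pt mulr0 addr0.
have good T : 0 <= T -> U [set j | (forall i, nm (thj j i 0) <= 1) /\
    forall z, nm z <= T -> [/\ nm (pt j z - z0) < rho0, ph j l1 (pt j z) != 0,
      forall i, hol (thj j i) z, thj j l1 z = 1 & sph (thj j) z = rho j ^+ 2 * sph (ph j) (pt j z)]].
  move=> T0; apply: filterS (filterI (filterI (dom T T0) Hl1) (c0 T)) => j /= [[H1 H2] H3].
  have nz z : nm z <= T -> ph j l1 (pt j z) != 0.
    have c1 : ph j l1 (pt j 0) != 0.
      have [h _] := H1 0 (n00 T T0).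
      rewrite pt0 in h *; rewrite -nm_gt0; apply: lt_le_trans (H2 l0).
      by rewrite (Phi1 (Phij j)) ?nm1 //; exact: lt_trans h rr.
    move=> zT; have [->//|zn] := eqVneq z 0.
    have [hz _] := H1 z zT; have hz' := lt_trans hz rr.
    have [N|N] := Phi0 (Phij j) l1.
      have [h _] := H1 0 (n00 T T0).
      by rewrite N ?eqxx in c1 => //; exact: lt_trans h rr.
    by apply: N; rewrite hz' andbT nm_gt0 subr_eq0 H3.
  split=> [i|z zT].
    have := nz 0 (n00 T T0); rewrite pt0 => c1.
    rewrite /thj /rescale -/(pt j 0) pt0 nmM nmV ler_pdivrMr ?nm_gt0 // mul1r.
    exact: H2.
  have [h1 h2] := H1 z zT; have hp i : hol (ph j i) (pt j z).
    by apply: (hPhi (Phij j)); exact: lt_trans h1 rr.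
  have hz := nz z zT; have D i := rdiff_rescale hp hz i.
  split; [exact: h1 | exact: hz | | | exact: (sph_rescale hp hz)].
    by move=> i; apply/holP; eexists; exact: (D i).
  exact: divff hz.
have sphb T : 0 <= T -> U [set j | forall z, nm z <= T -> sph (thj j) z <= 3 ^+ 2].
  move=> T0; apply: filterS (filterI (good T T0) (dom T T0)) => j /= [[_ H1] H2] z zT.
  have [_ _ _ _ ->] := H1 z zT; have [_ H] := H2 z zT.
  apply: le_trans (ler_wpM2l (sqr_ge0 _) H) _; rewrite mulrCA rho_s; lra.
have bnd T : 0 <= T -> exists B, U [set j | forall z i, nm z <= T -> nm (thj j i z) <= B].
  move=> T0; have k30 : 0 <= 3 :> R by [].
  have [B HB] := chain n k30 T0; exists B.
  have T1 : 0 <= T + 1 by rewrite addr_ge0.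
  apply: filterS (filterI (good _ T1) (sphb _ T1)) => j /= [[h0 H1] H2] z i zT.
  apply: (HB (thj j) l1 (T + 1)) => //.
  - by move=> i' w; rewrite subr0 => /ltW /H1[].
  - by move=> w /ltW /H1[].
  - by move=> w /ltW /H2.
have /choice[th1 Hth1] : forall p : 'I_n.+1 * C, exists x, ul U (fun j => thj j p.1 p.2) x.
  move=> [i z]; have [B HB] := bnd _ (nm_ge0 z).
  have K : U [set j | nm (thj j i z) <= B] by apply: filterS HB => j /= H; exact: H.
  by have [x ux] := ul_ex UU K; exists x; exact: ux.
pose th i z := th1 (i, z).
have Hth i z : ul U (fun j => thj j i z) (th i z) by exact: (Hth1 (i, z)).
have fam i p r : 0 < r -> exists B, ul_family U p r B (fun j => thj j i) (th i).
  move=> r1; have T0 : 0 <= nm p + r by rewrite addr_ge0 ?nm_ge0 // ltW.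
  have [B HB] := bnd _ T0; exists `|B|; split=> //.
  have zT z : nm (z - p) < r -> nm z <= nm p + r.
    by move=> zr; rewrite -[z](subrK p); apply: le_trans (nmD _ _) _; rewrite addrC lerD2l ltW.
  apply: filterS (filterI HB (good _ T0)) => j /= [H1 [_ H2]]; split=> z zr.
    by have [] := H2 z (zT z zr).
  by apply: le_trans (H1 z i (zT z zr)) (ler_norm _).
have eth i : entire (th i).
  move=> z; have [B /(ul_family_derive UU)[h _]] := fam i z 1 ltr01.
  by apply: h; rewrite subrr nm0.
have thl1 z : th l1 z = 1.
  apply: (ul_unique UU (Hth l1 z)); have := ul_cst UU (1 : C); apply: (ul_eq UU).
  by apply: filterS (good _ (nm_ge0 z)) => j /= [_ /(_ z (lexx _))[]].
have sq0 z : sq th z != 0.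
  by rewrite gt_eqF //; have := nm_le_sq th z l1; rewrite thl1 nm1 expr1n; lra.
have usph (x : nat -> C) p : ul U x p -> ul U (fun j => rc (sph (thj j) (x j))) (rc (sph th p)).
  move=> ux; apply: (ul_sph UU) (sq0 p) => i; have [B HB] := fam i p 1 ltr01.
    exact: (ul_moving_derive UU 0 HB ux).
  exact: (ul_moving_derive UU 1 HB ux).
have thK z : sph th z <= 3 ^+ 2.
  apply: (ul_lerc UU (usph _ _ (ul_cst UU z))).
  by apply: filterS (sphb _ (nm_ge0 z)) => j /= /(_ z (lexx _)).
have zero_free i : (forall z, th i z = 0) \/ (forall z, z != 0 -> th i z != 0).
  have [N|N] := pselect (forall z, th i z = 0); [by left | right=> z z_0].
  apply/eqP => tz; apply: N => w; apply/eqP/negPn/negP => tw.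
  have r1 : 0 < nm (w - z) + 1 by rewrite ltr_wpDl ?nm_ge0.
  have [B HB] := fam i z _ r1.
  have ex : exists2 w', nm (w' - z) < nm (w - z) + 1 & th i w' != 0.
    by exists w; [rewrite ltrDl | exact: tw].
  have nz0 : 0 < nm z by rewrite nm_gt0.
  have H := hurwitz UU HB tz ex nz0.
  have T0 : 0 <= nm z + nm z + nm w by rewrite !addr_ge0 ?nm_ge0.
  suff : ul U (fun j => thj j i w) 0.
    by move=> u0; move: tw; rewrite (ul_unique UU (Hth i w) u0) eqxx.
  have := ul_cst UU (0 : C); apply: (ul_eq UU).
  apply: filterS (filterI (filterI H (good _ T0)) (c0 (nm z + nm z + nm w))) => j /= [[[y yz ty] [_ G]] c0j].
  have yT : nm y <= nm z + nm z + nm w.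
    by rewrite -[y](subrK z); apply: le_trans (nmD _ _) _; have := nm_ge0 w; lra.
  have y0 : y != 0 by apply: contraTneq yz => ->; rewrite sub0r nmN ltxx.
  have [g1 g2 _ _ _] := G y yT.
  have py : ph j i (pt j y) = 0.
    move/eqP: ty; rewrite /thj /rescale mulf_eq0 invr_eq0 => /orP[/eqP //|].
    by rewrite (negbTE g2).
  have wT : nm w <= nm z + nm z + nm w by rewrite lerDr addr_ge0 ?nm_ge0.
  have [g1w _ _ _ _] := G w wT.
  have [N|N] := Phi0 (Phij j) i.
    by rewrite /thj /rescale -/(pt j w) N ?mul0r //; exact: lt_trans g1w rr.
  have := N (pt j y); rewrite py eqxx => /(_ _)/negP[] //.
  by rewrite nm_gt0 subr_eq0 c0j //= (lt_trans g1 rr).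
have multiple (k : 'I_(2 * n + 1)) : (n < k)%N -> forall z, z != 0 ->
    \sum_i a k ord0 i * th i z = 0 -> vanish n.+1 (fun w => \sum_i a k ord0 i * th i w) z.
  move=> nk z z_0 Gz; pose G w := \sum_i a k ord0 i * th i w.
  have [N|N] := pselect (exists2 w, nm (w - z) < 1 & G w != 0); last first.
    move=> q _; apply: etrans (derive1n_zero q z); apply: (derive1n_near q ltr01) => w wz.
    by apply/eqP/negPn/negP => gw; apply: N; exists w; [exact: wz | exact: gw].
  pose Gj j w := \sum_i a k ord0 i * thj j i w.
  have [B HB] : exists B, ul_family U z 1 B Gj G.
    have /choice[b Hb] := fun i => fam i z 1 ltr01.
    exists (\sum_i nm (a k ord0 i) * b i); split=> //.
    - by apply: sumr_ge0 => i _; rewrite mulr_ge0 ?nm_ge0 //; have [] := Hb i.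
    - have HU i : U [set j | hol_ball z 1 (thj j i) /\ forall w, nm (w - z) < 1 -> nm (thj j i w) <= b i].
        by have [_ _ h _] := Hb i; exact: h.
      apply: filterS (U_all UU HU) => j H.
      split=> w wz.
        apply/holP; eexists; apply: rdiff_eq (rdiff_sum _ (fun i => rdiffM (rdiff_cst (a k ord0 i) w)
          (hol_rdiff ((H i).1 w wz)))) _ _; first reflexivity.
        by apply: big1 => i _; rewrite mul0r mulr0 addr0.
      apply: le_trans (nm_sum _ _ _) _; apply: ler_sum => i _.
      by rewrite nmM ler_wpM2l ?nm_ge0 // (H i).2.
    move=> w wz; apply: (ul_sum UU) => i; exact: (ulM UU (ul_cst UU _) (Hth i w)).
  move=> [|q] qn; first exact: Gz.
  apply: nm_small => e e0; have e2 : 0 < e / 2 by rewrite divr_gt0.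
  have [dl dl0 Hd] := ul_unif_derive UU q.+1 HB e2.
  have H := hurwitz UU HB Gz N dl0.
  have T0 : 0 <= nm z + dl by rewrite addr_ge0 ?nm_ge0 // ltW.
  have e3 : 0 < Num.min 1 (e / 2 / (`|M| + 1)) by rewrite lt_min ltr01 !divr_gt0 // ltr_wpDl.
  have [j /= [[[H1 [y yz gy]] [_ H3]] H4]] :=
    U_ex UU (filterI (filterI (filterI Hd H) (good _ T0)) (rho_small e3)).
  have yT : nm y <= nm z + dl.
    by rewrite -[y](subrK z); apply: le_trans (nmD _ _) _; lra.
  have [g1 g2 _ _ _] := H3 y yT.
  pose g w := (\sum_i a k ord0 i * ph j i w) / ph j l1 w.
  have GjE : Gj j = fun w => g (c j + rc (rho j) * w).
    apply/funext => w; rewrite /Gj /g mulr_suml; apply: eq_bigr => i _.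
    by rewrite /thj /rescale mulrA.
  have g1' := lt_trans g1 rr.
  have gz : \sum_i a k ord0 i * ph j i (pt j y) = 0.
    move/eqP: gy; rewrite GjE /g mulf_eq0 invr_eq0 => /orP[/eqP //|].
    by rewrite (negbTE g2).
  have gM := PhiM (Phij j) nk (qn : (1 <= q.+1 <= n)%N) g1' g2 gz.
  have [r1 r10 hg] : exists2 r1, 0 < r1 & hol_ball (pt j y) r1 g.
    have cl := hol_ctn (@hPhi _ (Phij j) l1 _ g1').
    have n0 : 0 < nm (ph j l1 (pt j y)) by rewrite nm_gt0.
    have [|d1 d10 Hd1] := (ctnCP _ _).1 cl (nm (ph j l1 (pt j y)) / 2).
      by rewrite divr_gt0.
    exists (Num.min d1 (r0 - nm (pt j y - z0))); first by rewrite lt_min d10 subr_gt0.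
    move=> w; rewrite lt_min => /andP[w1 w2].
    have wr : nm (w - z0) < r0.
      have -> : w - z0 = (w - pt j y) + (pt j y - z0) by ring.
      by apply: le_lt_trans (nmD _ _) _; lra.
    have w0 : ph j l1 w != 0.
      by rewrite -nm_gt0; have := ler_nmB (ph j l1 (pt j y)) (ph j l1 w); have := Hd1 w w1; rewrite nmBC; lra.
    have hw i := hol_rdiff (@hPhi _ (Phij j) i _ wr).
    have D1 := rdiff_sum _ (fun i => rdiffM (rdiff_cst (a k ord0 i) w) (hw i)).
    have D := rdiffM (D1 (index_enum 'I_n.+1)) (rdiffV w0 (hw l1)).
    apply/holP; eexists; apply: rdiff_eq D _ _; first reflexivity.
    rewrite big1 => [|i _]; last by rewrite mul0r mulr0 addr0.
    by rewrite oppr0 !mul0r mulr0 addr0.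
  have ppr : nm (c j + rc (rho j) * y - pt j y) < r1 by rewrite subrr nm0.
  have : nm (derive1n q.+1 (Gj j) y - derive1n q.+1 G z) < e / 2 := H1 y yz.
  rewrite GjE (@derive1n_affine R g (pt j y) r1 (c j) (rho j) q.+1 y hg ppr).
  move: gM; rewrite -/g -/(pt j y); set D := derive1n _ g _; set D' := derive1n _ G z => gM H5.
  have H6 : nm (rc (rho j) ^+ q.+1 * D) <= e / 2.
    rewrite nmM nmX nm_rc gtr0_norm //; move: H4; rewrite le_min => /andP[r11 r12].
    have p0 : 0 <= rho j := ltW (rho_gt0 j).
    apply: (@le_trans _ _ (rho j * (`|M| + 1))); last by rewrite -ler_pdivlMr // ltr_wpDl.
    apply: ler_pM; rewrite ?nm_ge0 ?exprn_ge0 //.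
      by rewrite exprS ler_piMr // exprn_ile1.
    by apply: le_trans gM _; apply: le_trans (ler_norm _) _; rewrite lerDl.
  have tri (x y' : C) : nm x <= e / 2 -> nm (x - y') < e / 2 -> nm y' <= e.
    move=> x1 x2; have -> : y' = x - (x - y') by ring.
    by apply: le_trans (nmB _ _) _; lra.
  have HD : nm D' <= e := tri _ _ H6 H5.
  exact: HD.
have S0 := rigidity gp coord eth thl1 thK zero_free multiple xi.
have U1 : ul U (fun j => rc (sph (thj j) (ze j))) (rc 1).
  have T0 : 0 <= nm xi + 1 by rewrite addr_ge0 ?nm_ge0.
  have := ul_cst UU (rc 1 : C); apply: (ul_eq UU).
  apply: filterS (filterI (good _ T0) (ul_bound UU uze)) => j /= [[_ H1] H2].
  by have [_ _ _ _ ->] := H1 _ H2; rewrite /pt -Ec rho_s.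
have /eqP := ul_unique UU (usph _ _ uze) U1.
by rewrite S0 -subr_eq0 -rcB rc_eq0 sub0r oppr_eq0 oner_eq0.
Qed.

End Sequence.

Theorem local_bound : exists A : R, forall phi, Phi phi ->
  forall z, nm (z - z0) <= r0 / 4 -> sph phi z <= A.
Proof.
apply: contrapT => /forallNP N.
have rr : 0 < rho0 < r0.
  by have r00' := r00; rewrite /rho0; apply/andP; split; lra.
have [rho1 rho2] := andP rr.
have /choice[p Hp] : forall j : nat, exists p : ('I_n.+1 -> C -> C) * C, [/\ Phi p.1,
    nm (p.2 - z0) < rho0, 0 < sph p.1 p.2,
    (rho0 / 2) ^+ 2 * j.+1%:R / 2 <= (rho0 - nm (p.2 - z0)) ^+ 2 * sph p.1 p.2 &
    forall z, nm (z - p.2) <= (rho0 - nm (p.2 - z0)) / 2 ->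
      nm (z - z0) < rho0 /\ sph p.1 z <= 8 * sph p.1 p.2].
  move=> j; have /existsNP[phi /not_implyP[Pphi /existsNP[w /not_implyP[wr /negP]]]] := N j.+1%:R.
  rewrite -ltNge => lt; have wr' : nm (w - z0) <= rho0 / 2 by rewrite /rho0; lra.
  have j0 : 0 < j.+1%:R :> R by rewrite ltr0n.
  have [z1 [h1 h2 h3 h4]] := zalcman_point rr (hPhi Pphi) (Phi1 Pphi) wr' j0 lt.
  by exists (phi, z1).
have [U [UU Uoo]] := @ultraFilterLemma nat \oo _.
by apply: (@sequence_absurd (fun j => (p j).1) (fun j => (p j).2) _ _ _ _ _ U UU Uoo) => j;
  have [] := Hp j.
Qed.

End LocalBound.

Local Open Scope quotient_scope.
(** * Affine coordinates and the topology of projective space *)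

Section Coordinates.
Context {R : realType} (n : nat).
Local Notation C := (CC R).
Local Notation PP := (PP R n).
Implicit Types (w v : nzvec R n) (p : PP) (l i : 'I_n.+1).

Definition hc p i : C := set_val (repr p) ord0 i.
Definition co l i p : C := hc p i / hc p l.

Lemma to_PP_repr p : to_PP (repr p) = p. Proof. exact: reprK. Qed.

Lemma hc_to_PP w : exists2 c : C, c != 0 & forall i, hc (to_PP w) i = c * set_val w ord0 i.
Proof.
have /to_PP_eqP[c c0 e] : to_PP w = to_PP (repr (to_PP w)) by rewrite to_PP_repr.
by exists c => // i; rewrite /hc e mxE.
Qed.

Lemma co_to_PP l i w : co l i (to_PP w) = set_val w ord0 i / set_val w ord0 l.
Proof.
have [c c0 H] := hc_to_PP w; rewrite /co !H.
by rewrite -mulf_div divff // mul1r.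
Qed.

Lemma coord_openP l p : coord_open l p <-> hc p l != 0.
Proof.
split=> [[w /= wl <-]|h]; last by exists (repr p); [exact: h | exact: to_PP_repr].
by have [c c0 ->] := hc_to_PP w; rewrite mulf_neq0.
Qed.

Lemma coord_hyperplaneP l p : coord_hyperplane l p <-> hc p l = 0.
Proof.
split=> [[w /= wl <-]|h]; last by exists (repr p); [exact: h | exact: to_PP_repr].
by have [c c0 ->] := hc_to_PP w; rewrite wl mulr0.
Qed.

Lemma hyperplaneP a p : hyperplane a p <-> \sum_i a ord0 i * hc p i = 0.
Proof.
split=> [[w /= wl <-]|h]; last by exists (repr p); [exact: h | exact: to_PP_repr].
have [c c0 H] := hc_to_PP w.
transitivity (c * pairing a (set_val w)); last by rewrite wl mulr0.
by rewrite /pairing mulr_sumr; apply: eq_bigr => i _; rewrite H mulrCA.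
Qed.

Lemma co_ll l p : coord_open l p -> co l l p = 1.
Proof. by move=> /coord_openP h; rewrite /co divff. Qed.

Lemma co_change l l' i p : coord_open l' p -> co l i p = co l' i p * co l l' p.
Proof. by move=> /coord_openP h; rewrite /co mulrA divfK. Qed.

Lemma co_neq0 l l' p : coord_open l p -> coord_open l' p -> co l l' p != 0.
Proof. by move=> /coord_openP h /coord_openP h'; rewrite mulf_neq0 ?invr_eq0. Qed.

Lemma chartE l j p : chart l p ord0 j = co l (lift l j) p.
Proof. by rewrite /chart mxE. Qed.

Lemma nzvec_mk (v : 'rV[C]_n.+1) : v != 0 -> exists w : nzvec R n, set_val w = v.
Proof. by move=> v0; exists (SigSub (mem_set (v0 : [set w : 'rV[C]_n.+1 | w != 0] v))). Qed.

Lemma hc_neq0 p : exists i, hc p i != 0.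
Proof.
apply: contrapT => /forallNP H; have := set_valP (repr p) => /= /eqP; apply.
by apply/rowP => i; rewrite mxE; apply/eqP/negPn/negP; exact: H.
Qed.

Lemma vec_PP (y : 'I_n.+1 -> C) : (exists l, y l != 0) ->
  exists w : nzvec R n, forall i, set_val w ord0 i = y i.
Proof.
move=> [l yl]; have [|w E] := @nzvec_mk (\row_i y i).
  by apply/eqP => /rowP/(_ l); rewrite !mxE; exact/eqP.
by exists w => i; rewrite E mxE.
Qed.

Lemma co_vec l p : coord_open l p ->
  exists2 w : nzvec R n, (forall i, set_val w ord0 i = co l i p) & p = to_PP w.
Proof.
move=> pl; have [|w E] := vec_PP (y := fun i => co l i p); first by exists l; rewrite co_ll // oner_eq0.
exists w => //; rewrite -[LHS]to_PP_repr; apply/to_PP_eqP; exists (hc p l)^-1.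
  by rewrite invr_eq0; apply/coord_openP.
by apply/rowP => i; rewrite E mxE mulrC.
Qed.

Lemma PP_inj w v l : set_val w ord0 l != 0 -> set_val v ord0 l != 0 ->
  (forall i, set_val w ord0 i * set_val v ord0 l = set_val v ord0 i * set_val w ord0 l) ->
  to_PP w = to_PP v.
Proof.
move=> wl vl H; apply/to_PP_eqP; exists (set_val v ord0 l / set_val w ord0 l).
  by rewrite mulf_neq0 ?invr_eq0.
by apply/rowP => i; rewrite mxE mulrAC [_ * set_val w _ _]mulrC H mulfK.
Qed.

Lemma open_PP (O : set PP) : open O = open (@to_PP R n @^-1` O). Proof. by []. Qed.

Lemma nz_coord_continuous i : continuous (fun w => set_val w ord0 i : C).
Proof.
move=> w; apply: (@continuous_comp _ _ _ (set_val : nzvec R n -> 'rV[C]_n.+1) (fun x => x ord0 i)).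
  exact: initial_continuous.
exact: coord_continuous.
Qed.

Lemma coord_open_open l : open (coord_open l : set PP).
Proof.
rewrite open_PP (_ : _ @^-1` _ = (fun w => set_val w ord0 l : C) @^-1` [set x | x != 0]).
  apply: open_comp; first by move=> w _; exact: nz_coord_continuous.
  apply/openCP => x x0; exists (nm x); first by rewrite nm_gt0.
  move=> w wx; apply: contraTneq wx => ->; rewrite sub0r nmN ltxx //.
apply/seteqP; split=> w /=; rewrite coord_openP; have [c c0 ->] := hc_to_PP w.
  by rewrite mulf_eq0 negb_or => /andP[].
by move=> h; rewrite mulf_neq0.
Qed.

Definition dom (c : R) l : set PP := [set p | forall i, nm (hc p i) <= c * nm (hc p l)].

Lemma dom_to_PP c l w : dom c l (to_PP w) <->
  forall i, nm (set_val w ord0 i) <= c * nm (set_val w ord0 l).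
Proof.
have [x x0 H] := hc_to_PP w; have nx : 0 < nm x by rewrite nm_gt0.
by split=> h i; have := h i; rewrite !H !nmM mulrCA ler_pM2l.
Qed.

Lemma closed_dom c l : closed (dom c l).
Proof.
rewrite -[dom c l]setCK; apply: open_closedC; rewrite open_PP.
have -> : @to_PP R n @^-1` (~` dom c l) = ~` (\bigcap_(i in [set: 'I_n.+1])
    ((fun w => c * nm (set_val w ord0 l) - nm (set_val w ord0 i) : R) @^-1` [set x | 0 <= x])).
  apply/seteqP; split=> w H K; apply: H.
    by apply/dom_to_PP => i; have := K i I; rewrite /= subr_ge0.
  by move=> i _ /=; rewrite subr_ge0; move/dom_to_PP: K; exact.
apply: closed_openC; apply: closed_bigI => i _; apply: closed_comp; last exact: closed_ge.
move=> w _; have h j : {for w, continuous (fun w => nm (set_val w ord0 j : C))}.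
  exact: (continuous_comp (@nz_coord_continuous j w) (@nm_continuous R _)).
by apply: cvgB (h i); apply: cvgM (h l); exact: cvg_cst.
Qed.

Lemma domP c l p : dom c l p -> coord_open l p /\ forall i, nm (co l i p) <= c.
Proof.
move=> h; have [j pj] := hc_neq0 p.
have pl : hc p l != 0.
  by apply/eqP => e; have := h j; rewrite e nm0 mulr0 leNgt nm_gt0 pj.
split; first by apply/coord_openP.
by move=> i; rewrite /co nmM nmV ler_pdivrMr ?nm_gt0.
Qed.

Lemma PP_nbhs (O : set PP) w : open O -> O (to_PP w) -> exists2 e : R, 0 < e &
  forall v, (forall i, nm (set_val v ord0 i - set_val w ord0 i) < e) -> O (to_PP v).
Proof.
rewrite open_PP => -[V oV VO] Ow.
have Vw : V (set_val w) by have : (set_val @^-1` V) w by rewrite VO.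
have /nbhs_ballP[e /= /posC[x x0 ->] H] : nbhs (set_val w) V by exact: open_nbhs_nbhs.
exists x => // v Hv; suff : (@to_PP R n @^-1` O) v by [].
rewrite -VO; apply: H; split=> [|i j]; first by rewrite -[0]/(rc 0) ltC_rc.
by rewrite ord1 /ball /= normE ltC_rc nmBC.
Qed.

End Coordinates.

Section Charts.
Context {R : realType} (n : nat) (D : set (CC R)) (oD : open D).
Local Notation C := (CC R).
Local Notation PP := (PP R n).
Implicit Types (f : Hol n D) (l i : 'I_n.+1) (z : C).

(** The homogeneous coordinates of a curve normalised by the [l]-th one. *)
Definition lft f l i : C -> C := valL_ 0 (fun z : D => co l i (curve f z)).
Definition pre f (A : set PP) : set C := curve_preimage (curve f) A.

Lemma valL_val (V : Type) (v : V) (h : D -> V) (z : D) : valL_ v h (set_val z) = h z.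
Proof. by have := congr1 (fun k => k z) (valLK v h). Qed.

Lemma lftE f l i (z : D) : lft f l i (set_val z) = co l i (curve f z).
Proof. exact: valL_val. Qed.

Lemma preP f A (z : D) : pre f A (set_val z) <-> A (curve f z).
Proof. by split=> [[y h /val_inj <-]|h] //; exists z. Qed.

Lemma pre_sub f A z : pre f A z -> exists2 y : D, set_val y = z & A (curve f y).
Proof. by move=> [y h <-]; exists y. Qed.

Lemma D_pt z : D z -> exists y : D, set_val y = z.
Proof. by move=> Dz; exists (SigSub (mem_set Dz)). Qed.

Lemma pre_open f (O : set PP) : open O -> open (pre f O).
Proof.
move=> oO; have [cf _] : holomorphic_curve (curve f) by exact: (set_valP f).
have [V oV VO] : open (curve f @^-1` O) by apply: open_comp => // z _; exact: cf.
rewrite (_ : pre f O = V `&` D); first exact: openI.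
apply/seteqP; split=> z.
  by move=> [y h <-]; split; [have : (curve f @^-1` O) y by []; rewrite -VO | exact: set_valP].
move=> [Vz /D_pt[y yz]]; exists y => //; rewrite -VO /=; by rewrite yz.
Qed.

Lemma lft_hol f l i z : pre f (coord_open l) z -> hol (lft f l i) z.
Proof.
move=> pz; have [d d0 Hd] := (openCP _).1 (@pre_open f _ (@coord_open_open R n l)) z pz.
have [_ hf] : holomorphic_curve (curve f) by exact: (set_valP f).
have near g (hg : hol g z) : (forall w, pre f (coord_open l) w -> g w = lft f l i w) -> hol (lft f l i) z.
  move=> E; apply: (hol_near d0 _ hg) => h hd; apply: E; apply: Hd.
  by rewrite addrAC subrr add0r.
case: (unliftP l i) => [j ij|il].
  apply: (near _ (hf l j z pz)) => w /pre_sub[y <- hy].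
  by rewrite valL_val lftE chartE ij.
apply: (near (fun=> 1)); first by apply/holP; exists 0; exact: rdiff_cst.
by move=> w /pre_sub[y <- hy]; rewrite lftE il co_ll.
Qed.

End Charts.

(** * A compact set of curves *)

Section Compactness.
Context {R : realType} (n : nat) (D : set (CC R)) (oD : open D).
Local Notation C := (CC R).
Local Notation PP := (PP R n).
Local Notation Hol := (Hol n D).
Variables (r c : D -> R).
Hypothesis r0 : forall z0, 0 < r z0.
Hypothesis c0 : forall z0, 0 <= c z0.
Hypothesis rD : forall z0 z, nm (z - set_val z0) <= r z0 -> D z.

Definition star (z0 : D) l (f : Hol) :=
  forall z : D, nm (set_val z - set_val z0) <= r z0 -> dom (c z0) l (curve f z).
Definition stars : set Hol := [set f | forall z0, exists l, star z0 l f].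

Lemma eval_closed (z : D) (A : set PP) : closed A -> closed [set f : Hol | A (curve f z)].
Proof.
move=> cA; rewrite (_ : [set _ | _] = ~` [set f : Hol | (~` A) (curve f z)]).
  apply: open_closedC.
  exists [set g : {compact-open, D -> PP} | g @` [set z] `<=` ~` A].
    by apply: compact_open_open; [exact: compact_set1 | exact: closed_openC].
  apply/seteqP; split=> f /=; first by move=> h; apply: h; exists z.
  by move=> h _ [_ -> <-].
apply/seteqP; split=> f /=; first by move=> h; apply.
by move=> h; apply: contrapT.
Qed.

Lemma stars_closed : closed stars.
Proof.
rewrite (_ : stars = \bigcap_(z0 in [set: D]) \bigcup_(l in [set: 'I_n.+1])
   \bigcap_(z in [set z : D | nm (set_val z - set_val z0) <= r z0])
     [set f : Hol | dom (c z0) l (curve f z)]).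
  apply: closed_bigI => z0 _; apply: closed_bigcup; first exact: finite_finset.
  by move=> l _; apply: closed_bigI => z _; apply: eval_closed; exact: closed_dom.
apply/seteqP; split=> f.
  by move=> h z0 _; have [l H] := h z0; exists l => // z; exact: H.
by move=> h z0; have [l _ H] := h z0 I; exists l => z zr; exact: H.
Qed.

Section Limit.
Variables (U : set_system Hol).
Hypotheses (UU : UltraFilter U) (US : U stars).
Let FU : Filter U := @filter_filter _ _ (@ultra_proper _ _ UU).

Let pt0 (z0 : D) : nm (set_val z0 - set_val z0) < r z0. Proof. by rewrite subrr nm0. Qed.

Lemma dominating_index : exists L : D -> 'I_n.+1, forall z0, U [set f | star z0 (L z0) f].
Proof.
have /choice[L HL] : forall z0, exists l, U [set f | star z0 l f]; last by exists L.
move=> z0; apply: (U_pigeon UU (A := fun l => [set f | star z0 l f])).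
by apply: filterS US => f /(_ z0).
Qed.

Variable L : D -> 'I_n.+1.
Hypothesis HL : forall z0, U [set f | star z0 (L z0) f].

Lemma star_lft z0 f i z : star z0 (L z0) f -> nm (z - set_val z0) < r z0 ->
  [/\ pre f (coord_open (L z0)) z, hol (lft f (L z0) i) z & nm (lft f (L z0) i z) <= c z0].
Proof.
move=> st zr; have [y yz] := D_pt (rD (ltW zr)).
have [h1 h2] := domP (st y (eq_ind_r (fun x => nm (x - _) <= _) (ltW zr) yz)).
have pz : pre f (coord_open (L z0)) z by exists y.
split; [exact: pz | exact: (lft_hol oD pz) | rewrite -yz lftE; exact: h2].
Qed.

Lemma limit_coordinates : exists Y : D -> 'I_n.+1 -> C -> C,
  forall z0 i, ul_family U (set_val z0) (r z0) (c z0) (fun f => lft f (L z0) i) (Y z0 i).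
Proof.
have /choice[Y HY] : forall p : D * 'I_n.+1 * C, exists y : C, nm (p.2 - set_val p.1.1) < r p.1.1 ->
    ul U (fun f => lft f (L p.1.1) p.1.2 p.2) y.
  move=> [[z0 i] z]; have [zr|zr] := pselect (nm (z - set_val z0) < r z0); last by exists 0.
  have K : U [set f | nm (lft f (L z0) i z) <= c z0].
    by apply: filterS (HL z0) => f st; have [_ _ h] := star_lft i st zr; exact: h.
  by have [y uy] := ul_ex UU K; exists y => _; exact: uy.
exists (fun z0 i z => Y (z0, i, z)) => z0 i; split=> //; last first.
  by move=> z zr; exact: (HY (z0, i, z) zr).
apply: filterS (HL z0) => f st; split=> z zr; have [_ h1 h2] := star_lft i st zr; [exact: h1 | exact: h2].
Qed.

Variable Y : D -> 'I_n.+1 -> C -> C.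
Hypothesis HY : forall z0 i,
  ul_family U (set_val z0) (r z0) (c z0) (fun f => lft f (L z0) i) (Y z0 i).

Lemma Y_lim z0 i z : nm (z - set_val z0) < r z0 -> ul U (fun f => lft f (L z0) i z) (Y z0 i z).
Proof. by have [_ _ _ h] := HY z0 i; exact: h. Qed.

Lemma Y_hol z0 i z : nm (z - set_val z0) < r z0 -> hol (Y z0 i) z.
Proof. by have [h _] := ul_family_derive UU (HY z0 i); exact: h. Qed.

Lemma Y1 z0 z : nm (z - set_val z0) < r z0 -> Y z0 (L z0) z = 1.
Proof.
move=> zr; apply: (ul_unique UU (Y_lim (L z0) zr)).
have := ul_cst UU (1 : C); apply: (ul_eq UU); apply: filterS (HL z0) => f st /=.
by have [/pre_sub[y <- h] _ _] := star_lft (L z0) st zr; rewrite lftE co_ll.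
Qed.

Lemma limit_vector : exists W : D -> C -> nzvec R n, forall z0 z,
  nm (z - set_val z0) < r z0 -> forall i, set_val (W z0 z) ord0 i = Y z0 i z.
Proof.
have /choice[W HW] : forall p : D * C, exists w : nzvec R n, nm (p.2 - set_val p.1) < r p.1 ->
    forall i, set_val w ord0 i = Y p.1 i p.2.
  move=> [z0 z]; have [zr|zr] := pselect (nm (z - set_val z0) < r z0).
    have [|w Hw] := vec_PP (y := fun i => Y z0 i z).
      by exists (L z0); rewrite (Y1 zr) oner_eq0.
    by exists w => _; exact: Hw.
  have [|w Hw] := @vec_PP R n (fun _ => 1); first by exists ord0; rewrite oner_eq0.
  by exists w => /zr.
by exists (fun z0 z => W (z0, z)) => z0 z zr; exact: (HW (z0, z) zr).
Qed.

Variable W : D -> C -> nzvec R n.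
Hypothesis HW : forall z0 z, nm (z - set_val z0) < r z0 ->
  forall i, set_val (W z0 z) ord0 i = Y z0 i z.

Definition limit_map (z : D) : PP := to_PP (W z (set_val z)).

(** The local limits agree, as the transition formula passes to the limit. *)
Lemma limit_mapE (z0 z : D) : nm (set_val z - set_val z0) < r z0 ->
  limit_map z = to_PP (W z0 (set_val z)).
Proof.
move=> zr; set x := set_val z.
have T i : Y z0 i x = Y z i x * Y z0 (L z) x.
  apply: (ul_unique UU (Y_lim i zr)).
  have := ulM UU (Y_lim i (pt0 z)) (Y_lim (L z) zr); apply: (ul_eq UU).
  apply: filterS (HL z) => f st /=.
  have [/pre_sub[y e h] _ _] := star_lft i st (pt0 z).
  by rewrite -e !lftE; apply/esym/co_change.
have Yz : Y z0 (L z) x != 0.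
  apply/eqP => e; have := T (L z0); rewrite (Y1 zr) e mulr0 => /eqP.
  by rewrite oner_eq0.
apply: (@PP_inj _ _ _ _ (L z)).
- by rewrite (HW (pt0 z)) (Y1 (pt0 z)) oner_eq0.
- by rewrite (HW zr).
by move=> i; rewrite !(HW (pt0 z)) !(HW zr) (Y1 (pt0 z)) mulr1 [RHS]T.
Qed.

Lemma Y_near z0 (e : R) : 0 < e -> \forall x \near (set_val z0 : C),
  forall i, nm (Y z0 i x - Y z0 i (set_val z0)) < e.
Proof.
move=> e0; have FF : Filter (nbhs (set_val z0 : C)) := nbhs_filter _.
apply: (@filter_forall C 'I_n.+1 (fun i x => nm (Y z0 i x - Y z0 i (set_val z0)) < e) _ FF) => i.
have e2 : 0 < e / 2 by rewrite divr_gt0.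
have [d d0 Hd] := (ctnCP _ _).1 (hol_ctn (@Y_hol z0 i _ (pt0 z0))) _ e2.
by apply/nbhsCP; exists d => // w /Hd; lra.
Qed.

Lemma ball_near z0 : \forall x \near (set_val z0 : C), nm (x - set_val z0) < r z0.
Proof. by apply/nbhsCP; exists (r z0). Qed.

Lemma limit_map_continuous : continuous limit_map.
Proof.
move=> z A nA.
have [V0 [oO Oz] OA] : exists2 V0, open_nbhs (limit_map z) V0 & V0 `<=` A by move: nA; rewrite nbhsE.
have [e e0 He] := PP_nbhs oO Oz.
have cv : set_val y @[y --> z] --> (set_val z : C) by exact: initial_continuous.
have FF : Filter (nbhs (set_val z : C)) := nbhs_filter _.
have H : nbhs z [set y : D | (forall i, nm (Y z i (set_val y) - Y z i (set_val z)) < e) /\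
    nm (set_val y - set_val z) < r z] := cv _ (filterI (Y_near z e0) (ball_near z)).
suff K : [set y : D | (forall i, nm (Y z i (set_val y) - Y z i (set_val z)) < e) /\
    nm (set_val y - set_val z) < r z] `<=` limit_map @^-1` A.
  have G : nbhs z (limit_map @^-1` A) := @filterS _ (nbhs z) (nbhs_filter z) _ _ K (H FF).
  exact: G.
move=> y [h1 h2]; apply: OA; rewrite /= (limit_mapE h2); apply: He => i.
by rewrite (HW h2) (HW (pt0 z)); exact: h1.
Qed.

Lemma limit_map_holomorphic : holomorphic_curve limit_map.
Proof.
split; first exact: limit_map_continuous.
move=> l j _ [z hz <-]; set x := set_val z.
have Yl : Y z l x != 0.
  move/coord_openP: hz => /=; rewrite /limit_map; have [k k0 ->] := hc_to_PP (W z x).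
  by rewrite (HW (pt0 z)) mulf_eq0 negb_or => /andP[].
have hq : hol (fun w => Y z (lift l j) w / Y z l w) x.
  have h i := hol_rdiff (@Y_hol z i _ (pt0 z)).
  apply/holP; eexists; apply: rdiff_eq (rdiffM (h (lift l j)) (rdiffV Yl (h l))) _ _; first reflexivity.
  by rewrite oppr0 !mul0r mulr0 addr0.
apply: (hol_near (r0 z) _ hq) => h hr.
have xr : nm (x + h - set_val z) < r z by rewrite addrAC subrr add0r.
have [y yx] := D_pt (rD (ltW xr)); rewrite -yx in xr *.
rewrite valL_val chartE (limit_mapE xr) co_to_PP.
by rewrite !(HW xr).
Qed.

Definition limit_curve : Hol := SigSub (mem_set (limit_map_holomorphic :
  [set f : {compact-open, D -> PP} | holomorphic_curve f] limit_map)).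

(** A compact set on which the convergence fails would contain a limit point
    of bad points, contradicting equicontinuity there. *)
Lemma limit_uniform (K : set D) (O : set PP) : compact K -> open O -> limit_map @` K `<=` O ->
  U [set f : Hol | curve f @` K `<=` O].
Proof.
move=> cK oO KO; have [//|N] := U_or UU [set f : Hol | curve f @` K `<=` O]; exfalso.
have [f0 Hf0] := U_ex UU N; have [z1 _] : exists z1, K z1 /\ ~ O (curve f0 z1).
  by apply: contrapT => /forallNP H; apply: Hf0 => _ [z Kz <-]; apply: contrapT => ?; exact: (H z).
have /choice[b Hb] : forall f : Hol, exists z, ~ (curve f @` K `<=` O) -> K z /\ ~ O (curve f z).
  move=> f; have [h|h] := pselect (curve f @` K `<=` O); first by exists z1.
  apply: contrapT => /forallNP H; apply: h => _ [z Kz <-]; apply: contrapT => Oz.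
  by apply: (H z).
have bK : U [set f | K (b f)] by apply: filterS N => f /Hb[].
have [p [Kp clp]] := cK (b @ U) (fmap_proper_filter b (@ultra_proper _ _ UU)) bK.
have Op : O (to_PP (W p (set_val p))) by apply: KO; exists p.
have [e e0 He] := PP_nbhs oO Op.
have /choice[d Hd] : forall i, exists d, 0 < d /\ U [set f | forall z,
    nm (z - set_val p) < d -> nm (lft f (L p) i z - Y p i (set_val p)) < e].
  by move=> i; have [d ? ?] := ul_unif UU (HY p i) e0; exists d.
pose B : set D := [set y | (forall i, nm (set_val y - set_val p) < d i) /\
  nm (set_val y - set_val p) < r p].
have nB : nbhs p B.
  have cv : set_val y @[y --> p] --> (set_val p : C) by exact: initial_continuous.
  have nd : \forall x \near (set_val p : C), forall i, nm (x - set_val p) < d i.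
    have FF : Filter (nbhs (set_val p : C)) := nbhs_filter _.
    apply: (@filter_forall C 'I_n.+1 (fun i x => nm (x - set_val p) < d i) _ FF) => i.
    by apply/nbhsCP; exists (d i); [exact: (Hd i).1 | ].
  exact: cv _ (filterI nd (ball_near p)).
have bB : U [set f | B (b f)].
  have [//|M] := U_or UU [set f | B (b f)].
  by have [y [h1 h2]] := clp _ _ (M : (b @ U) (~` B)) nB.
have Ud := U_all UU (fun i => (Hd i).2).
have [f [[[h1 h2] h3] h4]] := U_ex UU (filterI (filterI (filterI N bB) Ud) (HL p)).
have [_] := Hb f h1; apply.
have [h5 h6] := h2; have [/pre_sub[y /val_inj yb hy] _ _] := star_lft ord0 h4 h6.
rewrite -yb; have [w Ew ->] := co_vec hy; apply: He => i.
by rewrite Ew (HW (pt0 p)) -lftE yb; apply: h3; exact: h5.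
Qed.

Lemma limit_cvg : U --> limit_curve.
Proof.
have cv : ((set_val @ U) : set_system {compact-open, D -> PP}) -->
    (limit_map : {compact-open, D -> PP}).
  by apply/compact_open_cvgP => K O cK oO KO; exact: limit_uniform cK oO KO.
move=> A; rewrite nbhsE; case=> O [[V oV VO] Of] OA.
have VF : nbhs (limit_map : {compact-open, D -> PP}) V.
  by apply: open_nbhs_nbhs; split=> //; have : (set_val @^-1` V) limit_curve by rewrite VO.
have H := cv _ VF; apply: (@filterS _ U FU _ _ _ H) => f Vf; apply: OA; rewrite -VO; exact: Vf.
Qed.

End Limit.

(** An ultrafilter converges to the curve glued from its local limits. *)
Lemma stars_compact : compact stars.
Proof.
rewrite compact_ultra => U UU US; have [L HL] := dominating_index UU US.
have [Y HY] := limit_coordinates UU HL; have [W HW] := limit_vector UU HL HY.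
have cv : U --> limit_curve UU HL HY HW by exact: limit_cvg.
exists (limit_curve UU HL HY HW); split; last exact: cv.
have := stars_closed; rewrite closedE => /(_ (limit_curve UU HL HY HW)); apply => M.
by have /(U_not UU US) := cv _ M.
Qed.

End Compactness.

(** * Local estimates for the family *)

Section GeneralPosition.
Context {R : realType} (n : nat).
Local Notation C := (CC R).
Variable a : 'I_(2 * n + 1) -> 'rV[C]_n.+1.

Lemma general_position_vec : general_position a ->
  forall S : {set 'I_(2 * n + 1)}, #|S| = n.+1 ->
  forall c : 'rV[C]_n.+1, (forall k, k \in S -> pairing (a k) c = 0) -> c = 0.
Proof.
move=> gp S cS c H; apply/eqP/negPn/negP => c0; have [w Ew] := nzvec_mk c0.
have : (\bigcap_(k in [set` S]) hyperplane (a k)) (to_PP w).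
  by move=> k kS; exists w => //; rewrite /= Ew; exact: H.
by rewrite gp.
Qed.

Lemma coord_vec : (forall (k : 'I_(2 * n + 1)) (l : 'I_n.+1),
    k = l :> nat -> hyperplane (a k) = coord_hyperplane l) ->
  forall (k : 'I_(2 * n + 1)) (l : 'I_n.+1), k = l :> nat ->
  forall c : 'rV[C]_n.+1, c ord0 l = 0 -> pairing (a k) c = 0.
Proof.
move=> ac k l kl c cl; have [->|c0] := eqVneq c 0.
  by rewrite /pairing big1 // => i _; rewrite mxE mulr0.
have [w Ew] := nzvec_mk c0.
have [v /= pv /to_PP_eqP[x x0 e]] : hyperplane (a k) (to_PP w).
  by rewrite (ac k l kl); exists w => //=; rewrite Ew.
rewrite -Ew e; transitivity (x * pairing (a k) (set_val v)); last by rewrite pv mulr0.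
by rewrite /pairing mulr_sumr; apply: eq_bigr => i _; rewrite mxE mulrCA.
Qed.

End GeneralPosition.

Section Local.
Context {R : realType} (n : nat) (D : set (CC R)) (oD : open D).
Local Notation C := (CC R).
Local Notation PP := (PP R n).
Implicit Types (f g : Hol n D) (l i : 'I_n.+1) (z : C).
Variables (F : set (Hol n D)) (a : 'I_(2 * n + 1) -> 'rV[C]_n.+1).
Hypothesis gp : general_position a.
Hypothesis ac : forall (k : 'I_(2 * n + 1)) (l : 'I_n.+1),
  k = l :> nat -> hyperplane (a k) = coord_hyperplane l.
Hypothesis hyp_a : forall f g, F f -> F g -> forall k : 'I_(2 * n + 1), (k < n.+1)%N ->
  pre f (hyperplane (a k)) = pre g (hyperplane (a k)).
Hypothesis hyp_b : forall K : set (CC R), compact K -> K `<=` D ->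
  exists2 M : R, 0 < M &
  forall f, F f -> forall l : 'I_n.+1,
  let U := curve_preimage (curve f) (coord_open l) in
  U !=set0 ->
  forall ft : CC R -> 'rV[CC R]_n.+1,
    reduced_rep (curve f) U ft ->
    (forall z, U z -> ft z ord0 l = 1) ->
  forall k : 'I_(2 * n + 1), (n.+1 <= k)%N ->
  forall q : nat, (1 <= q <= n)%N ->
  forall z, (curve_preimage (curve f) (hyperplane (a k)) `&` K `&` U) z ->
    `|derive1n q (pullback ft (a k)) z| <= (M%:C)%C :> CC R.

Lemma shared_zeros f g l (z : D) : F f -> F g -> hc (curve f z) l = 0 -> hc (curve g z) l = 0.
Proof.
move=> Ff Fg h; have le1 : (n.+1 <= 2 * n + 1)%N by lia.
have E := hyp_a Ff Fg (k := widen_ord le1 l) (ltn_ord l).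
rewrite !(ac (l := l)) // in E.
have : pre f (coord_hyperplane l) (set_val z) by apply/preP/coord_hyperplaneP.
by rewrite E => /preP/coord_hyperplaneP.
Qed.

Lemma lft_eq0 f l i (z : D) : coord_open l (curve f z) ->
  (lft f l i (set_val z) = 0 <-> hc (curve f z) i = 0).
Proof.
move=> /coord_openP h; rewrite lftE /co; split=> [/eqP|->]; last by rewrite mul0r.
by rewrite mulf_eq0 invr_eq0 (negbTE h) orbF => /eqP.
Qed.

(** The quotients in the normalised estimate are the components of the reduced
    representation for the coordinate [l]. *)
Lemma reduced_rep_lft f l : reduced_rep (curve f) (pre f (coord_open l)) (fun z => \row_i lft f l i z).
Proof.
split.
- exact: (@pre_open _ _ _ oD f _ (@coord_open_open R n l)).
- by move=> z /pre_sub[y <- _]; exact: set_valP.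
- move=> i z pz; rewrite (_ : (fun _ => _) = lft f l i); last by apply/funext => w; rewrite mxE.
  exact: (@lft_hol _ _ _ oD f l i z pz).
move=> z /preP h; have [w Ew ->] := co_vec h; exists w => //.
by apply/rowP => i; rewrite Ew mxE lftE.
Qed.

Lemma lft_quot f l0 l i z : pre f (coord_open l0) z -> pre f (coord_open l) z ->
  lft f l i z = lft f l0 i z / lft f l0 l z.
Proof.
move=> /pre_sub[y <- h0] /preP h; rewrite !lftE (co_change l0 i h) mulfK //.
exact: co_neq0.
Qed.

Variables (f0 : Hol n D) (Ff0 : F f0) (z0 : D).

Lemma normalising_coordinate : exists l0 r1, 0 < r1 /\
  forall f, F f -> forall z, nm (z - set_val z0) < r1 -> pre f (coord_open l0) z.
Proof.
have [l0 hl0] := hc_neq0 (curve f0 z0).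
have p0 : pre f0 (coord_open l0) (set_val z0) by apply/preP/coord_openP.
have [r1 r10 H] := (openCP _).1 (@pre_open _ _ _ oD f0 _ (@coord_open_open R n l0)) _ p0.
exists l0, r1; split=> // f Ff z zr; have /pre_sub[y <- /coord_openP hy] := H z zr.
by apply/preP/coord_openP; apply/eqP => /(shared_zeros Ff Ff0) e; rewrite e eqxx in hy.
Qed.

(** The zeros of the components are those of the coordinates, hence shared by
    all the curves, and they are isolated for one of them. *)
Lemma isolated_zeros l0 r1 : 0 < r1 ->
  (forall f, F f -> forall z, nm (z - set_val z0) < r1 -> pre f (coord_open l0) z) ->
  exists r2, 0 < r2 <= r1 /\ forall f, F f -> forall i,
    (forall z, nm (z - set_val z0) < r2 -> lft f l0 i z = 0) \/
    (forall z, 0 < nm (z - set_val z0) < r2 -> lft f l0 i z != 0).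
Proof.
move=> r10 H.
have hb i : hol_ball (set_val z0) r1 (lft f0 l0 i) by move=> z zr; exact: (@lft_hol _ _ _ oD f0 l0 i z (H _ Ff0 z zr)).
have /choice[e He] : forall i, exists e, 0 < e <= r1 /\
    ((forall z, nm (z - set_val z0) < e -> lft f0 l0 i z = 0) \/
     (forall z, 0 < nm (z - set_val z0) < e -> lft f0 l0 i z != 0)).
  move=> i; have [h|[d dr h]] := isolated_zero r10 (hb i); last by exists d; split=> //; right.
  by exists r1; rewrite r10 lexx; split=> //; left.
have [i0 _ Hi0] := @arg_minP _ R _ ord0 xpredT e isT.
exists (e i0); split; first exact: (He i0).1.
have /andP[_ er] := (He i0).1.
move=> f Ff i; have le := Hi0 i isT; have [_ [h|h]] := He i; [left=> z zr | right=> z /andP[z_0 zr]].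
  have zr1 := lt_le_trans zr er; have /pre_sub[y yz h1] := H _ Ff z zr1.
  have /preP h2 : pre f0 (coord_open l0) (set_val y) by apply: H => //; rewrite yz.
  rewrite -yz; apply/(lft_eq0 i h1)/(shared_zeros Ff0 Ff)/(lft_eq0 i h2).
  by rewrite yz; apply: h; exact: lt_le_trans zr le.
have zr1 := lt_le_trans zr er; have /pre_sub[y yz h1] := H _ Ff z zr1.
have /preP h2 : pre f0 (coord_open l0) (set_val y) by apply: H => //; rewrite yz.
have := h z; rewrite z_0 (lt_le_trans zr le) => /(_ isT); rewrite -yz; apply: contraNN => /eqP.
by move=> /(lft_eq0 i h1)/(shared_zeros Ff Ff0)/(lft_eq0 i h2) ->.
Qed.

Lemma derivative_bound l0 r1 (s M : R) f : F f -> 0 < s -> s <= r1 ->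
  (forall z, nm (z - set_val z0) < r1 -> pre f (coord_open l0) z) ->
  (forall l : 'I_n.+1,
    let U := curve_preimage (curve f) (coord_open l) in
    U !=set0 ->
    forall ft : CC R -> 'rV[CC R]_n.+1,
      reduced_rep (curve f) U ft ->
      (forall z, U z -> ft z ord0 l = 1) ->
    forall k : 'I_(2 * n + 1), (n.+1 <= k)%N ->
    forall q : nat, (1 <= q <= n)%N ->
    forall z, (curve_preimage (curve f) (hyperplane (a k)) `&` square (set_val z0) s `&` U) z ->
      `|derive1n q (pullback ft (a k)) z| <= (M%:C)%C :> CC R) ->
  forall l (k : 'I_(2 * n + 1)) q z,
  (n < k)%N -> (1 <= q <= n)%N -> nm (z - set_val z0) < s -> lft f l0 l z != 0 ->
  \sum_i a k ord0 i * lft f l0 i z = 0 ->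
  nm (derive1n q (fun w => (\sum_i a k ord0 i * lft f l0 i w) / lft f l0 l w) z) <= M.
Proof.
move=> Ff s0 sr H hb l k q z nk hq zs lz Sz.
have zr := lt_le_trans zs sr; have [y yz h0] := pre_sub (H z zr).
have hl : coord_open l (curve f y).
  by apply/coord_openP; apply: contraNneq lz => e; rewrite -yz; apply/eqP/(lft_eq0 l h0).
have pl : pre f (coord_open l) z by exists y.
have hk : pre f (hyperplane (a k)) z.
  exists y => //; apply/hyperplaneP; transitivity (hc (curve f y) l0 * \sum_i a k ord0 i * lft f l0 i z).
    rewrite mulr_sumr; apply: eq_bigr => i _; rewrite -yz lftE /co mulrCA.
    by rewrite [hc _ l0 * _]mulrC divfK //; apply/coord_openP.
  by rewrite Sz mulr0.
have ne : curve_preimage (curve f) (coord_open l) !=set0 by exists z.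
have ft1 w : pre f (coord_open l) w -> (\row_i lft f l i w) ord0 l = 1.
  by move=> /pre_sub[x <- hx]; rewrite mxE lftE co_ll.
have := hb l ne _ (reduced_rep_lft f l) ft1 k nk q hq z (conj (conj hk (ball_square (ltW zs))) pl).
rewrite normE -/(rc M) leC_rc; apply: le_trans; rewrite le_eqVlt; apply/orP; left; apply/eqP.
have [d d0 Hd] := (openCP _).1 (@pre_open _ _ _ oD f _ (@coord_open_open R n l)) _ pl.
congr (nm _); apply: (@derive1n_near _ q _ _ z (Num.min d (r1 - nm (z - set_val z0)))).
  by rewrite lt_min d0 subr_gt0.
move=> w; rewrite lt_min => /andP[wd wr].
have wr1 : nm (w - set_val z0) < r1.
  have -> : w - set_val z0 = (w - z) + (z - set_val z0) by ring.
  by apply: le_lt_trans (nmD _ _) _; lra.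
rewrite /pullback /pairing mulr_suml; apply: eq_bigr => i _.
by rewrite mxE (lft_quot i (H w wr1) (Hd w wd)) mulrA.
Qed.

(** [local_bound] bounds the spherical derivatives of the lifts, so [dominant]
    applies with the same radius to all the curves. *)
Lemma star_near : exists r c : R, [/\ 0 < r, 0 <= c,
  (forall z, nm (z - set_val z0) <= r -> D z) &
  forall f, F f -> exists l, forall z : D, nm (set_val z - set_val z0) <= r -> dom c l (curve f z)].
Proof.
have [l0 [r1 [r10 H1]]] := normalising_coordinate.
have [r2 [/andP[r20 r21] H2]] := isolated_zeros r10 H1.
pose s := r2 / 4; have s0 : 0 < s by rewrite divr_gt0.
have s4 : 4 * s = r2 by rewrite /s mulrC divfK.
have inD z : nm (z - set_val z0) < r1 -> D z by move=> /(H1 _ Ff0)/pre_sub[y <- _]; exact: set_valP.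
have sD : square (set_val z0) s `<=` D by move=> z /square_ball h; apply: inD; lra.
have [M _ HM] := hyp_b (@compact_square R (set_val z0) s) sD.
pose Phi : set ('I_n.+1 -> C -> C) := [set lft f l0 | f in F].
have P1 phi : Phi phi -> forall i, hol_ball (set_val z0) s (phi i).
  by move=> [f Ff <-] i z zs; apply: (@lft_hol _ _ _ oD f l0 i z); apply: H1 => //; lra.
have P2 phi : Phi phi -> forall z, nm (z - set_val z0) < s -> phi l0 z = 1.
  move=> [f Ff <-] z zs; have zr : nm (z - set_val z0) < r1 by lra.
  have [y <- hy] := pre_sub (H1 f Ff z zr).
  by rewrite lftE co_ll.
have P3 phi : Phi phi -> forall i, (forall z, nm (z - set_val z0) < s -> phi i z = 0) \/
    (forall z, 0 < nm (z - set_val z0) < s -> phi i z != 0).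
  move=> [f Ff <-] i; have [h|h] := H2 f Ff i; [left=> z zs|right=> z /andP[z1 zs]]; apply: h; first lra.
  by rewrite z1 /=; lra.
have P4 phi : Phi phi -> forall l (k : 'I_(2 * n + 1)) q z,
    (n < k)%N -> (1 <= q <= n)%N -> nm (z - set_val z0) < s -> phi l z != 0 ->
    \sum_i a k ord0 i * phi i z = 0 ->
    nm (derive1n q (fun w => (\sum_i a k ord0 i * phi i w) / phi l w) z) <= M.
  move=> [f Ff <-]; have sr : s <= r1 by lra.
  exact: (derivative_bound Ff s0 sr (H1 f Ff) (HM f Ff)).
have [A HA] := local_bound (general_position_vec gp) (coord_vec ac) s0 P1 P2 P3 P4.
pose k : R := `|A| + 1 + 4 / s.
have k1 : `|A| + 1 <= k by rewrite lerDl divr_ge0 // ltW.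
have k0 : 0 <= k by apply: le_trans k1; rewrite addr_ge0.
have Ak : A <= k ^+ 2.
  apply: le_trans (ler_norm A) _; have := normr_ge0 A; nra.
have cr0 := chain_radius_gt0 n k0; set d := chain_radius n k in cr0.
have ds : d <= s / 4.
  have m1 : 1 <= dimR n :> R by rewrite /dimR ler1n.
  have ks : 4 / s <= k + 1 by rewrite /k; have := normr_ge0 A; lra.
  have p4 : 0 < 4 / s by rewrite divr_gt0.
  rewrite -[s / 4]invrK invf_div /d /chain_radius lef_pV2 ?posrE //; last first.
    by rewrite !mulr_gt0 ?exprn_gt0 //; lra.
  by apply: le_trans ks _; rewrite ler_peMl //; [lra | have := exprn_ege1 2 m1; lra].
have m0 : 1 <= dimR n :> R by rewrite /dimR ler1n.
exists (d / 2), (2 * (dimR n : R)); split.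
- by rewrite divr_gt0.
- lra.
- by move=> z zd; apply: inD; lra.
move=> f Ff; have Pf : Phi (lft f l0) by exists f.
have Hc w : nm (w - set_val z0) < d ->
    [/\ forall i, hol (lft f l0 i) w, sph (lft f l0) w <= k ^+ 2 & 0 < sq (lft f l0) w].
  move=> wd; split.
  - by move=> i; apply: (P1 _ Pf); lra.
  - by apply: le_trans Ak; apply: (HA _ Pf); lra.
  have e : lft f l0 l0 w = 1 by apply: (P2 _ Pf); lra.
  by have := nm_le_sq (lft f l0) w l0; rewrite e nm1 expr1n; lra.
have [l Hl] := max_component (lft f l0) (set_val z0).
exists l => z zd i; have zd' : nm (set_val z - set_val z0) < d by lra.
have Hz := dominant k0 Hc Hl zd'.
have : nm (lft f l0 i (set_val z)) <= 2 * dimR n * nm (lft f l0 l (set_val z)).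
  have m20 : 1 <= 2 * dimR n :> R by lra.
  have Y0 : 0 <= 2 * dimR n * nm (lft f l0 l (set_val z)).
    by rewrite mulr_ge0 ?nm_ge0 //; lra.
  rewrite -ler_sqr ?nnegrE ?nm_ge0 //; apply: le_trans (nm_le_sq _ _ i) (le_trans Hz _).
  by rewrite exprMn ler_wpM2r ?sqr_ge0 // expr2 ler_peMl //; lra.
have /preP/coord_openP h0 : pre f (coord_open l0) (set_val z) by apply: H1 => //; lra.
by rewrite !lftE /co !nmM nmV mulrA ler_pM2r // invr_gt0 nm_gt0.
Qed.

End Local.

Theorem theorem1p2 (R : realType) (n : nat) (n_ge1 : (1 <= n)%N)
  (D : set (CC R)) (D_domain : is_domain D)
  (F : set (Hol n D))
  (a : 'I_(2 * n + 1) -> 'rV[CC R]_n.+1)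
  (a_neq0 : forall k, a k != 0)
  (a_gp : general_position a)
  (a_coord : forall (k : 'I_(2 * n + 1)) (l : 'I_n.+1),
     k = l :> nat -> hyperplane (a k) = coord_hyperplane l)
  (hyp_a : forall f g, F f -> F g ->
     forall k : 'I_(2 * n + 1), (k < n.+1)%N ->
       curve_preimage (curve f) (hyperplane (a k)) = curve_preimage (curve g) (hyperplane (a k)))
  (hyp_b : forall K : set (CC R), compact K -> K `<=` D ->
     exists2 M : R, 0 < M &
     forall f, F f -> forall l : 'I_n.+1,
     let U := curve_preimage (curve f) (coord_open l) in
     U !=set0 ->
     forall ft : CC R -> 'rV[CC R]_n.+1,
       reduced_rep (curve f) U ft ->
       (forall z, U z -> ft z ord0 l = 1) ->
     forall k : 'I_(2 * n + 1), (n.+1 <= k)%N ->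
     forall q : nat, (1 <= q <= n)%N ->
     forall z, (curve_preimage (curve f) (hyperplane (a k)) `&` K `&` U) z ->
       `|derive1n q (pullback ft (a k)) z| <= (M%:C)%C :> CC R) :
  normal_family F.
Proof.
have [_ oD _] := D_domain.
have [[f0 Ff0]|/set0P/negP/negPn/eqP F0] := pselect (F !=set0); last first.
  by exists set0; [rewrite F0 | split; [exact: compact0 | exact: closed0]].
have /choice[p Hp] : forall z0 : D, exists p : R * R, [/\ 0 < p.1, 0 <= p.2,
    (forall z, nm (z - set_val z0) <= p.1 -> D z) &
    forall f, F f -> exists l, forall z : D, nm (set_val z - set_val z0) <= p.1 -> dom p.2 l (curve f z)].
  by move=> z0; have [r [c h]] := star_near oD a_gp a_coord hyp_a hyp_b Ff0 z0; exists (r, c).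
pose r z0 := (p z0).1; pose c z0 := (p z0).2.
have r0 z0 : 0 < r z0 by have [] := Hp z0.
have c0 z0 : 0 <= c z0 by have [] := Hp z0.
have rD z0 z : nm (z - set_val z0) <= r z0 -> D z by have [_ _ h _] := Hp z0; exact: h.
exists (stars r c).
  by move=> f Ff z0; have [_ _ _ h] := Hp z0; exact: h f Ff.
by split; [exact: stars_compact | exact: stars_closed].
Qed.
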